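(* Let $(\bar x,\bar\lambda)=(\bar x^1,\dots,\bar x^N,\bar\lambda^1,\dots,\bar\lambda^N)\in S_{\rm KKT}(\bar p)$. Then $S_{\rm KKT}$ has a Lipschitz continuous single-valued localization around $\bar p$ for $(\bar x,\bar\lambda)$ if and only if both of the following hold: (i) the LICQ holds for each player $k$ at $(\bar p^k,\bar x^k)$, $k=1,\dots,N$; (ii) for every partition $(J_1,J_2,J_3)\in\mathcal I$ and every $y=(y^1,\dots,y^N)\in K(J_1,J_2)$, $$\begin{pmatrix}\nabla^2_{x^1x^1}L^1&\cdots&(\nabla^2_{x^Nx^1}L^N)^{\mathrm T}\\ \vdots&&\vdots\\ (\nabla^2_{x^1x^N}L^1)^{\mathrm T}&\cdots&\nabla^2_{x^Nx^N}L^N\end{pmatrix}\begin{pmatrix}y^1\\ \vdots\\ y^N\end{pmatrix}\in K(J_1,J_2)^\circ\ \Longrightarrow\ y=0,$$ where the $(k,i)$ block of the matrix is $(\nabla^2_{x^ix^k}L^i)^{\mathrm T}$ and $K^\circ$ denotes the polar cone $\{z\in\mathbb R^n:\langle z,y\rangle\le 0\ \forall y\in K\}$.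
   Context: Nash equilibrium problem (NEP) with canonical perturbations. There are $N$ players; player $k$ has strategy $x^k\in\mathbb R^{n_k}$; $x=(x^1,\dots,x^N)\in\mathbb R^n$, $n=n_1+\cdots+n_N$; $x^{-k}$ denotes the other players' strategies. Parameters: $p^k=(u^k,v^k,w^k)\in\mathbb R^{m_k}\times\mathbb R^{n_k}\times\mathbb R^{d_k}$, $p=(p^1,\dots,p^N)$, identified with $(u,v,w)\in\mathbb R^{m}\times\mathbb R^n\times\mathbb R^d$, $m=\sum m_k$, $d=\sum d_k$. Given $x^{-k},p^k$, player $k$ solves $$\min_{x^k}\ f^k(x^k,x^{-k};w^k)-\langle v^k,x^k\rangle\ \text{ s.t. } g^k_i(x^k;w^k)=u^k_i\ (i=1,\dots,s_k),\ \ g^k_j(x^k;w^k)\le u^k_j\ (j=s_k+1,\dots,m_k),$$ with $f^k\in C^2(\mathbb R^n\times\mathbb R^{d_k})$, $g^k_i\in C^2(\mathbb R^{n_k}\times\mathbb R^{d_k})$. Lagrangian: $L^k(x^k,x^{-k},\lambda^k;w^k)=f^k(x^k,x^{-k};w^k)+\sum_{i=1}^{m_k}\lambda^k_ig^k_i(x^k;w^k)$. KKT mapping: $S_{\rm KKT}(p)$ is the set of $(x,\lambda)\in\mathbb R^n\times\mathbb R^m$ such that for each $k$: $v^k=\nabla_{x^k}L^k(x^k,x^{-k},\lambda^k;w^k)$; $g^k_i(x^k;w^k)=u^k_i$ for $i\le s_k$; and $\lambda^k_j\ge0$, $g^k_j(x^k;w^k)\le u^k_j$, $\lambda^k_j(g^k_j(x^k;w^k)-u^k_j)=0$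 for $j>s_k$. Notation at $(\bar p,\bar x,\bar\lambda)\in{\rm gph}\,S_{\rm KKT}$: $\nabla^2_{x^kx^i}L^k\in\mathbb R^{n_k\times n_i}$ is the matrix of second partials $\partial^2L^k/\partial x^k_a\partial x^i_b$ evaluated at $(\bar x^k,\bar x^{-k},\bar\lambda^k;\bar w^k)$. Index sets: $I^k_1=\{1,\dots,s_k\}\cup\{i\in[s_k+1,m_k]:\bar\lambda^k_i>0=g^k_i(\bar x^k;\bar w^k)-\bar u^k_i\}$, $I^k_2=\{i\in[s_k+1,m_k]:\bar\lambda^k_i=0=g^k_i(\bar x^k;\bar w^k)-\bar u^k_i\}$, $I^k_3=\{i\in[s_k+1,m_k]:\bar\lambda^k_i=0>g^k_i(\bar x^k;\bar w^k)-\bar u^k_i\}$. $\mathcal I$ is the set of all $(J_1,J_2,J_3)$ with $J_l=\prod_{k=1}^NJ^k_l$ (the collection of the $J_l^k$), where for each $k$ the sets $J^k_1,J^k_2,J^k_3$ partition $\{1,\dots,m_k\}$ with $I^k_1\subset J^k_1\subset I^k_1\cup I^k_2$ and $I^k_3\subset J^k_3\subset I^k_2\cup I^k_3$. For such a partition, $K(J_1,J_2)=\{y=(y^1,\dots,y^N)\in\mathbb R^n:\nabla_{x^k}g^k_i(\bar x^k;\bar w^k)^{\mathrm T}y^k=0\ \forall i\in J^k_1,\ \nabla_{x^k}g^k_i(\bar x^k;\bar w^k)^{\mathrm T}y^k\le0\ \forall i\in J^k_2,\ k=1,\dots,N\}$. LICQ for player $k$ at $(\bar p^k,\bar x^k)$: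 the vectors $\nabla_{x^k}g^k_i(\bar x^k;\bar w^k)$, $i\in I^k_1\cup I^k_2$, are linearly independent. A set-valued mapping $\Phi$ has a Lipschitz continuous single-valued localization around $\bar a$ for $\bar b$ if $\bar b\in\Phi(\bar a)$ and there are neighborhoods $U$ of $\bar a$, $V$ of $\bar b$ such that ${\rm gph}\,\Phi\cap(U\times V)$ is the graph of a Lipschitz continuous single-valued mapping $U\to V$ (this is also called strong regularity of $\Phi$ at $\bar a$ for $\bar b$). *)

(* Defs.v *)
From HB Require Import structures.
From mathcomp Require Import all_boot all_order all_algebra.
From mathcomp Require Import all_classical all_reals all_analysis.

Set Implicit Arguments.
Unset Strict Implicit.
Unset Printing Implicit Defensive.

Import Order.TTheory GRing.Theory Num.Theory.
Import numFieldNormedType.Exports.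

Local Open Scope classical_set_scope.
Local Open Scope ring_scope.

Section Calculus.
Variable R : realType.

(* All the domains below are finite-dimensional, so continuity of
   z |-> 'd f z v for every fixed v is continuity of z |-> 'd f z. *)
Definition C1 (V : normedModType R) (f : V -> R) : Prop :=
  (forall z, differentiable f z) /\
  (forall v, continuous (fun z => 'd f z v)).

Definition C2 (V : normedModType R) (f : V -> R) : Prop :=
  C1 f /\ (forall v, C1 (fun z => 'd f z v)).

Definition partial n (f : 'cV[R]_n -> R) (i : 'I_n) (x : 'cV[R]_n) : R :=
  'D_(delta_mx i 0) f x.

Definition gradient n (f : 'cV[R]_n -> R) (x : 'cV[R]_n) : 'cV[R]_n :=
  \col_i partial f i x.

Definition hessian n (f : 'cV[R]_n -> R) (x : 'cV[R]_n) : 'M[R]_n :=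
  \matrix_(i, j) partial (partial f j) i x.

Definition dotv n (x y : 'cV[R]_n) : R := (x^T *m y) 0 0.

Definition polar n (K : set 'cV[R]_n) : set 'cV[R]_n :=
  [set z | forall y, K y -> dotv z y <= 0].

Definition gph (A B : Type) (Phi : A -> set B) : set (A * B) :=
  [set ab | Phi ab.1 ab.2].

Definition lipschitz_localization (A B : normedModType R)
    (Phi : A -> set B) (a : A) (b : B) : Prop :=
  Phi a b /\
  exists (U : set A) (V : set B), [/\ nbhs a U, nbhs b V &
    exists h : A -> B,
      gph Phi `&` (U `*` V) = [set (c, h c) | c in U] /\
      [lipschitz h c | c in U]].

End Calculus.

(* A point x of R^n, n = \sum_k n_k, is a column vector whose k-th block
   [submxcol x k] is the strategy x^k; multipliers and parameters are likewise
   stored blockwise. The objective f^k takes the full vector x, which stands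
   for (x^k, x^{-k}). *)
Record nep (R : realType) (N : nat) := Nep {
  nx : 'I_N -> nat;
  mc : 'I_N -> nat;
  dw : 'I_N -> nat;
  (* the constraints of player k with index (counted from 0) below [sc k] are
     equalities, the others inequalities *)
  sc : 'I_N -> nat;
  sc_le : forall k, (sc k <= mc k)%N;
  obj : forall k, 'cV[R]_(\sum_(i < N) nx i) -> 'cV[R]_(dw k) -> R;
  cstr : forall k, 'I_(mc k) -> 'cV[R]_(nx k) -> 'cV[R]_(dw k) -> R;
  obj_C2 : forall k,
    C2 (fun z : 'cV[R]_(\sum_(i < N) nx i) * 'cV[R]_(dw k) =>
          @obj k z.1 z.2);
  cstr_C2 : forall k (i : 'I_(mc k)),
    C2 (fun z : 'cV[R]_(nx k) * 'cV[R]_(dw k) => @cstr k i z.1 z.2)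
}.

Section NEP.
Variables (R : realType) (N : nat) (P : nep R N).

Local Notation strat := 'cV[R]_(\sum_(k < N) nx P k).
Local Notation mult := 'cV[R]_(\sum_(k < N) mc P k).
Local Notation wpar := 'cV[R]_(\sum_(k < N) dw P k).

(* A parameter p is the triple (u, v, w). *)
Definition ublk (p : mult * strat * wpar) k : 'cV[R]_(mc P k) :=
  submxcol p.1.1 k.
Definition vblk (p : mult * strat * wpar) k : 'cV[R]_(nx P k) :=
  submxcol p.1.2 k.
Definition wblk (p : mult * strat * wpar) k : 'cV[R]_(dw P k) :=
  submxcol p.2 k.

Definition lagrangian k (x : strat) (lam : 'cV[R]_(mc P k))
    (w : 'cV[R]_(dw P k)) : R :=
  obj x w + \sum_(i < mc P k) lam i 0 * cstr i (submxcol x k) w.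

Definition grad_lagrangian k (x : strat) (lam : 'cV[R]_(mc P k))
    (w : 'cV[R]_(dw P k)) : 'cV[R]_(nx P k) :=
  submxcol (gradient (fun x' => lagrangian x' lam w) x) k.

Definition S_KKT (p : mult * strat * wpar) : set (strat * mult) :=
  [set z | forall k : 'I_N,
     let x := z.1 in let lam := submxcol z.2 k in
     let g i := cstr i (submxcol x k) (wblk p k) in
     [/\ vblk p k = grad_lagrangian x lam (wblk p k),
         (forall i : 'I_(mc P k), (i < sc P k)%N -> g i = ublk p k i 0) &
         (forall j : 'I_(mc P k), (sc P k <= j)%N ->
            [/\ 0 <= lam j 0, g j <= ublk p k j 0 &
                lam j 0 * (g j - ublk p k j 0) = 0])]].

Section AtReferencePoint.
Variables (p : mult * strat * wpar) (z : strat * mult).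

Local Notation lam k := (submxcol z.2 k : 'cV[R]_(mc P k)).

Definition slack k (i : 'I_(mc P k)) : R :=
  cstr i (submxcol z.1 k) (wblk p k) - ublk p k i 0.

Definition I1 k : {set 'I_(mc P k)} :=
  finset (fun i : 'I_(mc P k) =>
    (i < sc P k)%N || [&& (sc P k <= i)%N, 0 < lam k i 0 & slack i == 0]).

Definition I2 k : {set 'I_(mc P k)} :=
  finset (fun i : 'I_(mc P k) =>
    [&& (sc P k <= i)%N, lam k i 0 == 0 & slack i == 0]).

Definition I3 k : {set 'I_(mc P k)} :=
  finset (fun i : 'I_(mc P k) =>
    [&& (sc P k <= i)%N, lam k i 0 == 0 & slack i < 0]).

(* The members of a partition may be empty. *)
Definition index_partition (J1 J2 J3 : forall k, {set 'I_(mc P k)}) : Prop :=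
  forall k,
    [/\ J1 k :|: J2 k :|: J3 k = [set: 'I_(mc P k)]%SET,
        [/\ J1 k :&: J2 k = finset.set0, J1 k :&: J3 k = finset.set0 &
            J2 k :&: J3 k = finset.set0],
        (I1 k \subset J1 k) && (J1 k \subset I1 k :|: I2 k) &
        (I3 k \subset J3 k) && (J3 k \subset I2 k :|: I3 k)].

Definition grad_cstr k (i : 'I_(mc P k)) : 'cV[R]_(nx P k) :=
  gradient (fun xk => cstr i xk (wblk p k)) (submxcol z.1 k).

Definition LICQ k : Prop :=
  free [seq grad_cstr i | i <- enum (I1 k :|: I2 k)].

Definition Kcone (J1 J2 : forall k, {set 'I_(mc P k)}) : set strat :=
  [set y | forall k,
     (forall i, i \in J1 k -> dotv (grad_cstr i) (submxcol y k) = 0) /\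
     (forall i, i \in J2 k -> dotv (grad_cstr i) (submxcol y k) <= 0)].

(* the n_k x n_i matrix of the second derivatives of L^k in (x^k, x^i) *)
Definition hess_lagrangian k i : 'M[R]_(nx P k, nx P i) :=
  submxblock
    (hessian (fun x => lagrangian x (lam k) (wblk p k)) z.1) k i.

Definition critical_matrix : 'M[R]_(\sum_(k < N) nx P k) :=
  \mxblock_(k < N, i < N) (hess_lagrangian i k)^T.

End AtReferencePoint.
End NEP.

(* Main.v *)
(* The KKT conditions of all players form one system for (x, lambda).  With
   xi = lambda + (g - u), the positive part of xi being lambda on the inequality
   indices, it becomes a piecewise smooth equation H(x, xi) = 0, the Kojima
   equation, and strong regularity asks for a Lipschitz inverse of H.

   Sufficiency.  Increments of H are, up to small errors, given by matrices M_t
   with t in a face of the cube [0,1]^m, and det M_t is affine in each t_i.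
   Conditions (i) and (ii) say that det M_t is nonzero when at most one t_i is
   fractional; hence the sign is the same at all vertices of the face, and by
   multi-affinity det M_t never vanishes.  The M_t form a compact convex set of
   invertible matrices, so Clarke's argument applies: H is injective with
   Lipschitz inverse because |M_t v| >= c |v| uniformly, and a minimiser of
   |H|^2 over a small ball is a zero.

   Necessity.  Failure of (i) or (ii) yields (y, eta) <> 0 with
   J^T y + G^T eta = 0 and compatible signs on the degenerate indices, which
   contradicts the Lipschitz bound at suitable nearby parameters.

   Under the linear independence (i), (ii) is equivalent to the nonexistence of
   such (y, eta), by computing the polar of K(J_1, J_2); the matrix in (ii) is
   J^T by symmetry of second derivatives. *)
Require Import Defs.
From HB Require Import structures.
From mathcomp Require Import all_boot all_order all_algebra.
From mathcomp Require Import all_classical all_reals all_analysis.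
From mathcomp Require Import ring lra.

Set Implicit Arguments.
Unset Strict Implicit.
Unset Printing Implicit Defensive.

Import Order.TTheory GRing.Theory Num.Theory.
Import numFieldNormedType.Exports.

Local Open Scope classical_set_scope.
Local Open Scope ring_scope.

(** * Determinants on a cube and the matrices of the Kojima map *)

Section MultiaffineCube.
Variables (R : realFieldType) (m : nat).
Implicit Types (t : 'cV[R]_m) (i : 'I_m) (a : R).

(** Why edges of the cube, and why a transpose: a row vector (y, eta) with (y, eta) M_t = 0
    satisfies J^T y + G^T eta = 0 and t_i (G y)_i = (1 - t_i) eta_i. So (G y)_i = 0 where t_i = 1,
    eta_i = 0 where t_i = 0, and both have the same sign where t_i is fractional. The partition
    condition wants them negative there, and the only freedom is one global sign of (y, eta). That
    repairs one fractional index but not two, so singularity can be excluded directly only along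
    edges; multi-affinity has to carry it inside.

    The rows of J come from the Lagrangians of different players, so J is not symmetric and
    solutions are not minimisers of a common potential; what is minimised is the residual.
    Derivatives are strict, with both points moving, because the mean-value matrices must serve
    every pair of points near the reference.

    For necessity the canonical perturbations matter: moving (u, v) by s (eta, y) and pairing the
    linearised system with (eta, y) itself produces s (|y|^2 + |eta|^2) against terms that are
    nonpositive or of small order. *)

Definition set_coord t i a : 'cV[R]_m :=
  \col_j (if j == i then a else t j 0).

Lemma set_coord_id t i : set_coord t i (t i 0) = t.
Proof. by apply/colP => j; rewrite !mxE; case: (j =P i) => // ->. Qed.

Definition cube_face (A1 A0 : pred 'I_m) : set 'cV[R]_m :=
  [set t | forall i, [/\ 0 <= t i 0 <= 1, A1 i -> t i 0 = 1 & A0 i -> t i 0 = 0]].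

Definition fractional t : {set 'I_m} :=
  finset (fun i => (t i 0 != 0) && (t i 0 != 1)).

Variables (A1 A0 : pred 'I_m) (f : 'cV[R]_m -> R).
Hypothesis f_affine : forall t i a,
  f (set_coord t i a) = a * f (set_coord t i 1) + (1 - a) * f (set_coord t i 0).
Hypothesis f_edge : forall t,
  cube_face A1 A0 t -> (#|fractional t| <= 1)%N -> f t != 0.

Lemma fractional_set_coord t i a :
  fractional (set_coord t i a) \subset (i |: fractional t)%SET.
Proof.
apply/fintype.subsetP => j; rewrite !inE !mxE.
by case: (j == i) => //.
Qed.

(** An affine function with opposite signs at the ends of an edge vanishes on it, and a point of an
    edge has at most one fractional coordinate, where [f_edge] forbids zeros. *)
Lemma edge_same_sign t i : cube_face A1 A0 t -> fractional t = finset.set0 ->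
  cube_face A1 A0 (set_coord t i 0) -> cube_face A1 A0 (set_coord t i 1) ->
  0 < f (set_coord t i 0) * f (set_coord t i 1).
Proof.
move=> Qt t01 Q0 Q1.
have card1 a : (#|fractional (set_coord t i a)| <= 1)%N.
  rewrite (leq_trans (subset_leq_card (fractional_set_coord t i a)))//.
  by rewrite t01 finset.setU0 cards1.
have n0 := f_edge Q0 (card1 0); have n1 := f_edge Q1 (card1 1).
rewrite ltNge; apply/negP => le0.
have {}lt0 : f (set_coord t i 0) * f (set_coord t i 1) < 0.
  by rewrite lt_neqAle le0 mulf_neq0.
set f0 := f _ in n0 lt0; set f1 := f _ in n1 lt0.
have d0 : f0 - f1 != 0.
  by apply/eqP => /eqP; rewrite subr_eq0 => /eqP e; move: lt0; rewrite e; nra.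
(* [f0 / (f0 - f1)] is the zero of the interpolation a f1 + (1 - a) f0. *)
have a01 : 0 <= f0 / (f0 - f1) <= 1.
  case: (ltgtP f0 f1) => [lt|lt|e]; last by move: d0; rewrite e subrr eqxx.
    rewrite -(opprB f1 f0) invrN mulrN -mulNr.
    by rewrite divr_ge0 ?ler_pdivrMr ?mul1r; nra.
  by rewrite divr_ge0 ?ler_pdivrMr ?mul1r; nra.
have Qa : cube_face A1 A0 (set_coord t i (f0 / (f0 - f1))).
  move=> j; move: (Q0 j) (Q1 j) (Qt j); rewrite /= !mxE.
  case: (j =P i) => // _ [_ h1 _] [_ _ h0] _; split=> //.
    by move/h1 => /eqP; rewrite eq_sym oner_eq0.
  by move/h0 => /eqP; rewrite oner_eq0.
move: (f_edge Qa (card1 _)); rewrite f_affine -/f0 -/f1 => /eqP; apply.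
by field.
Qed.

(** Induction on the number of coordinates in which the vertices differ: correcting one of them
    moves along an edge of the face. *)
Lemma vertex_same_sign t t' : cube_face A1 A0 t -> fractional t = finset.set0 ->
  cube_face A1 A0 t' -> fractional t' = finset.set0 -> 0 < f t * f t'.
Proof.
move=> Qt t01; have [k] := ubnP #|finset (fun i => t i 0 != t' i 0)|.
elim: k t' => // k IH t'; rewrite ltnS => le_k Qt' t'01.
have [D0|[i]] := set_0Vmem (finset (fun i => t i 0 != t' i 0)).
  have <- : t = t'.
    apply/colP => i; apply/eqP; apply/negPn/negP => ne.
    by move/finset.setP: D0 => /(_ i); rewrite !inE ne.
  by rewrite -expr2 exprn_even_gt0 //= f_edge // t01 cards0.
rewrite inE => ne.
have Qt'' : cube_face A1 A0 (set_coord t' i (t i 0)).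
  by move=> j; have := Qt' j; rewrite !mxE; case: (j =P i) => // ->.
have t''01 : fractional (set_coord t' i (t i 0)) = finset.set0.
  apply/finset.setP => j; move/finset.setP: t01 => /(_ j); move/finset.setP: t'01 => /(_ j).
  by rewrite !inE !mxE; case: (j =P i) => // ->.
have lt'' : 0 < f t * f (set_coord t' i (t i 0)).
  apply: IH => //; rewrite (leq_trans _ le_k)//; apply: proper_card.
  apply/fintype.properP; split.
    by apply/fintype.subsetP => j; rewrite !inE !mxE; case: (j =P i) => // ->; rewrite eqxx.
  by exists i; rewrite !inE ?mxE ?eqxx.
suff : 0 < f t' * f (set_coord t' i (t i 0)) by nra.
have v01 (s : 'cV[R]_m) : fractional s = finset.set0 -> s i 0 = 0 \/ s i 0 = 1.
  move/finset.setP/(_ i); rewrite !inE => /negbT; rewrite negb_and !negbK.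
  by case/orP => /eqP; [left|right].
have {1}-> : t' = set_coord t' i (t' i 0) by rewrite set_coord_id.
have Qi a : (a = t i 0 \/ a = t' i 0) -> cube_face A1 A0 (set_coord t' i a).
  by case=> ->//; rewrite set_coord_id.
have Q0t := Qi (t i 0); have Q0t' := Qi (t' i 0).
case: (v01 _ t01) (v01 _ t'01) => e [] e'; move: ne Q0t Q0t'; rewrite e e' ?eqxx// => _ Qa Qb.
  by rewrite mulrC; apply: edge_same_sign => //; [apply: Qa; left|apply: Qb; right].
by apply: edge_same_sign => //; [apply: Qb; right|apply: Qa; left].
Qed.

(** The induction, on the number of fractional coordinates, proves that [f t] has the sign of [f] at
    the vertex [t0]: [f t] is a convex combination of the values obtained by rounding one fractional
    coordinate to 0 and to 1. *)
Lemma cube_face_neq0 t : cube_face A1 A0 t -> f t != 0.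
Proof.
move=> Qt; pose t0 : 'cV[R]_m := \col_i (A1 i)%:R.
have t001 : fractional t0 = finset.set0.
  by apply/finset.setP => i; rewrite !inE !mxE; case: (A1 i); rewrite eqxx ?andbF.
have Qt0 : cube_face A1 A0 t0.
  move=> i; rewrite !mxE; case: (Qt i) => _ h1 h0; split.
  - by case: (A1 i); rewrite ?lexx ler01.
  - by move=> ->.
  - move=> A0i; case E : (A1 i) => //; have := h0 A0i.
    by rewrite (h1 E) => /eqP; rewrite oner_eq0.
suff : 0 < f t0 * f t by move=> lt; apply/eqP => e; move: lt; rewrite e mulr0 ltxx.
have [k] := ubnP #|fractional t|; elim: k t Qt => // k IH t Qt le_k.
have [F0|[i]] := set_0Vmem (fractional t); first exact: vertex_same_sign.
move=> iF; move: (iF); rewrite inE => /andP[i0 i1].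
have [/andP[ge0 le1] A1i A0i] := Qt i.
have Q' a : a = 0 \/ a = 1 -> 0 < f t0 * f (set_coord t i a).
  move=> a01; apply: IH.
    move=> j; have := Qt j; rewrite !mxE; case: (j =P i) => // -> _; split.
    - by case: a01 => ->; rewrite ?lexx ler01.
    - by move/A1i => e; rewrite e eqxx in i1.
    - by move/A0i => e; rewrite e eqxx in i0.
  rewrite -ltnS (leq_trans _ le_k)// ltnS; apply: proper_card; apply/fintype.properP; split.
    apply/fintype.subsetP => j; rewrite !inE !mxE; case: (j =P i) => // _.
    by case: a01 => ->; rewrite eqxx ?andbF.
  by exists i => //; rewrite !inE !mxE eqxx; case: a01 => ->; rewrite eqxx ?andbF.
rewrite -(set_coord_id t i) f_affine.
have := Q' 0 (or_introl erefl); have := Q' 1 (or_intror erefl).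
move: (f (set_coord _ _ 1)) (f (set_coord _ _ 0)) => f1 f0 h1 h0.
have {}ge0 : 0 < t i 0 by rewrite lt_neqAle eq_sym i0.
rewrite mulrDr !(mulrCA (f t0)); apply: ltr_wpDr; last by rewrite mulr_gt0.
by rewrite mulr_ge0 ?subr_ge0// ltW.
Qed.

End MultiaffineCube.

(** * Nonsingularity of the Kojima matrices over a face of the cube *)

Section MixedJacobian.
Variables (R : realFieldType) (n m : nat).
Variables (J : 'M[R]_n) (G : 'M[R]_(m, n)).

(* The mean-value matrices of the Kojima map
   (x, xi) |-> (F (x, xi^+), c x - xi^-): J and G are the derivatives of F and
   c in x, and t i in [0, 1] is the slope of the positive part in
   coordinate i. *)
Definition kojima_mx (t : 'cV[R]_m) : 'M[R]_(n + m) :=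
  block_mx J (G^T *m diag_mx t^T) G (diag_mx t^T - 1%:M).

(** The variable [t i] occurs only in column n + i; transposition turns it into a row, in which the
    determinant is linear. *)
Lemma det_kojima_affine t i a :
  \det (kojima_mx (set_coord t i a)) =
  a * \det (kojima_mx (set_coord t i 1)) +
  (1 - a) * \det (kojima_mx (set_coord t i 0)).
Proof.
rewrite -![\det (kojima_mx _)]det_tr.
have off b b' : row' (rshift n i) (kojima_mx (set_coord t i b))^T =
                row' (rshift n i) (kojima_mx (set_coord t i b'))^T.
  apply/matrixP => j k; rewrite [LHS]mxE [RHS]mxE.
  rewrite /kojima_mx !tr_block_mx.
  have : lift (rshift n i) j != rshift n i by rewrite eq_sym neq_lift.
  case: (splitP (lift (rshift n i) j)) => l el.
    have -> : lift (rshift n i) j = lshift m l by apply: val_inj.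
    by rewrite /block_mx !col_mxEu.
  have -> : lift (rshift n i) j = rshift n l by apply: val_inj.
  rewrite /block_mx !col_mxEd => ne.
  have {}ne : (l == i) = false by apply: contraNF ne => /eqP ->.
  case: (splitP k) => k' ek.
    have -> : k = lshift m k' by apply: val_inj.
    by rewrite !row_mxEl ![(_ *m _)^T _ _]mxE !mul_mx_diag !mxE ne.
  have -> : k = rshift n k' by apply: val_inj.
  rewrite !row_mxEr ![(_ - _)^T _ _]mxE ![(diag_mx _ - _) _ _]mxE ![diag_mx _ _ _]mxE.
  by case: eqP => [->|//]; rewrite !mxE ne.
apply: (@determinant_multilinear _ _ _ _ _ (rshift n i)) => //.
apply/rowP => k; rewrite [LHS]mxE [RHS]mxE ![fun_of_matrix (_ *: _) _ _]mxE ![row _ _ _ _]mxE.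
rewrite !tr_block_mx /block_mx !col_mxEd.
case: (splitP k) => k' ek.
  have -> : k = lshift m k' by apply: val_inj.
  rewrite !row_mxEl ![(_ *m _)^T _ _]mxE !mul_mx_diag !mxE eqxx.
  by rewrite mulr1 mulr0 mulr0 addr0 mulrC.
have -> : k = rshift n k' by apply: val_inj.
rewrite !row_mxEr ![(_ - _)^T _ _]mxE ![(diag_mx _ - _) _ _]mxE ![diag_mx _ _ _]mxE.
rewrite !mxE; case: (k' =P i) => [_|ne] /=; last by rewrite !mulr0n !oppr0 ?addr0 !mulr0 addr0.
by rewrite !mulr1n; ring.
Qed.

(** Off [A1] and [A0] lie the degenerate indices, and the three alternatives there stand for
    membership in J_1, J_3 and J_2. One pair thus accounts for all partitions at once; strict signs
    suffice in the last alternative because a zero falls under one of the others. *)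
Definition critical_pair (A1 A0 : pred 'I_m) (y : 'cV[R]_n) (eta : 'cV[R]_m) :=
  J^T *m y + G^T *m eta = 0 /\
  forall i, [/\ A1 i -> (G *m y) i 0 = 0, A0 i -> eta i 0 = 0 &
    [\/ (G *m y) i 0 = 0, eta i 0 = 0 | (G *m y) i 0 < 0 /\ eta i 0 < 0]].

Lemma kojima_mx_unit (A1 A0 : pred 'I_m) :
  (forall y eta, critical_pair A1 A0 y eta -> y = 0 /\ eta = 0) ->
  forall t, cube_face A1 A0 t -> kojima_mx t \in unitmx.
Proof.
move=> crit0 t Qt; rewrite unitmxE unitfE.
apply: (@cube_face_neq0 _ _ A1 A0 (fun t => \det (kojima_mx t))) Qt => {t}.
  exact: det_kojima_affine.
move=> t Qt frac1; apply/eqP => /eqP/det0P[v v0 vM].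
pose y0 : 'cV_n := (lsubmx v)^T; pose eta0 : 'cV_m := (rsubmx v)^T.
have vE : v = row_mx y0^T eta0^T by rewrite !trmxK hsubmxK.
move: y0 eta0 vE => y0 eta0 vE.
move: vM; rewrite vE mul_row_block -row_mx0 => /eq_row_mx[e1 e2].
have {e2} slope i : t i 0 * (G *m y0) i 0 = (1 - t i 0) * eta0 i 0.
  move/rowP: e2 => /(_ i); rewrite mulmxA -trmx_mul mulmxBr mulmx1 mul_mx_diag.
  by rewrite mul_mx_diag !mxE => h; nra.
have {e1} stat : J^T *m y0 + G^T *m eta0 = 0.
  by apply: trmx_inj; rewrite linearD /= !trmx_mul !trmxK trmx0.
(* At t_i = 1 or 0 the relation [slope] gives exact zeros; at a fractional index it makes eta_i
   negative together with (G y)_i. *)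
have key s : s ^+ 2 = 1 -> (forall i, i \in fractional t -> s * (G *m y0) i 0 <= 0) ->
    critical_pair A1 A0 (s *: y0) (s *: eta0).
  move=> s1 hs; split; first by rewrite -!scalemxAr -scalerDr stat scaler0.
  move=> i; have [/andP[ge0 le1] a1 a0] := Qt i; have sl := slope i.
  rewrite -scalemxAr !mxE; split.
  - by move/a1 => t1; move: sl; rewrite !mxE t1 subrr mul0r mul1r => ->; rewrite mulr0.
  - by move/a0 => t0; move: sl; rewrite t0 mul0r subr0 mul1r => <-; rewrite mulr0.
  have [/eqP F|F] := boolP (t i 0 == 0).
    by apply: Or32; move: sl; rewrite F mul0r subr0 mul1r => <-; rewrite mulr0.
  have [/eqP F1|F1] := boolP (t i 0 == 1).
    by apply: Or31; move: sl; rewrite !mxE F1 subrr mul0r mul1r => ->; rewrite mulr0.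
  have := hs i; rewrite inE F F1 => /(_ isT) le0.
  have t0 : 0 < t i 0 by rewrite lt_neqAle eq_sym F.
  have t1 : 0 < 1 - t i 0 by rewrite subr_gt0 lt_neqAle F1.
  have [Gy0|Gy0] := boolP ((G *m y0) i 0 == 0).
    by apply: Or31; move: Gy0; rewrite !mxE => /eqP ->; rewrite mulr0.
  have s0 : s != 0 by apply/eqP => s0; move: s1; rewrite s0 expr0n /= => /eqP; rewrite eq_sym oner_eq0.
  have lt0 : s * (G *m y0) i 0 < 0 by rewrite lt_neqAle le0 mulf_neq0.
  apply: Or33; split; first by rewrite !mxE in lt0.
  have : t i 0 * (s * (G *m y0) i 0) = (1 - t i 0) * (s * eta0 i 0).
    by rewrite !(mulrCA _ s) sl.
  by move: (s * eta0 i 0) (s * (G *m y0) i 0) lt0 => a b lt0 e; nra.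
(* A single fractional index dictates the sign [s]; two of them could demand opposite signs. *)
have [s s1 hs] : exists2 s : R, s ^+ 2 = 1 &
    forall i, i \in fractional t -> s * (G *m y0) i 0 <= 0.
  move: frac1; rewrite leq_eqVlt ltnS leqn0 cards_eq0 => /orP[/cards1P[i ->]|/eqP ->].
    case: (leP ((G *m y0) i 0) 0) => [le0|gt0].
      by exists 1; rewrite ?expr1n// => j; rewrite inE => /eqP ->; rewrite mul1r.
    exists (-1); first by rewrite sqrrN expr1n.
    by move=> j; rewrite inE => /eqP ->; rewrite mulN1r oppr_le0 ltW.
  by exists 1; rewrite ?expr1n// => j; rewrite inE.
have [/eqP y00 /eqP eta00] := crit0 _ _ (key s s1 hs).
have s0 : s == 0 = false.
  by apply/eqP => s0; move: s1; rewrite s0 expr0n /= => /eqP; rewrite eq_sym oner_eq0.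
rewrite !scaler_eq0 !s0 /= in y00 eta00.
by move: v0; rewrite vE (eqP y00) (eqP eta00) !trmx0 row_mx0 eqxx.
Qed.

End MixedJacobian.

(** * Norms and continuity of matrices *)

Section MatrixNorm.
Variable R : realType.

Lemma mx_entry_le_norm m n (A : 'M[R]_(m, n)) i j : `|A i j| <= `|A|.
Proof.
rewrite [leRHS]/Num.Def.normr/= mx_normrE.
by apply/bigmax_geP; right; exists (i, j).
Qed.

Lemma mx_norm_le m n (A : 'M[R]_(m, n)) c :
  0 <= c -> (forall i j, `|A i j| <= c) -> `|A| <= c.
Proof.
move=> c0 le_c; rewrite /Num.Def.normr/= mx_normrE.
by apply: bigmax_le => // -[i j] _; exact: le_c.
Qed.

(** The norm is the largest absolute entry, which is not submultiplicative; the factor is the inner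
    dimension. *)
Lemma mulmx_norm_le m n p (A : 'M[R]_(m, n)) (B : 'M[R]_(n, p)) :
  `|A *m B| <= n%:R * `|A| * `|B|.
Proof.
apply: mx_norm_le => [|i j]; first by rewrite !mulr_ge0.
rewrite mxE (le_trans (ler_norm_sum _ _ _))//.
have -> : n%:R * `|A| * `|B| = \sum_(k < n) `|A| * `|B|.
  by rewrite sumr_const card_ord -[RHS]mulr_natl mulrA.
by apply: ler_sum => k _; rewrite normrM ler_pM// mx_entry_le_norm.
Qed.

Lemma dotvE n (x y : 'cV[R]_n) : dotv x y = \sum_i x i 0 * y i 0.
Proof. by rewrite /dotv mxE; apply: eq_bigr => i _; rewrite mxE. Qed.

Lemma dotvC n (x y : 'cV[R]_n) : dotv x y = dotv y x.
Proof. by rewrite !dotvE; apply: eq_bigr => i _; rewrite mulrC. Qed.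

Lemma dotvDr n (x y z : 'cV[R]_n) : dotv x (y + z) = dotv x y + dotv x z.
Proof. by rewrite /dotv mulmxDr mxE. Qed.

Lemma dotvZr n a (x y : 'cV[R]_n) : dotv x (a *: y) = a * dotv x y.
Proof. by rewrite /dotv -scalemxAr mxE. Qed.

Lemma dotvNr n (x y : 'cV[R]_n) : dotv x (- y) = - dotv x y.
Proof. by rewrite /dotv mulmxN mxE. Qed.

Lemma dotvDl n (x y z : 'cV[R]_n) : dotv (x + y) z = dotv x z + dotv y z.
Proof. by rewrite dotvC dotvDr !(dotvC z). Qed.

Lemma dotvZl n a (x y : 'cV[R]_n) : dotv (a *: x) y = a * dotv x y.
Proof. by rewrite dotvC dotvZr dotvC. Qed.

Lemma dotv_trmx m n (A : 'M[R]_(m, n)) x y : dotv x (A *m y) = dotv (A^T *m x) y.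
Proof. by rewrite /dotv trmx_mul trmxK mulmxA. Qed.

Lemma dotv_norm_le n (x y : 'cV[R]_n) : `|dotv x y| <= n%:R * `|x| * `|y|.
Proof.
rewrite dotvE (le_trans (ler_norm_sum _ _ _))//.
have -> : n%:R * `|x| * `|y| = \sum_(k < n) `|x| * `|y|.
  by rewrite sumr_const card_ord -[RHS]mulr_natl mulrA.
by apply: ler_sum => k _; rewrite normrM ler_pM// mx_entry_le_norm.
Qed.

Lemma norm_sqr_le_dotv n (x : 'cV[R]_n) : `|x| ^+ 2 <= dotv x x.
Proof.
have dot_ge0 : 0 <= dotv x x by rewrite dotvE sumr_ge0// => i _; rewrite -expr2 sqr_ge0.
rewrite -(@ler_sqrt _ (`|x| ^+ 2))// sqrtr_sqr normr_id.
apply: mx_norm_le; first exact: sqrtr_ge0.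
move=> i j; rewrite ord1 -sqrtr_sqr ler_sqrt// dotvE (bigD1 i)//= -expr2 lerDl.
by rewrite sumr_ge0// => k _; rewrite -expr2 sqr_ge0.
Qed.

End MatrixNorm.

Section MatrixContinuity.
Variable R : realType.

Lemma mx_continuous_entries (T : topologicalType) m n (f : T -> 'M[R]_(m, n)) :
  (forall i j, continuous (fun t => f t i j)) -> continuous f.
Proof.
move=> cf t; apply/cvgrPdist_le => /= e e0.
have : \forall t' \near t, forall ij : 'I_m * 'I_n,
    `|f t ij.1 ij.2 - f t' ij.1 ij.2| <= e.
  apply: filter_forall => -[i j] /=.
  by have /cvgrPdist_le := cf i j t; apply.
apply: filterS => t' h; apply: mx_norm_le => [|i j]; first exact: ltW.
by rewrite !mxE; exact: (h (i, j)).
Qed.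

Lemma sum_continuous (T : topologicalType) (I : finType) (F : I -> T -> R) :
  (forall i, continuous (F i)) -> continuous (fun t => \sum_i F i t).
Proof.
by move=> cF; apply: continuous_big => //; exact: add_continuous.
Qed.

Lemma mulmx_continuous (T : topologicalType) m n p
    (f : T -> 'M[R]_(m, n)) (g : T -> 'M[R]_(n, p)) :
  continuous f -> continuous g -> continuous (fun t => f t *m g t).
Proof.
move=> cf cg; apply: mx_continuous_entries => i j.
rewrite (_ : (fun _ => _) = fun t => \sum_k f t i k * g t k j); last first.
  by apply/funext => t; rewrite mxE.
apply: sum_continuous => k t; apply: cvgM.
- exact: (cvg_comp f (fun M : 'M[R]_(m, n) => M i k) (cf t) (@coord_continuous _ _ _ i k (f t))).
- exact: (cvg_comp g (fun M : 'M[R]_(n, p) => M k j) (cg t) (@coord_continuous _ _ _ k j (g t))).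
Qed.

Lemma trmx_continuous m n : continuous (@trmx R m n).
Proof.
apply: mx_continuous_entries => i j.
rewrite (_ : (fun _ => _) = fun A : 'M[R]_(m, n) => A j i); first exact: coord_continuous.
by apply/funext => A; rewrite mxE.
Qed.

Lemma colvec_bounded_closed_compact n (A : set 'cV[R]_n) :
  bounded_set A -> closed A -> compact A.
Proof.
move=> bA cA.
have -> : A = trmx @` (trmx @^-1` A : set 'rV[R]_n).
  apply/seteqP; split=> [x Ax|_ [x + <-]//].
  by exists x^T; rewrite /= ?trmxK.
apply: continuous_compact.
  by apply: continuous_subspaceT => x; exact: trmx_continuous.
apply: bounded_closed_compact.
  case: bA => M [Mr hM]; exists M; split=> // M' /hM h x Ax.
  apply: le_trans (h _ Ax); apply: mx_norm_le => // i j.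
  by rewrite (le_trans _ (mx_entry_le_norm _ j i))// mxE.
by apply: preimage_closed => // x _; exact: trmx_continuous.
Qed.

End MatrixContinuity.

(** * Clarke's inverse function theorem *)

Section CompactMatrixFamily.
Variables (R : realType) (q : nat) (D : set 'M[R]_q).
Hypothesis compactD : compact D.

Lemma compact_mx_upper_bound :
  exists2 L : R, 0 < L & forall A, D A -> forall v : 'cV_q, `|A *m v| <= L * `|v|.
Proof.
have /ex_strict_bound_gt0[M M0 hM] : bounded_set D by exact: compact_bounded.
exists (q%:R * M + 1); first by rewrite ltr_wpDl// mulr_ge0// ltW.
move=> A DA v; rewrite (le_trans (mulmx_norm_le _ _))// ler_wpM2r//.
by rewrite ler_wpDr// ler_wpM2l// ltW// hM.
Qed.

Hypothesis unitD : forall A, D A -> A \in unitmx.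

(** The minimum of |A v| over [D] times the unit sphere is attained, and invertibility makes it
    positive; homogeneity extends the bound to all v. *)
Lemma compact_mx_lower_bound :
  exists2 c : R, 0 < c & forall A, D A -> forall v : 'cV_q, c * `|v| <= `|A *m v|.
Proof.
pose S := [set v : 'cV[R]_q | `|v| = 1].
have compactS : compact S.
  apply: colvec_bounded_closed_compact.
    by exists 1; split=> // M M1 x /= ->; exact: ltW.
  rewrite (_ : S = Num.norm @^-1` [set (1 : R)])//.
  apply: preimage_closed; first by move=> x _; exact: norm_continuous.
  exact: closed_eq.
have scale_unit v : v != 0 -> S (`|v|^-1 *: v).
  by move=> v0; rewrite /S/= normrZ normfV normr_id mulVf ?normr_eq0.
(* If the product is empty, only v = 0 is left: a nonzero v and a matrix of [D] would give a point
   of it. *)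
have [[x Dx]|D0] := pselect (D `*` S !=set0); last first.
  exists 1 => // A DA v; have [->|v0] := eqVneq v 0.
    by rewrite normr0 mulr0.
  by exfalso; apply: D0; exists (A, `|v|^-1 *: v); split=> //; exact: scale_unit.
have cont : continuous (fun x : 'M[R]_q * 'cV[R]_q => `|x.1 *m x.2|).
  move=> y; apply: cvg_norm; apply: mulmx_continuous => z; [exact: cvg_fst|exact: cvg_snd].
have [] := @compact_EVT_min _ R (fun x : 'M[R]_q * 'cV[R]_q => `|x.1 *m x.2|) (D `*` S).
- by exists x.
- exact: compact_setX.
- exact: continuous_subspaceT.
move=> [A0 v0] /set_mem[/= DA0 Sv0] minv; exists `|A0 *m v0|.
  rewrite normr_gt0; apply/eqP => A0v0.
  have : v0 = 0 by rewrite -(mulKmx (unitD DA0) v0) A0v0 mulmx0.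
  by move=> e; move: Sv0; rewrite /S/= e normr0 => /eqP; rewrite eq_sym oner_eq0.
move=> A DA v; have [->|vn0] := eqVneq v 0; first by rewrite normr0 mulr0.
have := minv (A, `|v|^-1 *: v); rewrite /= => /(_ _).
rewrite -scalemxAr normrZ normfV normr_id mulrC ler_pdivlMr ?normr_gt0//; apply.
by apply/mem_set; split=> //; exact: scale_unit.
Qed.

End CompactMatrixFamily.

Section Descent.
Variables (R : realType) (q : nat) (D : set 'M[R]_q).
Hypothesis D0 : D !=set0.
Hypothesis compactD : compact D.
Hypothesis unitD : forall A, D A -> A \in unitmx.
Hypothesis convexD : forall A B (s : R), D A -> D B -> 0 <= s <= 1 ->
  D (s *: A + (1 - s) *: B).

(* d is the element of least norm of the convex set {A^T r | A in D}. *)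
Lemma common_ascent_direction :
  exists2 k : R, 0 < k & forall r : 'cV_q, r != 0 -> exists2 d : 'cV_q, d != 0 &
    forall A, D A -> k * `|r| * `|d| <= dotv r (A *m d).
Proof.
have [|A [B DB <-]|k k0 lowk] := @compact_mx_lower_bound R q (trmx @` D).
- apply: continuous_compact => //.
  by apply: continuous_subspaceT => x; exact: trmx_continuous.
- by rewrite unitmx_tr; exact: unitD.
exists k => // r r0.
have cont : continuous (fun A : 'M[R]_q => dotv (A^T *m r) (A^T *m r)).
  move=> A; rewrite /dotv.
  have c1 : continuous (fun A : 'M[R]_q => A^T *m r).
    by apply: mulmx_continuous => B; [exact: trmx_continuous|exact: cst_continuous].
  have c2 : continuous (fun A : 'M[R]_q => (A^T *m r)^T *m (A^T *m r)).
    apply: mulmx_continuous => // B.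
    exact: (cvg_comp _ _ (c1 B) (@trmx_continuous _ _ _ _)).
  exact: (cvg_comp _ (fun M : 'M[R]_1 => M 0 0) (c2 A) (@coord_continuous _ _ _ 0 0 _)).
have [|A0 /set_mem DA0 minA0] :=
    @compact_EVT_min _ R (fun A : 'M[R]_q => dotv (A^T *m r) (A^T *m r)) D D0 compactD.
  exact: continuous_subspaceT.
pose d := A0^T *m r.
have lowd : k * `|r| <= `|d| by apply: lowk; exists A0.
have d0 : d != 0.
  by rewrite -normr_gt0 (lt_le_trans _ lowd)// mulr_gt0// normr_gt0.
exists d => // A DA; rewrite dotv_trmx.
(* Variational inequality for the point of least norm of a convex set: moving from [d] towards A^T r
   cannot shorten it. *)
have : dotv d d <= dotv (A^T *m r) d.
  rewrite leNgt; apply/negP => lt.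
  have [e Ee] : exists e, A^T *m r = d + e by exists (A^T *m r - d); rewrite addrC subrK.
  have quad (s : R) : 0 <= s <= 1 -> 0 <= 2 * s * dotv d e + s ^+ 2 * dotv e e.
    move=> s01; have := minA0 (s *: A + (1 - s) *: A0) (mem_set (convexD DA DA0 s01)).
    have -> : (s *: A + (1 - s) *: A0)^T *m r = d + s *: e.
      rewrite linearD/= !linearZ/= mulmxDl -!scalemxAl Ee -/d scalerDr scalerBl scale1r.
      by rewrite [s *: d + _]addrC addrACA subrr addr0 addrC.
    rewrite -/d !dotvDl !dotvDr !dotvZl !dotvZr (dotvC e d).
    rewrite -subr_ge0; congr (0 <= _).
    move: (dotv d d) (dotv d e) (dotv e e) => a b c; ring.
  move: lt; rewrite Ee dotvDl gtrDl (dotvC e) => lt.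
  have ee0 : 0 <= dotv e e by rewrite (le_trans _ (norm_sqr_le_dotv e))// sqr_ge0.
  move: (dotv d e) (dotv e e) lt ee0 quad => b c b0 c0 quad.
  have den : 0 < c - b by lra.
  (* For this s one has s c <= - b, hence 2 s b + s^2 c <= s b < 0, against [quad]. *)
  have s0 : 0 < - b / (c - b) by rewrite divr_gt0//; lra.
  have s1 : - b / (c - b) <= 1 by rewrite ler_pdivrMr//; lra.
  have := quad (- b / (c - b)); rewrite s1 (ltW s0) => /(_ isT).
  have sE : (- b / (c - b)) * (c - b) = - b by rewrite divfK// gt_eqF.
  by move: (- b / (c - b)) s0 s1 sE => s s0 s1 sE; rewrite leNgt => /negP; apply; nra.
apply: le_trans; rewrite (le_trans _ (norm_sqr_le_dotv d))//.
by rewrite expr2 ler_wpM2r.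
Qed.

End Descent.

Section InverseFunction.
Variables (R : realType) (q : nat) (D : set 'M[R]_q).
Hypothesis D0 : D !=set0.
Hypothesis compactD : compact D.
Hypothesis unitD : forall A, D A -> A \in unitmx.
Hypothesis convexD : forall A B (s : R), D A -> D B -> 0 <= s <= 1 ->
  D (s *: A + (1 - s) *: B).

(** The matrix may depend on both points and [f] need not be differentiable; [D] plays the role of
    Clarke's generalized Jacobian, up to the relative error [delta]. *)
Definition mean_value_family (f : 'cV[R]_q -> 'cV[R]_q) (z : 'cV[R]_q) (e delta : R) :=
  forall z1 z2 : 'cV_q, `|z1 - z| <= e -> `|z2 - z| <= e ->
  exists2 A, D A & `|f z1 - f z2 - A *m (z1 - z2)| <= delta * `|z1 - z2|.

(* Clarke's argument: a minimiser of |f|^2 over a closed ball is a zero,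
   because the common ascent direction of the family D at f z would otherwise
   give a descent direction. *)
Lemma mean_value_family_solve :
  exists2 delta : R, 0 < delta & exists2 K : R, 0 < K &
  forall f (z : 'cV_q) (e : R), 0 < e -> mean_value_family f z e delta ->
  (forall z1 z2 : 'cV_q, `|z1 - z| <= e -> `|z2 - z| <= e -> `|z1 - z2| <= K * `|f z1 - f z2|) /\
  (K * `|f z| < e -> exists2 z', `|z' - z| < e & f z' = 0).
Proof.
have [c c0 lowc] := compact_mx_lower_bound compactD unitD.
have [L L0 upL] := compact_mx_upper_bound compactD.
have [k k0 asc] := common_ascent_direction D0 compactD unitD convexD.
(* The bound c / 2 leaves half of the lower bound [c] for injectivity; the bound k / (2 (q + 1))
   keeps the error, amplified by the factor q of [dotv_norm_le], below half of the ascent rate. *)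
pose delta := Num.min (c / 2) (k / (2 * (q%:R + 1))).
have q0 : (0 : R) <= q%:R by [].
have delta0 : 0 < delta by rewrite lt_min !divr_gt0//; lra.
have dc : delta <= c / 2 by rewrite ge_min lexx.
have dk : delta * (2 * (q%:R + 1)) <= k.
  by rewrite -ler_pdivlMr ?ge_min ?lexx ?orbT//; lra.
(* The factor 2 / c comes from injectivity, and q + 2 bounds |f y| + |f z| by a multiple of |f z|
   for the minimiser y found below, which places y in the open ball. *)
exists delta => //; exists (2 / c * (q%:R + 2)).
  by rewrite mulr_gt0 ?divr_gt0//; lra.
move=> f z e e0 mv.
have lowf z1 z2 : `|z1 - z| <= e -> `|z2 - z| <= e ->
    `|z1 - z2| <= 2 / c * `|f z1 - f z2|.
  move=> /mv h /h{h}[A DA hA]; rewrite mulrAC ler_pdivlMr//.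
  have := lowc _ DA (z1 - z2); have := ler_distD (f z1 - f z2) (A *m (z1 - z2)) 0.
  rewrite !subr0 distrC; move: hA.
  move: `|_ - _ - A *m _| `|A *m _| `|f z1 - f z2| => x y w hx hxy hy.
  have : delta * `|z1 - z2| <= c / 2 * `|z1 - z2| by rewrite ler_wpM2r.
  by nra.
split=> [z1 z2 h1 h2|].
  rewrite (le_trans (lowf _ _ h1 h2))// ler_wpM2r// ler_peMr ?divr_ge0//; first exact: ltW.
  by lra.
move=> fz_small.
have lipf z1 z2 : `|z1 - z| <= e -> `|z2 - z| <= e ->
    `|f z1 - f z2| <= (L + delta) * `|z1 - z2|.
  move=> /mv h /h{h}[A DA hA].
  have -> : f z1 - f z2 = A *m (z1 - z2) + (f z1 - f z2 - A *m (z1 - z2)).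
    by rewrite [RHS]addrC subrK.
  by rewrite (le_trans (ler_normD _ _))// mulrDl lerD// upL.
pose B := [set y : 'cV[R]_q | `|y - z| <= e].
have compactB : compact B.
  apply: colvec_bounded_closed_compact.
    exists (e + `|z|); split; first exact: num_real.
    move=> M leM y /= By.
    rewrite -[y](subrK z) (le_trans (ler_normD _ _))// (le_trans _ (ltW leM))//.
    by rewrite lerD2r.
  rewrite (_ : B = (fun y => `|y - z|) @^-1` [set x | x <= e])//.
  apply: preimage_closed; last exact: closed_le.
  move=> y _; apply: (@cvg_norm _ _ _ (nbhs y) _ (fun y => y - z)).
  by apply: (@cvgB _ _ _ (nbhs y) _ id (cst z)); [exact: cvg_id|exact: cvg_cst].
have cont : {within B, continuous (fun y => dotv (f y) (f y))}.
  apply/subspace_continuousP => y By.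
  have dot_cont : continuous (fun v : 'cV[R]_q => dotv v v).
    move=> v; rewrite /dotv.
    have c2 : continuous (fun v : 'cV[R]_q => v^T *m v).
      by apply: mulmx_continuous => w; [exact: trmx_continuous|exact: cvg_id].
    exact: (cvg_comp _ (fun M : 'M[R]_1 => M 0 0) (c2 v) (@coord_continuous _ _ _ 0 0 _)).
  apply: (cvg_comp f _ _ (dot_cont (f y))).
  apply/cvgrPdist_le => /= x x0; rewrite near_withinE.
  near=> w => /= Bw; rewrite (le_trans (lipf _ _ By Bw))//.
  rewrite mulrC -ler_pdivlMr ?addr_gt0//.
  near: w; apply: (@cvgr_dist_le _ _ _ (nbhs y) _ id) => //.
  by rewrite divr_gt0// addr_gt0.
have zB : B z by rewrite /B/= subrr normr0 ltW.
have [y /set_mem By miny] := @compact_EVT_min _ R (fun y => dotv (f y) (f y)) B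
  (ex_intro _ z zB) compactB cont.
(* The minimum is taken for the Euclidean norm, while |f y| is the maximum norm; the comparison
   costs the factor q + 1. *)
have fy_small : `|f y| <= (q%:R + 1) * `|f z|.
  rewrite -(@ler_sqr _ `|f y|) ?nnegrE ?mulr_ge0 ?addr_ge0//.
  rewrite (le_trans (norm_sqr_le_dotv _))//.
  rewrite (le_trans (miny _ (mem_set zB)))// (le_trans (ler_norm _))//.
  rewrite (le_trans (dotv_norm_le _ _))// exprMn -mulrA -expr2 ler_wpM2r ?sqr_ge0//.
  by nra.
have yz : `|y - z| < e.
  apply: le_lt_trans fz_small; rewrite (le_trans (lowf _ _ By zB))//.
  rewrite -[leRHS]mulrA ler_wpM2l ?divr_ge0 ?(ltW c0)//.
  by rewrite (le_trans (ler_normB _ _))//; lra.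
exists y => //; apply/eqP/negPn/negP => fy0.
have [d d0 ascd] := asc _ fy0.
have nd : 0 < `|d| by rewrite normr_gt0.
have nf : 0 < `|f y| by rewrite normr_gt0.
(* The second-order term of the descent step is at most s^2 |d| M. The step [s] keeps y - s d in the
   ball and makes this term at most half of the first-order gain s k |f y| |d|. *)
pose M := q%:R * (L + delta) ^+ 2 * `|d| + 1.
have M0 : 0 < M by rewrite ltr_wpDl// mulr_ge0// mulr_ge0 ?sqr_ge0.
pose s := Num.min ((e - `|y - z|) / `|d|) (k * `|f y| / (2 * M)).
have s0 : 0 < s.
  by rewrite lt_min !divr_gt0 ?subr_gt0 ?mulr_gt0.
have sM : 2 * (s * M) <= k * `|f y|.
  by rewrite mulrCA -ler_pdivlMr ?mulr_gt0// ge_min lexx orbT.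
have Bs : B (y - s *: d).
  rewrite /B/= addrAC (le_trans (ler_normB _ _))// -lerBrDl normrZ gtr0_norm//.
  by rewrite -ler_pdivlMr// ge_min lexx.
have yys : y - (y - s *: d) = s *: d by rewrite opprB addrC subrK.
have [A DA] := mv _ _ By Bs; have := lipf _ _ By Bs; rewrite yys -scalemxAr.
have := miny _ (mem_set Bs).
have [h fsE] : exists h, f (y - s *: d) = f y - (s *: (A *m d) + h).
  by exists (f y - f (y - s *: d) - s *: (A *m d)); rewrite [_ + (_ - _)]addrC subrK subKr.
rewrite fsE !subKr [_ + h - _]addrAC subrr add0r normrZ gtr0_norm//.
have [g gE] : exists g, g = s *: (A *m d) + h by exists (s *: (A *m d) + h).
rewrite -gE => min_le lip_le h_le.
have e1 : dotv (f y - g) (f y - g) =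
    dotv (f y) (f y) - 2 * dotv (f y) g + dotv g g.
  rewrite dotvDl !dotvDr !dotvNr (dotvC (- g)) (dotvC (- g) g) !dotvNr.
  by ring.
have e2 : dotv (f y) g = s * dotv (f y) (A *m d) + dotv (f y) h.
  by rewrite gE dotvDr dotvZr.
have h1 := ascd _ DA.
have h2 : - (q%:R * `|f y| * `|h|) <= dotv (f y) h.
  by have := dotv_norm_le (f y) h; rewrite ler_norml => /andP[].
have h3 : dotv g g <= q%:R * `|g| * `|g|.
  by rewrite (le_trans (ler_norm _))// dotv_norm_le.
have h4 : `|g| * `|g| <= ((L + delta) * (s * `|d|)) * ((L + delta) * (s * `|d|)).
  by rewrite ler_pM.
have h5 : q%:R * (`|g| * `|g|) <= s ^+ 2 * `|d| * M.
  rewrite (le_trans (ler_wpM2l q0 h4))// /M.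
  have : 0 <= s ^+ 2 * `|d| by rewrite mulr_ge0// sqr_ge0.
  by rewrite !expr2; nra.
have h6 : q%:R * `|f y| * `|h| <= k / 2 * `|f y| * (s * `|d|).
  rewrite (@le_trans _ _ (q%:R * `|f y| * (delta * (s * `|d|))))//.
    by rewrite ler_wpM2l// mulr_ge0.
  have -> : q%:R * `|f y| * (delta * (s * `|d|)) = (q%:R * delta) * (`|f y| * (s * `|d|)).
    by ring.
  rewrite -[leRHS]mulrA ler_wpM2r ?mulr_ge0 ?(ltW s0)//.
  by nra.
have h7 : s * (k * `|f y| * `|d|) <= s * dotv (f y) (A *m d) by rewrite ler_wpM2l// ltW.
have h8 : s * `|d| * (2 * (s * M)) <= s * `|d| * (k * `|f y|).
  by rewrite ler_wpM2l// mulr_ge0// ltW.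
have pos : 0 < s * `|d| * (k * `|f y|) by rewrite !mulr_gt0.
rewrite e1 e2 in min_le.
move: min_le h2 h3 h5 h6 h7 h8 pos; rewrite expr2.
set X := dotv (f y) (A *m d); set Y := dotv (f y) h; set Z := dotv g g.
by clear; nra.
Unshelve. all: by end_near. Qed.

End InverseFunction.

(** * Dependence of the zero on a parameter *)

Section ImplicitFunction.
Variables (R : realType) (q : nat) (P : normedModType R) (D : set 'M[R]_q).
Hypothesis D0 : D !=set0.
Hypothesis compactD : compact D.
Hypothesis unitD : forall A, D A -> A \in unitmx.
Hypothesis convexD : forall A B (s : R), D A -> D B -> 0 <= s <= 1 ->
  D (s *: A + (1 - s) *: B).
Variables (H : 'cV[R]_q -> P -> 'cV[R]_q) (z0 : 'cV[R]_q) (p0 : P).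
Hypothesis H0 : H z0 p0 = 0.
Hypothesis H_mean : forall delta : R, 0 < delta -> exists2 e : R, 0 < e &
  forall p, `|p - p0| <= e -> mean_value_family D (H^~ p) z0 e delta.
Hypothesis H_lip : exists2 e : R, 0 < e & exists2 L : R, 0 < L &
  forall (z : 'cV_q) p1 p2, `|z - z0| <= e -> `|p1 - p0| <= e -> `|p2 - p0| <= e ->
  `|H z p1 - H z p2| <= L * `|p1 - p2|.

(** The solvability result applies at each p near p0 with the same radius and constants, since the
    residual at z0 is at most L |p - p0|. Injectivity gives uniqueness as well as the Lipschitz
    bound. *)
Lemma clarke_implicit_function :
  exists e rho M : R, exists h : P -> 'cV[R]_q, [/\ 0 < e, 0 < rho, 0 < M,
  forall p, `|p - p0| < rho -> [/\ `|h p - z0| < e, H (h p) p = 0 &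
    forall z, `|z - z0| < e -> H z p = 0 -> z = h p] &
  forall p1 p2, `|p1 - p0| < rho -> `|p2 - p0| < rho ->
    `|h p1 - h p2| <= M * `|p1 - p2|].
Proof.
have [delta delta0 [K K0 solve]] :=
  mean_value_family_solve D0 compactD unitD convexD.
have [e1 e10 mean] := H_mean delta0.
have [e2 e20 [L L0 lip]] := H_lip.
pose e := Num.min e1 e2.
have e0 : 0 < e by rewrite lt_min e10.
have ee1 : e <= e1 by rewrite ge_min lexx.
have ee2 : e <= e2 by rewrite ge_min lexx orbT.
pose rho := Num.min e (e / (K * L)).
have KL0 : 0 < K * L by rewrite mulr_gt0.
have rho0 : 0 < rho by rewrite lt_min e0 divr_gt0.
have sol p : `|p - p0| < rho ->
    (forall z1 z2, `|z1 - z0| <= e -> `|z2 - z0| <= e ->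
      `|z1 - z2| <= K * `|H z1 p - H z2 p|) /\
    exists2 z, `|z - z0| < e & H z p = 0.
  rewrite lt_min => /andP[pe pKL].
  have mv : mean_value_family D (H^~ p) z0 e delta.
    move=> z1 z2 h1 h2; apply: (mean p _ z1 z2 (le_trans h1 ee1) (le_trans h2 ee1)).
    exact: le_trans (ltW pe) ee1.
  have [inj ex] := solve _ _ _ e0 mv; split => //; apply: ex.
  rewrite -[H z0 p]subr0 -H0.
  have h : `|H z0 p - H z0 p0| <= L * `|p - p0|.
    by apply: lip; rewrite ?subrr ?normr0 ?(ltW e20)// (le_trans (ltW pe)).
  rewrite (le_lt_trans (ler_wpM2l (ltW K0) h))// mulrA.
  by rewrite mulrC -ltr_pdivlMr.
(* Outside the ball of radius [rho] the value of [h] is an arbitrary 0. *)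
have /choice[h hP] : forall p, exists z, `|p - p0| < rho -> `|z - z0| < e /\ H z p = 0.
  move=> p; have [/sol[_ [z]]|] := boolP (`|p - p0| < rho); first by exists z.
  by exists 0.
exists e, rho, (K * L), h; split=> //.
  move=> p pr; have [h1 h2] := hP p pr; split=> // z ze Hz.
  have [inj _] := sol p pr; apply/eqP; rewrite -subr_eq0 -normr_le0.
  by rewrite (le_trans (inj _ _ (ltW ze) (ltW h1)))// Hz h2 subrr normr0 mulr0.
move=> p1 p2 pr1 pr2; have [h1 h1'] := hP p1 pr1; have [h2 h2'] := hP p2 pr2.
have [inj _] := sol p1 pr1; rewrite (le_trans (inj _ _ (ltW h1) (ltW h2)))//.
have rho_e2 p : `|p - p0| < rho -> `|p - p0| <= e2.
  by rewrite lt_min => /andP[/ltW/le_trans-> ].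
(* Both solutions are compared in the equation at p1: there the residual of h p2 is due only to the
   change from p2 to p1. *)
have := lip (h p2) p1 p2 (le_trans (ltW h2) ee2) (rho_e2 _ pr1) (rho_e2 _ pr2).
rewrite -mulrA h1' h2' subr0 sub0r normrN; exact: ler_wpM2l (ltW K0) _ _.
Qed.

End ImplicitFunction.

(** * KKT systems without block structure *)

Section StrictDerivative.
Variables (R : realType) (V W : normedModType R).

(** Both points vary, unlike in the Fréchet derivative. The candidate [df] is a bare function;
    linearity or a bound is supplied where it is used. *)
Definition strict_derivative (f : V -> W) (a : V) (df : V -> W) :=
  forall delta : R, 0 < delta -> exists2 e : R, 0 < e &
  forall z1 z2, `|z1 - a| <= e -> `|z2 - a| <= e ->
    `|f z1 - f z2 - df (z1 - z2)| <= delta * `|z1 - z2|.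

Lemma strict_derivative_lipschitz f a df M : strict_derivative f a df ->
  (forall v, `|df v| <= M * `|v|) ->
  exists2 e : R, 0 < e & forall z1 z2, `|z1 - a| <= e -> `|z2 - a| <= e ->
    `|f z1 - f z2| <= (M + 1) * `|z1 - z2|.
Proof.
move=> /(_ 1 ltr01)[e e0 he] hM; exists e => // z1 z2 h1 h2.
rewrite -[f z1 - f z2](subrK (df (z1 - z2))) (le_trans (ler_normD _ _))//.
by rewrite mulrDl addrC lerD// he.
Qed.

End StrictDerivative.

Section NormBlocks.
Variable R : realType.

Lemma norm_pair (V W : normedModType R) (a : V) (b : W) :
  `|(a, b)| = Num.max `|a| `|b|.
Proof. by []. Qed.

Lemma norm_sub_fst_le (V W : normedModType R) (v w : V * W) :
  `|v.1 - w.1| <= `|v - w|.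
Proof. by case: v w => [a b] [a' b']; rewrite norm_pair le_max lexx. Qed.

Lemma norm_sub_snd_le (V W : normedModType R) (v w : V * W) :
  `|v.2 - w.2| <= `|v - w|.
Proof. by case: v w => [a b] [a' b']; rewrite norm_pair le_max lexx orbT. Qed.

Lemma norm_col_mx_le m1 m2 n (A : 'M[R]_(m1, n)) (B : 'M[R]_(m2, n)) c :
  `|A| <= c -> `|B| <= c -> `|col_mx A B| <= c.
Proof.
move=> hA hB; apply: mx_norm_le => [|i j]; first by rewrite (le_trans _ hA).
case: (splitP i) => k ik.
  have -> : i = lshift m2 k by apply: val_inj.
  by rewrite col_mxEu (le_trans (mx_entry_le_norm _ _ _)).
have -> : i = rshift m1 k by apply: val_inj.
by rewrite col_mxEd (le_trans (mx_entry_le_norm _ _ _)).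
Qed.

Lemma norm_usubmx_le m1 m2 n (A : 'M[R]_(m1 + m2, n)) : `|usubmx A| <= `|A|.
Proof. by apply: mx_norm_le => // i j; rewrite mxE mx_entry_le_norm. Qed.

Lemma norm_dsubmx_le m1 m2 n (A : 'M[R]_(m1 + m2, n)) : `|dsubmx A| <= `|A|.
Proof. by apply: mx_norm_le => // i j; rewrite mxE mx_entry_le_norm. Qed.

Lemma nonzero_entries_bounded_below m (a : 'cV[R]_m) :
  exists2 b : R, 0 < b & forall i, a i 0 != 0 -> b <= `|a i 0|.
Proof.
(* Zero entries contribute 0 to the sum, the inverse of 0 being 0; the added 1 keeps [S] positive
   when all entries vanish. *)
pose S := \sum_i `|a i 0|^-1 + 1.
have S0 : 0 < S by rewrite ltr_wpDl// sumr_ge0// => i _; rewrite invr_ge0.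
exists S^-1; first by rewrite invr_gt0.
move=> i ai; have ai0 : 0 < `|a i 0| by rewrite normr_gt0.
rewrite -[leRHS]invrK lef_pV2 ?posrE ?invr_gt0// /S (bigD1 i)//= -addrA lerDl.
by rewrite addr_ge0// sumr_ge0// => j _; rewrite invr_ge0.
Qed.

End NormBlocks.

(** * The Kojima matrices as a compact convex family *)

Section KojimaMatrices.
Variables (R : realType) (n m : nat) (J : 'M[R]_n) (G : 'M[R]_(m, n)).
Variables (A1 A0 : pred 'I_m).

Lemma kojima_mxE (t : 'cV[R]_m) : kojima_mx J G t =
  block_mx J 0 G (- 1%:M) + col_mx G^T 1%:M *m diag_mx t^T *m row_mx 0 1%:M.
Proof.
rewrite mul_col_mx mul_col_row !mulmx0 !mulmx1 mul1mx add_block_mx !addr0 add0r.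
by rewrite /kojima_mx [- _ + _]addrC.
Qed.

Lemma kojima_mx_continuous : continuous (kojima_mx J G).
Proof.
have -> : kojima_mx J G = fun t => block_mx J 0 G (- 1%:M) +
    col_mx G^T 1%:M *m diag_mx t^T *m row_mx 0 1%:M.
  by apply/funext => t; exact: kojima_mxE.
move=> t; apply: (@cvgD _ _ _ (nbhs t) _ (cst _)); first exact: cvg_cst.
apply: mulmx_continuous t; last by move=> t; exact: cst_continuous.
apply: mulmx_continuous => t; first exact: cst_continuous.
move: t; apply: mx_continuous_entries => i j.
have [<-|ij] := eqVneq i j.
  rewrite (_ : (fun _ => _) = fun t : 'cV[R]_m => t i 0); first exact: coord_continuous.
  by apply/funext => t; rewrite !mxE eqxx.
rewrite (_ : (fun _ => _) = cst 0); first by move=> t; exact: cst_continuous.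
by apply/funext => t; rewrite !mxE (negbTE ij).
Qed.

Lemma cube_face_compact : compact (cube_face A1 A0 : set 'cV[R]_m).
Proof.
(* The segment is {1} on [A1], {0} on [A0] and [0, 1] elsewhere; an index in both gives the empty
   segment [1, 0], in agreement with an empty face. *)
pose S i := `[(A1 i)%:R, (~~ A0 i)%:R]%classic : set R.
have -> : cube_face A1 A0 = trmx @` [set v : 'rV[R]_m | forall i, S i (v ord0 i)].
  apply/seteqP; split => [t Qt|_ [v Sv <-]] /=.
    exists t^T; rewrite ?trmxK// => i; rewrite mxE /S/= in_itv/=.
    have [/andP[u1 u2] h1 h0] := Qt i.
    case: (A1 i) h1 => h1; case: (A0 i) h0 => h0 /=;
      try (have := h1 isT); try (have := h0 isT); lra.
  move=> i; rewrite mxE; move: (Sv i); rewrite /S/= in_itv/=.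
  case: (A1 i); case: (A0 i) => //= /andP[h1 h0]; split=> //; try lra.
apply: continuous_compact.
  by apply: continuous_subspaceT => x; exact: trmx_continuous.
by apply: rV_compact => i; exact: segment_compact.
Qed.

Lemma kojima_mx_convex B1 B2 (s : R) :
  (kojima_mx J G @` cube_face A1 A0) B1 -> (kojima_mx J G @` cube_face A1 A0) B2 ->
  0 <= s <= 1 -> (kojima_mx J G @` cube_face A1 A0) (s *: B1 + (1 - s) *: B2).
Proof.
move=> [t1 Q1 <-] [t2 Q2 <-] /andP[s0 s1]; exists (s *: t1 + (1 - s) *: t2).
  move=> i; have [/andP[a0 a1] h1 h0] := Q1 i; have [/andP[b0 b1] g1 g0] := Q2 i.
  rewrite !mxE; split.
  - by move: (t1 i 0) (t2 i 0) a0 a1 b0 b1 => x y *; nra.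
  - by move=> Ai; rewrite h1// g1//; ring.
  - by move=> Ai; rewrite h0// g0//; ring.
rewrite !kojima_mxE linearD/= !linearZ/= linearD/= !linearZ/=.
rewrite mulmxDr mulmxDl -!scalemxAr -!scalemxAl !scalerDr addrACA.
by rewrite -scalerDl (_ : s + (1 - s) = 1) ?scale1r//; ring.
Qed.

End KojimaMatrices.

(** * The KKT system and its Kojima equation *)

Section KKTSystem.
Variables (R : realType) (n m d : nat) (E : pred 'I_m).
Variables (F : 'cV[R]_n * 'cV[R]_m * 'cV[R]_d -> 'cV[R]_n).
Variables (c : 'cV[R]_n * 'cV[R]_d -> 'cV[R]_m).

(** [F] is an arbitrary map, not the gradient of one Lagrangian, so that the stationarity conditions
    of all players can be stacked into it. *)
Definition kkt_system (p : 'cV[R]_m * 'cV[R]_n * 'cV[R]_d) :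
    set ('cV[R]_n * 'cV[R]_m) :=
  [set z | p.1.2 = F (z.1, z.2, p.2) /\
    forall i, if E i then c (z.1, p.2) i 0 = p.1.1 i 0 else
      [/\ 0 <= z.2 i 0, c (z.1, p.2) i 0 <= p.1.1 i 0 &
          z.2 i 0 * (c (z.1, p.2) i 0 - p.1.1 i 0) = 0]].

Definition pos_part (xi : 'cV[R]_m) : 'cV[R]_m :=
  \col_i (if E i then xi i 0 else Num.max (xi i 0) 0).

Definition kojima_map (z : 'cV[R]_(n + m)) (p : 'cV[R]_m * 'cV[R]_n * 'cV[R]_d) :=
  let x := usubmx z in let xi := dsubmx z in
  col_mx (F (x, pos_part xi, p.2) - p.1.2)
         (c (x, p.2) - p.1.1 - (xi - pos_part xi)).

(** By complementarity one of lambda_i and g_i - u_i vanishes on an inequality index, so their sum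
    determines both: its positive part is lambda_i, the rest is g_i - u_i. *)
Lemma kkt_system_kojima p z : kkt_system p z ->
  let xi := z.2 + (c (z.1, p.2) - p.1.1) in
  kojima_map (col_mx z.1 xi) p = 0 /\ pos_part xi = z.2.
Proof.
move=> [statz cz] xi; rewrite /kojima_map col_mxKu col_mxKd.
have -> : pos_part xi = z.2.
  apply/colP => i; rewrite !mxE; have := cz i.
  case: (E i) => [->|[h1 h2 h3]]; first by rewrite subrr addr0.
  by case: (leP (z.2 i 0) 0) => hz; case: (leP (z.2 i 0 + _) 0) => h; nra.
have -> : xi - z.2 = c (z.1, p.2) - p.1.1 by rewrite /xi addrAC subrr add0r.
by rewrite -statz !subrr col_mx0.
Qed.

Lemma kojima_kkt_system p z : kojima_map z p = 0 ->
  let x := usubmx z in let xi := dsubmx z in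
  kkt_system p (x, pos_part xi) /\ xi = pos_part xi + (c (x, p.2) - p.1.1).
Proof.
move=> Hz x xi; move: Hz; rewrite /kojima_map -col_mx0 -/x -/xi.
move=> /eq_col_mx[/subr0_eq e1 /subr0_eq e2].
move: x xi e1 e2 => x xi e1 e2.
split; last by rewrite e2 addrC subrK.
split=> [//|i /=]; move/colP: e2 => /(_ i); rewrite !mxE.
case: (E i) => e2; first by apply/eqP; rewrite -subr_eq0 e2 subrr.
rewrite e2; move: e2; case: (leP (xi i 0) 0) => h; first by move=> e2; rewrite mul0r; split=> //; lra.
by move=> e2; rewrite subrr mulr0; split=> //; lra.
Qed.

Lemma pos_part_lipschitz xi1 xi2 : `|pos_part xi1 - pos_part xi2| <= `|xi1 - xi2|.
Proof.
apply: mx_norm_le => // i j; rewrite ord1 !mxE.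
apply: (@le_trans _ _ `|(xi1 - xi2) i 0|); last exact: mx_entry_le_norm.
rewrite !mxE; case: (E i) => //.
by case: (leP (xi1 i 0) 0) => h1; case: (leP (xi2 i 0) 0) => h2;
  rewrite ?subrr ?normr0// ler_norml; case: (ger0P (xi1 i 0 - xi2 i 0)) => h3;
  apply/andP; split; lra.
Qed.

Lemma pos_part_slope (xi0 : 'cV[R]_m) : exists2 e : R, 0 < e &
  forall xi1 xi2, `|xi1 - xi0| <= e -> `|xi2 - xi0| <= e ->
  exists2 t : 'cV[R]_m, cube_face [pred i | E i || (0 < xi0 i 0)]
    [pred i | ~~ E i && (xi0 i 0 < 0)] t &
    pos_part xi1 - pos_part xi2 = diag_mx t^T *m (xi1 - xi2).
Proof.
have [b b0 hb] := nonzero_entries_bounded_below xi0.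
(* Within half of the least nonzero |xi0_i|, the signs of the nonzero coordinates cannot change. *)
exists (b / 2); first by rewrite divr_gt0.
move=> xi1 xi2 h1 h2.
(* The slope is a difference quotient. Where the coordinates coincide any value would do, except
   that it must be 1 on [A1] and 0 on [A0], so the indicator of [A1] is taken. *)
pose t : 'cV[R]_m := \col_i (if xi1 i 0 == xi2 i 0 then (E i || (0 < xi0 i 0))%:R
  else (pos_part xi1 i 0 - pos_part xi2 i 0) / (xi1 i 0 - xi2 i 0)).
have tE i : pos_part xi1 i 0 - pos_part xi2 i 0 = t i 0 * (xi1 i 0 - xi2 i 0).
  rewrite [t i 0]mxE; case: eqP => [e|/eqP ne]; last by rewrite divfK// subr_eq0.
  by rewrite !mxE e !subrr mulr0.
exists t; last first.
  apply/colP => i; rewrite mul_diag_mx; move: (pos_part _) (pos_part _) (t) tE => y1 y2 t' t'E.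
  by rewrite !mxE t'E.
move=> i; have := tE i; have := mx_entry_le_norm (xi1 - xi0) i 0.
have := mx_entry_le_norm (xi2 - xi0) i 0.
have := hb i; rewrite !mxE /=.
move: (xi1 i 0) (xi2 i 0) (xi0 i 0) => x1 x2 x0 hbi.
move=> /le_trans/(_ h2); rewrite ler_norml => /andP[k1 k2].
move=> /le_trans/(_ h1); rewrite ler_norml => /andP[l1 l2] _.
have [e|ne] := eqVneq x1 x2.
  split=> [||]; rewrite /=.
  - by case: (_ || _); rewrite ?lexx ?ler01.
  - by move=> ->.
  - by case: (E i) => //= lt; rewrite (lt_gtF lt).
have d0 : x1 - x2 != 0 by rewrite subr_eq0.
split=> /=.
- case: (E i); first by rewrite divff// lexx ler01.
  apply/andP; split.
    case: (leP x1 0) => a1; case: (leP x2 0) => a2; rewrite ?subrr ?mul0r//.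
    + by rewrite sub0r -opprB invrN mulNr mulrN opprK divr_ge0//; lra.
    + by rewrite subr0 divr_ge0//; lra.
    + by rewrite divff.
  case: (ltgtP x1 x2) => [lt|lt|e]; last by rewrite e eqxx in ne.
    rewrite -[x1 - x2]opprB invrN mulrN -mulNr ler_pdivrMr ?subr_gt0// mul1r.
    by case: (leP x1 0) => a1; case: (leP x2 0) => a2; lra.
  rewrite ler_pdivrMr ?subr_gt0// mul1r.
  by case: (leP x1 0) => a1; case: (leP x2 0) => a2; lra.
- case: (E i) => /=; first by rewrite divff.
  move=> x00; move: hbi; rewrite gt_eqF// gtr0_norm// => /(_ isT) hbi.
  have p1 : 0 < x1 by lra.
  have p2 : 0 < x2 by lra.
  by rewrite !max_l ?ltW// divff.
- case: (E i) => //= x00; move: hbi; rewrite lt_eqF// ltr0_norm// => /(_ isT) hbi.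
  have p1 : x1 <= 0 by lra.
  have p2 : x2 <= 0 by lra.
  by rewrite !max_r// subrr mul0r.
Qed.

End KKTSystem.

(** * Sufficiency for a single KKT system *)

Section KKTRegularity.
Variables (R : realType) (n m d : nat) (E : pred 'I_m).
Variables (F : 'cV[R]_n * 'cV[R]_m * 'cV[R]_d -> 'cV[R]_n).
Variables (c : 'cV[R]_n * 'cV[R]_d -> 'cV[R]_m).
Variables (J : 'M[R]_n) (G : 'M[R]_(m, n)) (B : 'M[R]_(n, d)) (C : 'M[R]_(m, d)).
Variables (p0 : 'cV[R]_m * 'cV[R]_n * 'cV[R]_d) (z0 : 'cV[R]_n * 'cV[R]_m).
Hypothesis F_strict : strict_derivative F (z0.1, z0.2, p0.2)
  (fun t => J *m t.1.1 + G^T *m t.1.2 + B *m t.2).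
Hypothesis c_strict : strict_derivative c (z0.1, p0.2)
  (fun t => G *m t.1 + C *m t.2).
Hypothesis kkt0 : kkt_system E F c p0 z0.

Let xi0 := z0.2 + (c (z0.1, p0.2) - p0.1.1).
Let A1 := [pred i | E i || (0 < xi0 i 0)].
Let A0 := [pred i | ~~ E i && (xi0 i 0 < 0)].

Lemma F_lipschitz : exists2 e : R, 0 < e & exists2 M : R, 0 < M & forall z1 z2,
  `|z1 - (z0.1, z0.2, p0.2)| <= e -> `|z2 - (z0.1, z0.2, p0.2)| <= e ->
  `|F z1 - F z2| <= M * `|z1 - z2|.
Proof.
pose M := n%:R * `|J| + m%:R * `|G^T| + d%:R * `|B|.
have M0 : 0 <= M by rewrite !addr_ge0 ?mulr_ge0.
have [|e e0 he] := strict_derivative_lipschitz (M := M) F_strict.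
  move=> [[x l] w]; rewrite !norm_pair /=.
  set N := Num.max (Num.max `|x| `|l|) `|w|.
  have hx : `|x| <= N by rewrite !le_max lexx.
  have hl : `|l| <= N by rewrite !le_max lexx orbT.
  have hw : `|w| <= N by rewrite !le_max lexx orbT.
  rewrite (le_trans (ler_normD _ _))// /M mulrDl lerD//; last first.
    by rewrite (le_trans (mulmx_norm_le _ _))// ler_wpM2l// mulr_ge0.
  rewrite (le_trans (ler_normD _ _))// mulrDl lerD//.
    by rewrite (le_trans (mulmx_norm_le _ _))// ler_wpM2l// mulr_ge0.
  by rewrite (le_trans (mulmx_norm_le _ _))// ler_wpM2l// mulr_ge0.
by exists e => //; exists (M + 1) => //; rewrite ltr_wpDl.
Qed.

Lemma c_lipschitz : exists2 e : R, 0 < e & exists2 M : R, 0 < M & forall z1 z2,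
  `|z1 - (z0.1, p0.2)| <= e -> `|z2 - (z0.1, p0.2)| <= e ->
  `|c z1 - c z2| <= M * `|z1 - z2|.
Proof.
pose M := n%:R * `|G| + d%:R * `|C|.
have M0 : 0 <= M by rewrite !addr_ge0 ?mulr_ge0.
have [|e e0 he] := strict_derivative_lipschitz (M := M) c_strict.
  move=> [x w]; rewrite !norm_pair /=.
  have hx : `|x| <= Num.max `|x| `|w| by rewrite !le_max lexx.
  have hw : `|w| <= Num.max `|x| `|w| by rewrite !le_max lexx orbT.
  rewrite (le_trans (ler_normD _ _))// /M mulrDl lerD//.
    by rewrite (le_trans (mulmx_norm_le _ _))// ler_wpM2l// mulr_ge0.
  by rewrite (le_trans (mulmx_norm_le _ _))// ler_wpM2l// mulr_ge0.
by exists e => //; exists (M + 1) => //; rewrite ltr_wpDl.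
Qed.

Lemma pos_part_xi0 : pos_part E xi0 = z0.2.
Proof. by have [] := kkt_system_kojima kkt0. Qed.

Let D := kojima_mx J G @` cube_face A1 A0.
Let zeta0 := col_mx z0.1 xi0.

(** In an increment at fixed p the terms u and v cancel, and w only has to be near its reference
    value; hence one radius serves all p. The positive part contributes its exact slope, so the
    error is that of the strict derivatives of [F] and [c]. *)
Lemma kojima_map_mean_value delta : 0 < delta -> exists2 e : R, 0 < e &
  forall p, `|p - p0| <= e ->
  mean_value_family D (fun z => kojima_map E F c z p) zeta0 e delta.
Proof.
move=> delta0; have [e1 e10 hF] := F_strict delta0.
have [e2 e20 hc] := c_strict delta0.
have [e3 e30 hpos] := pos_part_slope E xi0.
exists (Num.min e1 (Num.min e2 e3)); first by rewrite !lt_min e10 e20.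
move=> p hp z1 z2 h1 h2.
have hw : `|p.2 - p0.2| <= `|p - p0| by exact: norm_sub_snd_le.
have hx z : `|usubmx z - z0.1| <= `|z - zeta0|.
  have -> : usubmx z - z0.1 = usubmx (z - zeta0).
    by rewrite linearB/= /zeta0 col_mxKu.
  exact: norm_usubmx_le.
have hxi z : `|dsubmx z - xi0| <= `|z - zeta0|.
  have -> : dsubmx z - xi0 = dsubmx (z - zeta0).
    by rewrite linearB/= /zeta0 col_mxKd.
  exact: norm_dsubmx_le.
have hl z : `|pos_part E (dsubmx z) - z0.2| <= `|z - zeta0|.
  by rewrite -pos_part_xi0 (le_trans (pos_part_lipschitz _ _ _))// hxi.
move: hp h1 h2; rewrite !le_min => /and3P[hp1 hp2 hp3] /and3P[h11 h12 h13] /and3P[h21 h22 h23].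
have [t Qt tE] := hpos _ _ (le_trans (hxi z1) h13) (le_trans (hxi z2) h23).
exists (kojima_mx J G t); first by exists t.
have := hF (usubmx z1, pos_part E (dsubmx z1), p.2) (usubmx z2, pos_part E (dsubmx z2), p.2).
have := hc (usubmx z1, p.2) (usubmx z2, p.2).
rewrite !norm_pair/= !ge_max.
rewrite (le_trans (hx _) h12) (le_trans (hx _) h22) (le_trans hw hp2).
rewrite (le_trans (hx _) h11) (le_trans (hx _) h21) (le_trans hw hp1).
rewrite (le_trans (hl _) h11) (le_trans (hl _) h21).
rewrite !subrr !mulmx0 !addr0 => /(_ isT isT) hc12 /(_ isT isT) hF12.
have dz : z1 - z2 = col_mx (usubmx z1 - usubmx z2) (dsubmx z1 - dsubmx z2).
  by rewrite -[z1 in LHS]vsubmxK -[z2 in LHS]vsubmxK opp_col_mx add_col_mx.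
have dx : `|usubmx z1 - usubmx z2| <= `|z1 - z2|.
  by rewrite -linearB/= norm_usubmx_le.
have dxi : `|dsubmx z1 - dsubmx z2| <= `|z1 - z2|.
  by rewrite -linearB/= norm_dsubmx_le.
have dl : `|pos_part E (dsubmx z1) - pos_part E (dsubmx z2)| <= `|z1 - z2|.
  by rewrite (le_trans (pos_part_lipschitz _ _ _)).
have -> : kojima_map E F c z1 p - kojima_map E F c z2 p - kojima_mx J G t *m (z1 - z2) =
  col_mx (F (usubmx z1, pos_part E (dsubmx z1), p.2) - F (usubmx z2, pos_part E (dsubmx z2), p.2)
    - (J *m (usubmx z1 - usubmx z2) + G^T *m (pos_part E (dsubmx z1) - pos_part E (dsubmx z2))))
   (c (usubmx z1, p.2) - c (usubmx z2, p.2) - G *m (usubmx z1 - usubmx z2)).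
  rewrite dz /kojima_map /kojima_mx mul_block_col !opp_col_mx !add_col_mx.
  congr col_mx.
    by rewrite -mulmxA -tE [in LHS]opprB addrA subrK.
  rewrite mulmxBl mul1mx -tE.
  move: (c _) (c _) (p.1.1) (dsubmx _) (dsubmx _) (G *m _) (pos_part _ _) (pos_part _ _).
  move=> a1 a2 a3 a4 a5 a6 a7 a8; apply/colP => i; rewrite !mxE; ring.
apply: norm_col_mx_le.
  rewrite (le_trans hF12)// ler_wpM2l ?(ltW delta0)//.
  by rewrite !ge_max dx dl normr0 normr_ge0.
rewrite (le_trans hc12)// ler_wpM2l ?(ltW delta0)//.
by rewrite !ge_max dx normr0 normr_ge0.
Qed.

Lemma kojima_map_parameter_lipschitz : exists2 e : R, 0 < e & exists2 L : R, 0 < L &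
  forall (z : 'cV_(n + m)) p1 p2, `|z - zeta0| <= e -> `|p1 - p0| <= e -> `|p2 - p0| <= e ->
  `|kojima_map E F c z p1 - kojima_map E F c z p2| <= L * `|p1 - p2|.
Proof.
have [e1 e10 [M1 M10 hF]] := F_lipschitz.
have [e2 e20 [M2 M20 hc]] := c_lipschitz.
exists (Num.min e1 e2); first by rewrite !lt_min e10 e20.
exists (M1 + M2 + 1); first by rewrite !addr_gt0.
move=> z p1 p2.
have hw (p p' : 'cV[R]_m * 'cV[R]_n * 'cV[R]_d) : `|p.2 - p'.2| <= `|p - p'| by exact: norm_sub_snd_le.
have hv (p p' : 'cV[R]_m * 'cV[R]_n * 'cV[R]_d) : `|p.1.2 - p'.1.2| <= `|p - p'|.
  by exact: le_trans (norm_sub_snd_le _ _) (norm_sub_fst_le _ _).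
have hu (p p' : 'cV[R]_m * 'cV[R]_n * 'cV[R]_d) : `|p.1.1 - p'.1.1| <= `|p - p'|.
  by exact: le_trans (norm_sub_fst_le _ _) (norm_sub_fst_le _ _).
have hx : `|usubmx z - z0.1| <= `|z - zeta0|.
  have -> : usubmx z - z0.1 = usubmx (z - zeta0).
    by rewrite linearB/= /zeta0 col_mxKu.
  exact: norm_usubmx_le.
have hl : `|pos_part E (dsubmx z) - z0.2| <= `|z - zeta0|.
  rewrite -pos_part_xi0 (le_trans (pos_part_lipschitz _ _ _))//.
  have -> : dsubmx z - xi0 = dsubmx (z - zeta0).
    by rewrite linearB/= /zeta0 col_mxKd.
  exact: norm_dsubmx_le.
rewrite !le_min => /andP[hz1 hz2] /andP[h11 h12] /andP[h21 h22].
have := hF (usubmx z, pos_part E (dsubmx z), p1.2) (usubmx z, pos_part E (dsubmx z), p2.2).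
have := hc (usubmx z, p1.2) (usubmx z, p2.2).
rewrite !norm_pair/= !ge_max.
rewrite (le_trans hx hz2) (le_trans (hw _ _) h12) (le_trans (hw _ _) h22).
rewrite (le_trans hx hz1) (le_trans (hw _ _) h11) (le_trans (hw _ _) h21) (le_trans hl hz1).
rewrite !subrr !normr0 maxxx (max_r (normr_ge0 _)) => /(_ isT isT) hc12 /(_ isT isT) hF12.
have -> : kojima_map E F c z p1 - kojima_map E F c z p2 =
  col_mx (F (usubmx z, pos_part E (dsubmx z), p1.2) - F (usubmx z, pos_part E (dsubmx z), p2.2)
     - (p1.1.2 - p2.1.2)) (c (usubmx z, p1.2) - c (usubmx z, p2.2) - (p1.1.1 - p2.1.1)).
  rewrite /kojima_map !opp_col_mx !add_col_mx; congr col_mx.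
    move: (F _) (F _) (p1.1.2) (p2.1.2) => a1 a2 a3 a4.
    by apply/colP => i; rewrite !mxE; ring.
  move: (c _) (c _) (p1.1.1) (p2.1.1) (dsubmx _) (pos_part _ _) => a1 a2 a3 a4 a5 a6.
  by apply/colP => i; rewrite !mxE; ring.
have M2p : 0 <= M2 * `|p1 - p2| by rewrite mulr_ge0// ltW.
have M1p : 0 <= M1 * `|p1 - p2| by rewrite mulr_ge0// ltW.
apply: norm_col_mx_le; rewrite (le_trans (ler_normB _ _))// !mulrDl mul1r lerD ?hu ?hv//.
  rewrite (le_trans hF12)// (@le_trans _ _ (M1 * `|p1 - p2|))//; last by rewrite lerDl.
  by rewrite ler_wpM2l ?(ltW M10).
rewrite (le_trans hc12)// (@le_trans _ _ (M2 * `|p1 - p2|))//; last by rewrite lerDr.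
by rewrite ler_wpM2l ?(ltW M20).
Qed.

Lemma kkt_system_localization :
  (forall y eta, critical_pair J G A1 A0 y eta -> y = 0 /\ eta = 0) ->
  lipschitz_localization (kkt_system E F c) p0 z0.
Proof.
move=> crit; split; first exact: kkt0.
have Dne : D !=set0.
  exists (kojima_mx J G (\col_i (A1 i)%:R)); exists (\col_i (A1 i)%:R) => // i.
  rewrite !mxE; split=> [|->//|]; first by case: (A1 i); rewrite ?lexx ?ler01.
  by rewrite /A1/=; case: (E i) => //= lt; rewrite (lt_gtF lt).
have Dcompact : compact D.
  apply: continuous_compact; last exact: cube_face_compact.
  by apply: continuous_subspaceT => t; exact: kojima_mx_continuous.
have Dunit M : D M -> M \in unitmx.
  by move=> [t Qt <-]; exact: (kojima_mx_unit crit).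
have [|e [rho [M [h [e0 rho0 M0 hP h_lip]]]]] :=
  clarke_implicit_function Dne Dcompact Dunit (@kojima_mx_convex _ _ _ J G A1 A0) _
   kojima_map_mean_value kojima_map_parameter_lipschitz.
  by have [] := kkt_system_kojima kkt0.
have [e1 e10 [M1 M10 hc]] := c_lipschitz.
(* Passing from (x, lambda) to xi involves c and u: if z and p move by less than e', then xi moves
   by at most e' + M1 e' + e', which is less than (M1 + 3) e' <= e, so uniqueness for the Kojima
   equation applies. *)
pose e' := Num.min e1 (e / (M1 + 3)).
have M13 : 0 < M1 + 3 by lra.
have e'0 : 0 < e' by rewrite lt_min e10 divr_gt0.
have e'e1 : e' <= e1 by rewrite ge_min lexx.
have e'e : e' * (M1 + 3) <= e by rewrite -ler_pdivlMr// ge_min lexx orbT.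
(* The bound e' / M keeps the solutions over [U] inside [V]. *)
pose rho' := Num.min rho (Num.min e' (e' / M)).
have rho'0 : 0 < rho' by rewrite lt_min rho0/= lt_min e'0 divr_gt0.
have rho'P x : x < rho' -> [/\ x < rho, x < e' & M * x < e'].
  rewrite lt_min => /andP[xr]; rewrite lt_min => /andP[xe xM]; split=> //.
  by rewrite mulrC -ltr_pdivlMr.
pose H p := (usubmx (h p), pos_part E (dsubmx (h p))).
have H_lip p1 p2 : `|H p1 - H p2| <= `|h p1 - h p2|.
  rewrite norm_pair/= ge_max -linearB/= norm_usubmx_le/=.
  by rewrite (le_trans (pos_part_lipschitz _ _ _))// -linearB/= norm_dsubmx_le.
have hp0 : h p0 = zeta0.
  have [] := hP p0; first by rewrite subrr normr0.
  move=> _ _ uniq; apply/esym/uniq; first by rewrite subrr normr0.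
  by have [] := kkt_system_kojima kkt0.
have H0 : H p0 = z0.
  by rewrite /H hp0 /zeta0 col_mxKu col_mxKd pos_part_xi0 -surjective_pairing.
pose U := ball p0 rho'; pose V := ball z0 e'.
have UP p : U p = (`|p - p0| < rho') :> Prop by rewrite /U -ball_normE /ball_/= distrC.
have VP z : V z = (`|z - z0| < e') :> Prop by rewrite /V -ball_normE /ball_/= distrC.
exists U, V; split; [exact: nbhsx_ballx|exact: nbhsx_ballx|].
exists H; split; last first.
  have PF : ProperFilter (globally (U `*` U)).
    by apply: (@globally_properfilter _ _ (p0, p0)); split; exact: ballxx.
  apply: (@klipschitzW _ _ _ M _ _ PF) => -[p1 p2] /= [].
  rewrite !UP => /rho'P[h1 _ _] /rho'P[h2 _ _].
  by rewrite (le_trans (H_lip _ _))// h_lip.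
apply/seteqP; split.
  move=> [p z] /= [kktz [Up Vz]]; exists p => //; congr pair.
  move: Up Vz; rewrite UP VP => /rho'P[p_rho p_e' _] ze'.
  have [_ _ uniq] := hP p p_rho.
  have [Hz pz] := kkt_system_kojima kktz.
  rewrite /H -(uniq _ _ Hz); last first.
    have hx : `|z.1 - z0.1| <= `|z - z0| by exact: norm_sub_fst_le.
    have hl : `|z.2 - z0.2| <= `|z - z0| by exact: norm_sub_snd_le.
    have hw : `|p.2 - p0.2| <= `|p - p0| by exact: norm_sub_snd_le.
    have hu : `|p.1.1 - p0.1.1| <= `|p - p0|.
      by exact: le_trans (norm_sub_fst_le _ _) (norm_sub_fst_le _ _).
    have hcp : `|c (z.1, p.2) - c (z0.1, p0.2)| <= M1 * e'.
      have cz : `|(z.1, p.2) - (z0.1, p0.2)| <= e'.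
        by rewrite norm_pair/= ge_max (le_trans hx (ltW ze')) (le_trans hw (ltW p_e')).
      rewrite (le_trans (hc _ _ _ _))//; first exact: le_trans cz e'e1.
        by rewrite subrr normr0 ltW.
      by rewrite ler_wpM2l// ltW.
    apply: (@le_lt_trans _ _ (e' + (M1 * e' + e'))); last by nra.
    rewrite /zeta0 opp_col_mx add_col_mx; apply: norm_col_mx_le.
      rewrite (le_trans hx)// (le_trans (ltW ze'))// lerDl.
      by rewrite addr_ge0// ?mulr_ge0// ltW.
    rewrite /xi0 opprD addrACA (le_trans (ler_normD _ _))// lerD//.
      by rewrite (le_trans hl)// ltW.
    rewrite opprD addrACA -opprD (le_trans (ler_normB _ _))// lerD//.
    by rewrite (le_trans _ (ltW p_e')).
  by rewrite col_mxKu col_mxKd pz -surjective_pairing.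
move=> _ [p Up <-] /=.
have p_small : `|p - p0| < rho' by rewrite -UP.
have [p_rho p_e' p_M] := rho'P _ p_small.
have [_ hp _] := hP p p_rho; have [kp _] := kojima_kkt_system hp.
split; first exact: kp.
split; first exact: Up.
rewrite /= VP -H0 (le_lt_trans (H_lip _ _))//.
by apply: le_lt_trans (h_lip p p0 p_rho _) p_M; rewrite subrr normr0.
Qed.

End KKTRegularity.

(* Replacing lambda by lambda + t al and u by u + t be makes every degenerate
   index with a vanishing component of (G y, eta) nondegenerate, while x stays a
   solution; perturbing (u, v) further by s (eta, y) then shows that the pair
   (eta, y) violates the Lipschitz bound unless it is zero. *)
Lemma kkt_system_localization_critical (R : realType) (n m d : nat) (E : pred 'I_m)
  (F : 'cV[R]_n * 'cV[R]_m * 'cV[R]_d -> 'cV[R]_n)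
  (c : 'cV[R]_n * 'cV[R]_d -> 'cV[R]_m)
  (J : 'M[R]_n) (G : 'M[R]_(m, n)) (B : 'M[R]_(n, d)) (C : 'M[R]_(m, d))
  (p0 : 'cV[R]_m * 'cV[R]_n * 'cV[R]_d) (z0 : 'cV[R]_n * 'cV[R]_m) :
  strict_derivative F (z0.1, z0.2, p0.2)
    (fun t => J *m t.1.1 + G^T *m t.1.2 + B *m t.2) ->
  strict_derivative c (z0.1, p0.2) (fun t => G *m t.1 + C *m t.2) ->
  kkt_system E F c p0 z0 ->
  let xi0 := z0.2 + (c (z0.1, p0.2) - p0.1.1) in
  lipschitz_localization (kkt_system E F c) p0 z0 ->
  forall y eta, critical_pair J G [pred i | E i || (0 < xi0 i 0)]
    [pred i | ~~ E i && (xi0 i 0 < 0)] y eta -> y = 0 /\ eta = 0.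
Proof.
move=> F_strict c_strict kkt0 xi0.
move=> [_ [U [V [nbU nbV [h [gphE [M0 [_ lipM]]]]]]]] y eta [stat crit].
pose M := `|M0| + 1.
have M_gt0 : 0 < M by rewrite ltr_wpDl.
have h_lip p1 p2 : U p1 -> U p2 -> `|h p1 - h p2| <= M * `|p1 - p2|.
  move=> U1 U2; apply: (lipM M _ (p1, p2)) => //.
  by rewrite (le_lt_trans (ler_norm _))// ltrDl.
have h_kkt p : U p -> kkt_system E F c p (h p).
  move=> Up; suff [] : (gph (kkt_system E F c) `&` U `*` V) (p, h p) by [].
  by rewrite gphE; exists p.
have h_uniq p z : U p -> V z -> kkt_system E F c p z -> h p = z.
  move=> Up Vz kp; have : (gph (kkt_system E F c) `&` U `*` V) (p, z) by [].
  by rewrite gphE => -[q Uq [<- <-]].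
have [r r0 [rU rV]] : exists2 r : R, 0 < r &
    (forall p, `|p - p0| < r -> U p) /\ (forall z, `|z - z0| < r -> V z).
  move/nbhs_normP: nbU => [r1 /= r10 hr1]; move/nbhs_normP: nbV => [r2 /= r20 hr2].
  exists (Num.min r1 r2); first by rewrite lt_min r10.
  split=> [p|z]; rewrite lt_min => /andP[h1 h2].
    by apply: hr1; rewrite /= distrC.
  by apply: hr2; rewrite /= distrC.
have [eF eF0 [KF KF0 F_lip]] := F_lipschitz F_strict.
have [ec ec0 [Kc Kc0 c_lip]] := c_lipschitz c_strict.
pose q : R := n%:R + m%:R + 1.
have q0 : 0 < q by rewrite ltr_wpDl// addr_ge0.
(* With this choice the two linearisation errors, paired with (y, eta), add up to at most s N^2 / 2;
   [q] is n + m increased by 1 to be positive. *)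
pose delta := (2 * q * M)^-1.
have qM0 : 0 < 2 * q * M by rewrite !mulr_gt0.
have delta0 : 0 < delta by rewrite invr_gt0.
have deltaE : 2 * (q * (delta * M)) = 1.
  by rewrite /delta; field; rewrite !gt_eqF.
have [e1 e10 F_str] := F_strict _ delta0.
have [e2 e20 c_str] := c_strict _ delta0.
have [b b0 hb] := nonzero_entries_bounded_below xi0.
pose N := Num.max `|eta| `|y|.
have Ny : `|y| <= N by rewrite le_max lexx orbT.
have Neta : `|eta| <= N by rewrite le_max lexx.
suff N0 : N <= 0.
  by split; apply/eqP; rewrite -normr_le0 (le_trans _ N0).
rewrite leNgt; apply/negP => Npos.
pose e := Num.min (Num.min r b) (Num.min (Num.min eF ec) (Num.min e1 e2)).
have e0 : 0 < e by rewrite !lt_min r0 b0 eF0 ec0 e10 e20.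
have [[er eb] [eeF eec] [ee1 ee2]] :
    [/\ e <= r /\ e <= b, e <= eF /\ e <= ec & e <= e1 /\ e <= e2].
  by rewrite !ge_min !lexx !orbT.
pose deg := [pred i | ~~ E i && (xi0 i 0 == 0)].
(* On a degenerate index, [al] makes the multiplier positive when (G y)_i = 0, and [be] makes the
   constraint slack when (G y)_i is nonzero and eta_i = 0. Indices with both components negative
   stay degenerate. *)
pose al : 'cV[R]_m := \col_i (deg i && ((G *m y) i 0 == 0))%:R.
pose be : 'cV[R]_m := \col_i [&& deg i, (G *m y) i 0 != 0 & eta i 0 == 0]%:R.
have bool_le1 (s : bool) : `|s%:R| <= 1 :> R.
  by case: s; rewrite ?normr1 ?normr0.
have al1 : `|al| <= 1 by apply: mx_norm_le => // i j; rewrite mxE bool_le1.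
have be1 : `|be| <= 1 by apply: mx_norm_le => // i j; rewrite mxE bool_le1.
have [t t0 tE] : exists2 t, 0 < t & 2 * (KF + 1) * t = e.
  exists (e / (2 * (KF + 1))); first by rewrite divr_gt0 ?mulr_gt0 ?addr_gt0.
  by rewrite mulrC divfK// gt_eqF ?mulr_gt0 ?addr_gt0.
have KFt : 0 < KF * t by rewrite mulr_gt0.
have tE' : 2 * (KF * t) + 2 * t = e by rewrite -tE; ring.
have t_e : 2 * t <= e by move: tE' KFt; clear; lra.
have KFt_e : 2 * (KF * t) <= e by move: tE' t0; clear; lra.
have t_r : t < r by move: t_e t0 er; clear; lra.
have KFt_r : KF * t < r by move: KFt_e KFt er; clear; lra.
have KM0 : 0 < Kc * M by rewrite mulr_gt0.
have d1 : 0 < 1 + M + Kc * M by move: M_gt0 KM0; clear; lra.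
have den0 : 0 < 2 * N * (1 + M + Kc * M) by rewrite !mulr_gt0.
(* Over the second perturbation lambda moves by at most M s N and c - u by at most Kc M s N + s N;
   both are less than t, so the strict signs created by [al] and [be] survive. *)
have [s s0 sE] : exists2 s, 0 < s &
    2 * (s * N + M * (s * N) + Kc * (M * (s * N))) = t.
  exists (t / (2 * N * (1 + M + Kc * M))); first by rewrite divr_gt0.
  rewrite -[RHS](divfK (lt0r_neq0 den0)); ring.
have sN0 : 0 < s * N by rewrite mulr_gt0.
have sMN0 : 0 < M * (s * N) by rewrite mulr_gt0.
have sKMN0 : 0 < Kc * (M * (s * N)) by rewrite mulr_gt0.
pose lt := z0.2 + t *: al.
pose vt := F (z0.1, lt, p0.2).
pose pt := (p0.1.1 + t *: be, vt, p0.2).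
pose qs := (p0.1.1 + t *: be + s *: eta, vt + s *: y, p0.2).
have sMN_t : 2 * (M * (s * N)) <= t by move: sE sN0 sKMN0; clear; lra.
have sN_t : 2 * (s * N) <= t by move: sE sMN0 sKMN0; clear; lra.
have sKMN_t : 2 * (Kc * (M * (s * N)) + s * N) < t by move: sE sMN0; clear; lra.
have near_e : M * (s * N) + t <= e by move: sMN_t t_e t0; clear; lra.
have sMN_e : M * (s * N) <= e by move: near_e t0; clear; lra.
have t_le_e : t <= e by move: t_e t0; clear; lra.
have lt_near : `|lt - z0.2| <= t.
  by rewrite /lt addrAC subrr add0r normrZ gtr0_norm// ler_piMr// ltW.
have vt_near : `|vt - p0.1.2| <= KF * t.
  have [-> _] := kkt0; rewrite /vt (le_trans (F_lip _ _ _ _))//.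
  - rewrite !norm_pair/= !subrr !normr0 !ge_max (ltW eF0) (le_trans lt_near (le_trans t_le_e eeF))//=.
  - by rewrite subrr normr0 ltW.
  rewrite ler_wpM2l ?(ltW KF0)// !norm_pair/= !subrr !normr0 !ge_max (ltW t0).
  by rewrite lt_near.
have ut_near : `|p0.1.1 + t *: be - p0.1.1| <= t.
  by rewrite addrAC subrr add0r normrZ gtr0_norm// ler_piMr// ltW.
have pt_U : U pt.
  apply: rU; rewrite !norm_pair/= !gt_max subrr normr0 r0 andbT.
  by rewrite (le_lt_trans ut_near t_r) (le_lt_trans vt_near KFt_r).
have addBK (W : zmodType) (a a' : W) : a + a' - a = a' by rewrite addrAC subrr add0r.
have qs_pt : `|qs - pt| <= s * N.
  rewrite !norm_pair/= !ge_max subrr normr0 (ltW sN0) andbT.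
  rewrite !addBK !normrZ !gtr0_norm//.
  by rewrite !ler_wpM2l ?(ltW s0).
have qs_U : U qs.
  apply: rU; rewrite -[qs](subrK pt) -addrA (le_lt_trans (ler_normD _ _))//.
  have : `|pt - p0| <= e / 2.
    rewrite !norm_pair/= !ge_max subrr normr0.
    rewrite (le_trans ut_near) ?(le_trans vt_near) ?divr_ge0 ?(ltW e0)//.
    - by move: KFt_e; clear; lra.
    - by move: t_e; clear; lra.
  by move: qs_pt sN_t t_e t0 er; clear; lra.
have xi0E i : [\/ E i /\ c (z0.1, p0.2) i 0 = p0.1.1 i 0,
   [/\ ~~ E i, 0 < xi0 i 0, z0.2 i 0 = xi0 i 0 & c (z0.1, p0.2) i 0 = p0.1.1 i 0],
   [/\ ~~ E i, xi0 i 0 < 0, z0.2 i 0 = 0 & c (z0.1, p0.2) i 0 = p0.1.1 i 0 + xi0 i 0] |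
   [/\ ~~ E i, xi0 i 0 = 0, z0.2 i 0 = 0 & c (z0.1, p0.2) i 0 = p0.1.1 i 0] ].
  have [_ /(_ i)] := kkt0; rewrite !mxE; case: (E i) => [->|[h1 h2 /eqP]].
    by apply: Or41.
  rewrite mulf_eq0 => /orP[/eqP h3|/eqP h3].
    move: h2; rewrite h3 add0r le_eqVlt => /orP[/eqP h2|h2].
      by apply: Or44; rewrite h2 subrr.
    by apply: Or43; split=> //; rewrite ?subr_lt0// addrCA subrr addr0.
  have {}h3 := subr0_eq h3; rewrite h3 subrr addr0.
  move: h1; rewrite le_eqVlt => /orP[/eqP h1|h1].
    by apply: Or44; rewrite -h1.
  by apply: Or42.
have ltE i : lt i 0 = z0.2 i 0 + t * al i 0 by rewrite /lt !mxE.
have utE i : (p0.1.1 + t *: be) i 0 = p0.1.1 i 0 + t * be i 0 by rewrite !mxE.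
have alE i : al i 0 = (deg i && ((G *m y) i 0 == 0))%:R by rewrite mxE.
have beE i : be i 0 = [&& deg i, (G *m y) i 0 != 0 & eta i 0 == 0]%:R by rewrite mxE.
have pt_kkt : kkt_system E F c pt (z0.1, lt).
  split=> //= i; rewrite ltE utE alE beE /deg /=.
  have [[-> ->]|[/negbTE-> h1 -> ->]|[/negbTE-> h1 -> ->]|[/negbTE-> h1 -> ->]] := xi0E i.
  - by rewrite /= mulr0 addr0.
  - by rewrite /= gt_eqF//= !mulr0 !addr0 subrr mulr0; split=> //; exact: ltW.
  - by rewrite /= lt_eqF//= !mulr0 !addr0 mul0r; split=> //; rewrite gerDl ltW.
  - rewrite h1 eqxx/=; case: (_ == 0) => /=.
      by rewrite mulr0 !addr0 subrr mulr0 mulr1 add0r; split=> //; exact: ltW.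
    rewrite mulr0 addr0 mul0r; split=> //.
    by rewrite lerDl mulr_ge0// ltW.
have lt_V : V (z0.1, lt).
  apply: rV; rewrite norm_pair/= gt_max subrr normr0 r0/=.
  exact: le_lt_trans lt_near t_r.
have ht : h pt = (z0.1, lt) by exact: h_uniq.
have := h_lip _ _ qs_U pt_U; rewrite ht.
have [] := h_kkt _ qs_U.
move: (h qs) => -[x l] /= vsE l_kkt.
rewrite norm_pair/= ge_max => /andP[/le_trans x_near /le_trans l_near].
have {}x_near : `|x - z0.1| <= M * (s * N) by apply: x_near; rewrite ler_wpM2l// ltW.
have {}l_near : `|l - lt| <= M * (s * N) by apply: l_near; rewrite ler_wpM2l// ltW.
have l_near0 : `|l - z0.2| <= M * (s * N) + t.
  by rewrite -[l](subrK lt) -addrA (le_trans (ler_normD _ _))// lerD.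
pose r1 := s *: y - (J *m (x - z0.1) + G^T *m (l - lt)).
have r1_small : `|r1| <= delta * (M * (s * N)).
  have := F_str (x, l, p0.2) (z0.1, lt, p0.2); rewrite -vsE -/vt.
  rewrite addBK !norm_pair/= !subrr !normr0 mulmx0 addr0.
  rewrite !ge_max (ltW e10) (le_trans x_near (le_trans sMN_e ee1)).
  rewrite (le_trans l_near0 (le_trans near_e ee1)) (le_trans lt_near (le_trans t_le_e ee1)).
  move=> /(_ isT isT)/le_trans; apply; rewrite ler_wpM2l ?(ltW delta0)//.
  by rewrite !ge_max x_near l_near ltW.
pose dc := c (x, p0.2) - c (z0.1, p0.2).
pose r2 := dc - G *m (x - z0.1).
have r2_small : `|r2| <= delta * (M * (s * N)).
  have := c_str (x, p0.2) (z0.1, p0.2).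
  rewrite !norm_pair/= !subrr !normr0 mulmx0 addr0.
  rewrite !ge_max (ltW e20) (le_trans x_near (le_trans sMN_e ee2)).
  move=> /(_ isT isT)/le_trans; apply; rewrite ler_wpM2l ?(ltW delta0)//.
  by rewrite !ge_max x_near ltW.
have dc_small : `|dc| <= Kc * (M * (s * N)).
  have := c_lip (x, p0.2) (z0.1, p0.2).
  rewrite !norm_pair/= !subrr !normr0 !ge_max (ltW ec0) (le_trans x_near (le_trans sMN_e eec)).
  move=> /(_ isT isT)/le_trans; apply; rewrite ler_wpM2l ?(ltW Kc0)//.
  by rewrite ge_max x_near ltW.
pose sg := dc - s *: eta.
have sgE i : sg i 0 = c (x, p0.2) i 0 - c (z0.1, p0.2) i 0 - s * eta i 0.
  by rewrite /sg /dc !mxE.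
have dlE i : (l - lt) i 0 = l i 0 - lt i 0 by rewrite !mxE.
(* Both products vanish unless i is degenerate with (G y)_i and eta_i negative: the index is either
   surely active, so sg_i = 0, or surely inactive, so the multiplier stays 0. In the exceptional
   case feasibility alone gives the signs, as l_i >= 0 and sg_i <= 0. *)
have signs i : (G *m y) i 0 * (l - lt) i 0 - eta i 0 * sg i 0 <= 0.
  have dl : `|l i 0 - lt i 0| <= M * (s * N).
    by rewrite -dlE (le_trans (mx_entry_le_norm _ _ _)).
  have ds : `|sg i 0| <= Kc * (M * (s * N)) + s * N.
    rewrite (le_trans (mx_entry_le_norm _ _ _))// (le_trans (ler_normB _ _))// lerD//.
    by rewrite normrZ gtr0_norm// ler_wpM2l// ltW.
  have := l_kkt i; rewrite [(_ + s *: eta) i 0]mxE utE [(s *: eta) i 0]mxE.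
  have [cA1 cA0 cdeg] := crit i; have hbi := hb i.
  move: dl ds; rewrite dlE sgE ltE alE beE /deg /=.
  have [[Ei ->]|[Ei h1 -> ->]|[Ei h1 -> ->]|[Ei h1 -> ->]] := xi0E i.
  - rewrite Ei /= => _ _ ->; rewrite cA1 /= ?Ei//.
    by rewrite [leLHS](_ : _ = 0)//; ring.
  - rewrite (negbTE Ei) (gt_eqF h1) /= cA1 /= ?h1 ?orbT//.
    move=> dl ds [k1 k2 k3].
    rewrite gt_eqF// gtr0_norm// in hbi; have {}hbi := hbi isT.
    have lpos : 0 < l i 0.
      by move: dl hbi sMN_t t_e eb t0; rewrite ler_norml => /andP[+ _]; clear; lra.
    move/eqP: k3; rewrite mulf_eq0 gt_eqF//= => /eqP k3.
    move: (eta i 0) k3 => et k3.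
    have -> : c (x, p0.2) i 0 - p0.1.1 i 0 - s * et = 0 by move: k3; clear; lra.
    by rewrite mul0r mulr0 subrr.
  - rewrite (negbTE Ei) (lt_eqF h1) /= cA0 /= ?Ei ?h1//.
    move=> dl ds [k1 k2 k3].
    rewrite lt_eqF// ltr0_norm// in hbi; have {}hbi := hbi isT.
    have cneg : c (x, p0.2) i 0 - (p0.1.1 i 0 + t * 0 + s * 0) < 0.
      by move: ds hbi sKMN_t t_e eb t0; rewrite ler_norml => /andP[_ +]; clear; lra.
    move/eqP: k3; rewrite mulf_eq0 (lt_eqF cneg) orbF => /eqP ->.
    by rewrite mul0r mulr0 !addr0 subrr mulr0 subrr.
  - rewrite (negbTE Ei) h1 eqxx /=.
    have [Gy0|Gy0] := boolP ((G *m y) i 0 == 0) => /=.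
      rewrite (eqP Gy0) => dl ds [k1 k2 k3].
      have lpos : 0 < l i 0.
        by move: dl sMN_t t0; rewrite ler_norml => /andP[+ _]; clear; lra.
      move/eqP: k3; rewrite mulf_eq0 gt_eqF//= => /eqP k3.
      move: (eta i 0) k3 => et k3.
      have -> : c (x, p0.2) i 0 - p0.1.1 i 0 - s * et = 0 by move: k3; clear; lra.
      by rewrite mul0r mulr0 subrr.
    have [eta0|eta0] := boolP (eta i 0 == 0) => /=.
      rewrite (eqP eta0) => dl ds [k1 k2 k3].
      have cneg : c (x, p0.2) i 0 - (p0.1.1 i 0 + t * 1 + s * 0) < 0.
        by move: ds sKMN_t t0; rewrite ler_norml => /andP[_ +]; clear; lra.
      move/eqP: k3; rewrite mulf_eq0 (lt_eqF cneg) orbF => /eqP ->.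
      by rewrite mul0r mulr0 !addr0 subrr mulr0 subrr.
    move=> _ _ [k1 k2 _].
    case: cdeg => [/eqP|/eqP|[]]; rewrite ?(negbTE Gy0) ?(negbTE eta0)//.
    move: ((G *m y) i 0) (eta i 0) k2 => gy et k2 gy0 et0; move: k1 k2 gy0 et0; clear; nra.
have dot_signs : dotv (G *m y) (l - lt) - dotv eta sg <= 0.
  rewrite !dotvE -sumrB; apply: sumr_le0 => i _; exact: signs.
have sy : s *: y = J *m (x - z0.1) + G^T *m (l - lt) + r1.
  by rewrite /r1 [RHS]addrC subrK.
have Gx : G *m (x - z0.1) = s *: eta + sg - r2.
  by rewrite /r2 /sg [s *: eta + _]addrC subrK subKr.
(* Stationarity is paired with y and the constraint increments with eta; the terms in x - x0 cancel
   because J^T y = - G^T eta. *)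
have balance : s * (dotv y y + dotv eta eta) =
    dotv (G *m y) (l - lt) - dotv eta sg + dotv y r1 + dotv eta r2.
  have e_y : s * dotv y y = dotv (J^T *m y) (x - z0.1) + dotv (G *m y) (l - lt) + dotv y r1.
    by rewrite -dotvZr sy dotvDr [dotv y (_ + _)]dotvDr !dotv_trmx trmxK.
  have e_J : dotv (J^T *m y) (x - z0.1) = - (dotv eta (G *m (x - z0.1))).
    have -> : J^T *m y = - (G^T *m eta) by apply/eqP; rewrite -addr_eq0 stat eqxx.
    by rewrite dotv_trmx dotvC dotvNr dotvC.
  rewrite mulrDr e_y e_J Gx [dotv eta (_ - _)]dotvDr [dotv eta (_ + _)]dotvDr dotvNr dotvZr; ring.
have dot_ge0 k (w : 'cV[R]_k) : 0 <= dotv w w.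
  exact: le_trans (sqr_ge0 _) (norm_sqr_le_dotv w).
have sq : N ^+ 2 <= dotv y y + dotv eta eta.
  rewrite /N; case: (leP `|eta| `|y|) => _.
    by rewrite (le_trans (norm_sqr_le_dotv y))// lerDl.
  by rewrite (le_trans (norm_sqr_le_dotv eta))// lerDr.
have err1 : dotv y r1 <= n%:R * N * (delta * (M * (s * N))).
  rewrite (le_trans (ler_norm _))// (le_trans (dotv_norm_le _ _))//.
  by rewrite ler_pM ?mulr_ge0// ler_wpM2l.
have err2 : dotv eta r2 <= m%:R * N * (delta * (M * (s * N))).
  rewrite (le_trans (ler_norm _))// (le_trans (dotv_norm_le _ _))//.
  by rewrite ler_pM ?mulr_ge0// ler_wpM2l.
have errs : n%:R * N * (delta * (M * (s * N))) + m%:R * N * (delta * (M * (s * N)))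
    <= s * N ^+ 2 / 2.
  have -> : s * N ^+ 2 / 2 = q * (delta * M) * (s * N ^+ 2).
    have -> : q * (delta * M) = 1 / 2 by move: deltaE; clear; lra.
    by ring.
  rewrite -subr_ge0 (_ : _ - _ = delta * M * (s * N ^+ 2)); last by rewrite /q; ring.
  by rewrite ltW// mulr_gt0 ?mulr_gt0// exprn_gt0.
have := ler_wpM2l (ltW s0) sq; rewrite balance.
have : 0 < s * N ^+ 2 by rewrite mulr_gt0// exprn_gt0.
move: dot_signs err1 err2 errs; clear; lra.
Qed.
(** * Strict derivatives and symmetry of second derivatives *)

Section LineDerivatives.
Variables (R : realType).

Lemma is_derive_comp_affine (U V : normedModType R) (f : V -> R) (phi : U -> V)
    (x v : U) (v' : V) df :
  (forall h : R, phi (h *: v + x) = h *: v' + phi x) ->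
  is_derive (phi x) v' f df -> is_derive x v (f \o phi) df.
Proof.
move=> phiE [dfx <-].
have quotE : (fun h : R => h^-1 *: ((f \o shift (phi x)) (h *: v') - f (phi x))) =
    (fun h => h^-1 *: (((f \o phi) \o shift x) (h *: v) - (f \o phi) x)).
  by apply/funext => h; rewrite /= phiE.
by split; [move: dfx; rewrite /derivable quotE|rewrite /derive quotE].
Qed.

Lemma is_derive_diff (V : normedModType R) (f : V -> R) x v :
  differentiable f x -> is_derive x v f ('d f x v).
Proof. by move=> dfx; rewrite -deriveE//; apply/derivableP/diff_derivable. Qed.

Lemma is_derive_line (V : normedModType R) (f : V -> R) z v (s : R) :
  differentiable f (z + s *: v) ->
  is_derive s 1 (fun s : R => f (z + s *: v)) ('d f (z + s *: v) v).
Proof.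
move=> dfz; apply: (@is_derive_comp_affine R V f (fun s : R => z + s *: v) s 1 v).
  by move=> h; rewrite scalerDl [h *: 1]mulr1 addrCA.
exact: is_derive_diff.
Qed.

Lemma diffZ (V : normedModType R) (f : V -> R) z (h : R) w :
  'd f z (h *: w) = h * 'd f z w.
Proof. exact: linearZ. Qed.

Lemma mean_value_unit_interval (phi dphi : R -> R) :
  (forall s, is_derive s (1 : R) phi (dphi s)) ->
  exists2 s, 0 <= s <= 1 & phi 1 - phi 0 = dphi s.
Proof.
move=> dphiP.
have cont : {within `[0, 1], continuous phi}.
  apply: continuous_subspaceT => s.
  by apply: differentiable_continuous; apply/derivable1_diffP; case: (dphiP s).
have [s] := MVT_segment ler01 (fun s _ => dphiP s) cont.
by rewrite in_itv/= subr0 mulr1; exists s.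
Qed.

Lemma mean_value_segment (V : normedModType R) (f : V -> R) z1 z2 :
  (forall z, differentiable f z) -> exists2 s : R, 0 <= s <= 1 &
  f z1 - f z2 = 'd f (z2 + s *: (z1 - z2)) (z1 - z2).
Proof.
move=> df.
have [s s01] := mean_value_unit_interval (fun s => is_derive_line (v := z1 - z2) (df (z2 + s *: (z1 - z2)))).
by rewrite scale1r scale0r addr0 [z2 + _]addrC subrK; exists s.
Qed.

Lemma segment_near (V : normedModType R) (a z1 z2 : V) (s e : R) :
  0 <= s <= 1 -> `|z1 - a| <= e -> `|z2 - a| <= e -> `|z2 + s *: (z1 - z2) - a| <= e.
Proof.
move=> /andP[s0 s1] h1 h2.
have -> : z2 + s *: (z1 - z2) - a = s *: (z1 - a) + (1 - s) *: (z2 - a).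
  rewrite scalerBl scale1r addrCA -scalerBr opprB [z1 - a + _]addrA subrK.
  by rewrite addrAC.
rewrite (le_trans (ler_normD _ _))// !normrZ !ger0_norm ?subr_ge0//.
have : 0 <= 1 - s by rewrite subr_ge0.
by move: `|z1 - a| `|z2 - a| h1 h2 => x y h1 h2 s1'; nra.
Qed.

(** The common radius is a positive lower bound for the finitely many chosen radii, viewed as
    entries of a vector. *)
Lemma uniform_radius (I : finType) (P : I -> R -> Prop) :
  (forall i e e', 0 < e' -> e' <= e -> P i e -> P i e') ->
  (forall i, exists2 e : R, 0 < e & P i e) ->
  exists2 e : R, 0 < e & forall i, P i e.
Proof.
move=> anti ex.
have /choice[e eP] : forall i, exists e : R, 0 < e /\ P i e.
  by move=> i; have [e e0 Pe] := ex i; exists e.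
have [b b0 hb] := nonzero_entries_bounded_below (\col_(i < #|I|) e (enum_val i)).
exists b => // i; have [e0 Pe] := eP i; apply: anti b0 _ Pe.
have := hb (enum_rank i); rewrite mxE enum_rankK gt_eqF// gtr0_norm//.
exact.
Qed.

End LineDerivatives.

(** * Calculus of strict derivatives, and Schwarz's theorem *)

Section StrictDerivativeCalculus.
Variable R : realType.

Lemma strict_derivative_colvec (V : normedModType R) n (f df : V -> 'cV[R]_n) a :
  (forall i, strict_derivative (fun t => f t i 0) a (fun v => df v i 0)) ->
  strict_derivative f a df.
Proof.
move=> fi delta delta0.
have [|i|e e0 he] := @uniform_radius R 'I_n (fun i e => forall z1 z2,
    `|z1 - a| <= e -> `|z2 - a| <= e ->
    `|f z1 i 0 - f z2 i 0 - df (z1 - z2) i 0| <= delta * `|z1 - z2|).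
- by move=> i e e' _ ee' h z1 z2 h1 h2; apply: h; exact: le_trans ee'.
- exact: fi delta delta0.
exists e => // z1 z2 h1 h2; apply: mx_norm_le; first by rewrite mulr_ge0// ltW.
by move=> i j; rewrite ord1 !mxE; exact: he.
Qed.

Lemma strict_derivative_cst (V : normedModType R) (k : R) (a : V) :
  strict_derivative (fun=> k) a (fun=> 0).
Proof.
move=> delta delta0; exists 1 => // z1 z2 _ _.
by rewrite !subrr normr0 mulr_ge0// ltW.
Qed.

Lemma strict_derivativeD (V : normedModType R) (f g df dg : V -> R) a :
  strict_derivative f a df -> strict_derivative g a dg ->
  strict_derivative (fun t => f t + g t) a (fun v => df v + dg v).
Proof.
move=> hf hg delta delta0; have d2 : 0 < delta / 2 by rewrite divr_gt0.
have [e1 e10 {}hf] := hf _ d2; have [e2 e20 {}hg] := hg _ d2.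
exists (Num.min e1 e2); first by rewrite lt_min e10.
move=> z1 z2; rewrite !le_min => /andP[h11 h12] /andP[h21 h22].
rewrite [delta in leRHS]splitr mulrDl.
have -> : f z1 + g z1 - (f z2 + g z2) - (df (z1 - z2) + dg (z1 - z2)) =
  (f z1 - f z2 - df (z1 - z2)) + (g z1 - g z2 - dg (z1 - z2)) by ring.
by rewrite (le_trans (ler_normD _ _))// lerD// ?hf ?hg.
Qed.

Lemma strict_derivative_sum (V : normedModType R) n (f df : 'I_n -> V -> R) a :
  (forall i, strict_derivative (f i) a (df i)) ->
  strict_derivative (fun t => \sum_i f i t) a (fun v => \sum_i df i v).
Proof.
elim: n f df => [|n IH] f df h.
  have := @strict_derivative_cst V 0 a; congr strict_derivative;
    by apply/funext => t; rewrite big_ord0.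
have := strict_derivativeD (IH _ _ (fun i => h (widen_ord (leqnSn n) i))) (h ord_max).
by congr strict_derivative; apply/funext => t; rewrite big_ord_recr.
Qed.

Lemma strict_derivativeM (V : normedModType R) (f g df dg : V -> R) a Mf Mg :
  strict_derivative f a df -> strict_derivative g a dg ->
  (forall v, `|df v| <= Mf * `|v|) -> (forall v, `|dg v| <= Mg * `|v|) ->
  strict_derivative (fun t => f t * g t) a (fun v => f a * dg v + df v * g a).
Proof.
move=> hf hg bf bg delta delta0.
have [ef ef0 lf] := strict_derivative_lipschitz hf bf.
have [eg eg0 lg] := strict_derivative_lipschitz hg bg.
pose K := `|f a| + `|g a| + `|Mf| + `|Mg| + 2.
have K0 : 0 < K by rewrite ltr_wpDl// !addr_ge0.
pose d' := delta / (4 * K).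
have d'0 : 0 < d' by rewrite divr_gt0 ?mulr_gt0.
have d'E : 4 * (d' * K) = delta by rewrite mulrCA /d' divfK// gt_eqF ?mulr_gt0.
have [e1 e10 {}hf] := hf _ d'0; have [e2 e20 {}hg] := hg _ d'0.
pose e := Num.min (Num.min e1 e2) (Num.min (Num.min ef eg) (Num.min d' 1)).
have [[ee1 ee2] [eef eeg] [ed' e_le1]] : [/\ e <= e1 /\ e <= e2,
    e <= ef /\ e <= eg & e <= d' /\ e <= 1].
  by rewrite !ge_min !lexx !orbT.
have e0 : 0 < e by rewrite !lt_min e10 e20 ef0 eg0 d'0 ltr01.
have {bf} bf v : `|df v| <= K * `|v|.
  rewrite (le_trans (bf v))// ler_wpM2r// (le_trans (ler_norm _))// /K.
  have := normr_ge0 (f a); have := normr_ge0 (g a); have := normr_ge0 Mg; lra.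
have {bg} bg v : `|dg v| <= K * `|v|.
  rewrite (le_trans (bg v))// ler_wpM2r// (le_trans (ler_norm _))// /K.
  have := normr_ge0 (f a); have := normr_ge0 (g a); have := normr_ge0 Mf; lra.
have MfK : Mf + 1 <= K.
  rewrite /K; have := ler_norm Mf.
  have := normr_ge0 (f a); have := normr_ge0 (g a); have := normr_ge0 Mg; lra.
have MgK : Mg + 1 <= K.
  rewrite /K; have := ler_norm Mg.
  have := normr_ge0 (f a); have := normr_ge0 (g a); have := normr_ge0 Mf; lra.
exists (e / K); first by rewrite divr_gt0.
have K1 : 1 <= K.
  rewrite /K; have := normr_ge0 Mf.
  have := normr_ge0 (f a); have := normr_ge0 (g a); have := normr_ge0 Mg; lra.
have eK : e / K <= e by rewrite ler_pdivrMr// ler_peMr// ltW.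
have KeK : K * (e / K) = e by rewrite mulrC divfK// gt_eqF.
move: (e / K) eK KeK => e' e'e Ke' z1 z2 h1 h2.
have [h1e h2e] := (le_trans h1 e'e, le_trans h2 e'e).
have aa : `|a - a| <= e by rewrite subrr normr0 ltW.
have f1 : `|f z1 - f a| <= e.
  rewrite (le_trans (lf _ _ (le_trans h1e eef) (le_trans aa eef)))// -Ke'.
  by rewrite (le_trans (ler_wpM2r (normr_ge0 _) MfK))// ler_wpM2l// ltW.
have g2 : `|g z2 - g a| <= e.
  rewrite (le_trans (lg _ _ (le_trans h2e eeg) (le_trans aa eeg)))// -Ke'.
  by rewrite (le_trans (ler_wpM2r (normr_ge0 _) MgK))// ler_wpM2l// ltW.
have := hf _ _ (le_trans h1e ee1) (le_trans h2e ee1).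
have := hg _ _ (le_trans h1e ee2) (le_trans h2e ee2).
have := bf (z1 - z2); have := bg (z1 - z2); have n0 := normr_ge0 (z1 - z2).
set rg := g z1 - g z2 - dg _; set rf := f z1 - f z2 - df _ => bg' bf' rg' rf'.
(* Four error terms, each at most d' K |z1 - z2|, a quarter of the allowance. *)
have -> : f z1 * g z1 - f z2 * g z2 - (f a * dg (z1 - z2) + df (z1 - z2) * g a) =
  f z1 * rg + (f z1 - f a) * dg (z1 - z2) + rf * g z2 + df (z1 - z2) * (g z2 - g a).
  by rewrite /rf /rg; ring.
have f1K : `|f z1| <= K.
  rewrite -(subrK (f a) (f z1)) (le_trans (ler_normD _ _))// /K.
  have := normr_ge0 Mf; have := normr_ge0 (g a); have := normr_ge0 Mg; lra.
have g2K : `|g z2| <= K.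
  rewrite -(subrK (g a) (g z2)) (le_trans (ler_normD _ _))// /K.
  have := normr_ge0 Mf; have := normr_ge0 (f a); have := normr_ge0 Mg; lra.
have t1 : `|f z1 * rg| <= K * (d' * `|z1 - z2|) by rewrite normrM ler_pM.
have t2 : `|(f z1 - f a) * dg (z1 - z2)| <= d' * (K * `|z1 - z2|).
  by rewrite normrM ler_pM// (le_trans f1).
have t3 : `|rf * g z2| <= (d' * `|z1 - z2|) * K by rewrite normrM ler_pM.
have t4 : `|df (z1 - z2) * (g z2 - g a)| <= (K * `|z1 - z2|) * d'.
  by rewrite normrM ler_pM// (le_trans g2).
rewrite (le_trans (ler_normD _ _))//.
have := ler_normD (f z1 * rg + (f z1 - f a) * dg (z1 - z2)) (rf * g z2).
have := ler_normD (f z1 * rg) ((f z1 - f a) * dg (z1 - z2)).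
rewrite -d'E; nra.
Qed.

Lemma strict_derivative_comp (U V W : normedModType R) (f df : V -> W) (P : U -> V) a :
  (forall x y, P (x - y) = P x - P y) -> (forall x, `|P x| <= `|x|) ->
  strict_derivative f (P a) df -> strict_derivative (f \o P) a (df \o P).
Proof.
move=> PB P1 hf delta delta0; have [e e0 he] := hf _ delta0; exists e => // z1 z2 h1 h2.
rewrite /= PB (le_trans (he _ _ _ _))// -?PB ?(le_trans (P1 _))//.
by rewrite ler_wpM2l// ltW.
Qed.

Lemma colvec_sum_delta n (x : 'cV[R]_n) : x = \sum_i x i 0 *: delta_mx i 0.
Proof.
rewrite {1}[x]matrix_sum_delta; apply: eq_bigr => i _.
by rewrite big_ord1.
Qed.

Lemma linear_pair_delta (n d : nat) (W : lmodType R)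
    (phi : {linear ('cV[R]_n * 'cV[R]_d)%type -> W}) (v : 'cV[R]_n * 'cV[R]_d) :
  phi v = \sum_i v.1 i 0 *: phi (delta_mx i 0, 0) +
          \sum_j v.2 j 0 *: phi (0, delta_mx j 0).
Proof.
case: v => x w /=.
have -> : (x, w) = (x, 0) + (0, w).
  by transitivity (x + 0, 0 + w); first rewrite addr0 add0r.
rewrite linearD; congr (_ + _).
  have inlE (y y' : 'cV[R]_n) (a : R) :
      (a *: y + y', 0) = a *: (y, 0 : 'cV[R]_d) + (y', 0) :> 'cV[R]_n * 'cV[R]_d.
    by transitivity (a *: y + y', a *: (0 : 'cV[R]_d) + 0); first rewrite scaler0 addr0.
  rewrite [in LHS](colvec_sum_delta x).
  apply: (big_rec2 (fun y z => phi (y, 0) = z)) => [|i z y _ <-]; first exact: linear0.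
  by rewrite inlE linearP.
have inrE (y y' : 'cV[R]_d) (a : R) :
    (0, a *: y + y') = a *: (0 : 'cV[R]_n, y) + (0, y') :> 'cV[R]_n * 'cV[R]_d.
  by transitivity (a *: (0 : 'cV[R]_n) + 0, a *: y + y'); first rewrite scaler0 addr0.
rewrite [in LHS](colvec_sum_delta w).
apply: (big_rec2 (fun y z => phi (0, y) = z)) => [|i z y _ <-]; first exact: linear0.
by rewrite inrE linearP.
Qed.

Lemma linear_pair_bound (n d : nat) (phi : {linear ('cV[R]_n * 'cV[R]_d)%type -> R^o}) e :
  (forall i, `|phi (delta_mx i 0, 0)| <= e) ->
  (forall j, `|phi (0, delta_mx j 0)| <= e) ->
  forall v, `|phi v| <= (n%:R + d%:R) * e * `|v|.
Proof.
move=> h1 h2 v; rewrite linear_pair_delta (le_trans (ler_normD _ _))// 2!mulrDl lerD//.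
  rewrite (le_trans (ler_norm_sum _ _ _))//.
  have -> : n%:R * e * `|v| = \sum_(i < n) `|v| * e.
    by rewrite sumr_const card_ord -[RHS]mulr_natl; ring.
  apply: ler_sum => i _; rewrite normrM ler_pM// (le_trans (mx_entry_le_norm _ _ _))//.
  by have := norm_sub_fst_le v 0; rewrite !subr0.
rewrite (le_trans (ler_norm_sum _ _ _))//.
have -> : d%:R * e * `|v| = \sum_(i < d) `|v| * e.
  by rewrite sumr_const card_ord -[RHS]mulr_natl; ring.
apply: ler_sum => i _; rewrite normrM ler_pM// (le_trans (mx_entry_le_norm _ _ _))//.
by have := norm_sub_snd_le v 0; rewrite !subr0.
Qed.

Lemma diff_bounded n d (f : 'cV[R]_n * 'cV[R]_d -> R) a :
  exists M, forall v, `|'d f a v| <= M * `|v|.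
Proof.
pose e := \sum_i `|'d f a (delta_mx i 0, 0)| + \sum_j `|'d f a (0, delta_mx j 0)|.
exists ((n%:R + d%:R) * e); apply: linear_pair_bound => i; rewrite /e.
  rewrite (bigD1 i)//= -addrA lerDl addr_ge0// ?sumr_ge0//.
by rewrite addrC (bigD1 i)//= -addrA lerDl addr_ge0// ?sumr_ge0//.
Qed.

(** By the mean value theorem the error is ('d f zeta - 'd f a) (z1 - z2) for some zeta on the
    segment. Continuity of the derivative is known only for each fixed direction; the finitely many
    basis directions make it uniform. *)
Lemma C1_strict_derivative n d (f : 'cV[R]_n * 'cV[R]_d -> R) a :
  C1 f -> strict_derivative f a ('d f a).
Proof.
move=> [df cf] delta delta0.
pose e := delta / (n%:R + d%:R + 1).
have nd0 : (0 : R) < n%:R + d%:R + 1 by rewrite ltr_wpDl// addr_ge0.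
have e0 : 0 < e by rewrite divr_gt0.
have cont (v : 'cV[R]_n * 'cV[R]_d) : exists2 r : R, 0 < r &
    forall z, `|z - a| <= r -> `|'d f z v - 'd f a v| <= e.
  have /cvgrPdist_le/(_ _ e0) := cf v a.
  move=> /nbhs_normP[r /= r0 hr]; exists (r / 2); first by rewrite divr_gt0.
  move=> z hz; rewrite distrC; apply: hr; rewrite /= distrC (le_lt_trans hz)//.
  by rewrite ltr_pdivrMr// ltr_pMr// ltr1n.
have mono (v : 'cV[R]_n * 'cV[R]_d) r r' : 0 < r' -> r' <= r ->
   (forall z, `|z - a| <= r -> `|'d f z v - 'd f a v| <= e) ->
   (forall z, `|z - a| <= r' -> `|'d f z v - 'd f a v| <= e).
  by move=> _ rr' h z hz; apply: h; exact: le_trans rr'.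
have [r1 r10 h1] := uniform_radius (fun i => mono (delta_mx i 0, 0)) (fun i => cont (delta_mx i 0, 0)).
have [r2 r20 h2] := uniform_radius (fun i => mono (0, delta_mx i 0)) (fun i => cont (0, delta_mx i 0)).
exists (Num.min r1 r2); first by rewrite lt_min r10.
move=> z1 z2; rewrite !le_min => /andP[h11 h12] /andP[h21 h22].
have [s s01 ->] := mean_value_segment z1 z2 df.
set zeta := z2 + _.
have z_r1 : `|zeta - a| <= r1 by exact: segment_near.
have z_r2 : `|zeta - a| <= r2 by exact: segment_near.
have := @linear_pair_bound _ _ ('d f zeta \- 'd f a : {linear _ -> _}) e.
move=> /(_ (fun i => h1 i _ z_r1) (fun i => h2 i _ z_r2) (z1 - z2)) /= /le_trans; apply.
rewrite ler_wpM2r//.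
have -> : delta = (n%:R + d%:R + 1) * e by rewrite /e mulrC divfK// gt_eqF.
by rewrite ler_wpM2r ?(ltW e0)// lerDl.
Qed.

Lemma second_difference (V : normedModType R) (f : V -> R) (T : V -> R) a u v :
  (forall z, differentiable f z) -> (forall (h : R) w, T (h *: w) = h * T w) ->
  strict_derivative (fun z => 'd f z u) a T ->
  forall e : R, 0 < e -> exists2 r : R, 0 < r & forall h, 0 < h -> h <= r ->
  `|f (a + h *: u + h *: v) - f (a + h *: u) - f (a + h *: v) + f a -
    h ^+ 2 * T v| <= h ^+ 2 * e.
Proof.
move=> df TZ Tstrict e e0.
have v10 : 0 < `|v| + 1 by rewrite ltr_wpDl.
have e'0 : 0 < e / (`|v| + 1) by rewrite divr_gt0.
have [r r0 hr] := Tstrict _ e'0.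
have uv0 : 0 < `|u| + `|v| + 1 by rewrite ltr_wpDl// addr_ge0.
exists (r / (`|u| + `|v| + 1)); first by rewrite divr_gt0.
move=> h h0; rewrite ler_pdivlMr// => hr'.
(* The second difference is phi 1 - phi 0; the mean value theorem turns it into a difference of
   derivatives in direction u at two points that differ by h v, to which the strict derivative
   applies. *)
pose phi (s : R) := f (a + h *: v + s *: (h *: u)) - f (a + s *: (h *: u)).
have line z s : is_derive s (1 : R) (fun s => f (z + s *: (h *: u)))
    (h * 'd f (z + s *: (h *: u)) u).
  by apply: is_derive_eq; [exact: is_derive_line|exact: diffZ].
have dphi s : is_derive s (1 : R) phi
   (h * 'd f (a + h *: v + s *: (h *: u)) u - h * 'd f (a + s *: (h *: u)) u).
  exact: is_deriveB.
have [s /andP[s0 s1] E] := mean_value_unit_interval dphi.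
have -> : f (a + h *: u + h *: v) - f (a + h *: u) - f (a + h *: v) + f a = phi 1 - phi 0.
  by rewrite /phi !scale1r !scale0r !addr0 [a + h *: u + _]addrAC; ring.
rewrite E.
have [z1 z1E] : exists z, a + h *: v + s *: (h *: u) = z by eexists.
have [z2 z2E] : exists z, a + s *: (h *: u) = z by eexists.
rewrite z1E z2E.
have zE : z1 - z2 = h *: v.
  by rewrite -z1E -z2E opprD addrACA subrr addr0 [a + _]addrC addrK.
have shu : s * (h * `|u|) <= h * `|u| by rewrite ler_piMl// mulr_ge0// ltW.
have hv0 : 0 <= h * `|v| by rewrite mulr_ge0// ltW.
have {}hr' : h * `|u| + h * `|v| + h <= r by rewrite -mulrDr -[X in _ + X <= _]mulr1 -mulrDr.
have near1 : `|z1 - a| <= r.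
  rewrite -z1E -[a + h *: v + _]addrA [a + _]addrC addrK (le_trans (ler_normD _ _))// !normrZ.
  rewrite (gtr0_norm h0) (ger0_norm s0).
  by move: hr' shu hv0 h0; clear; lra.
have near2 : `|z2 - a| <= r.
  rewrite -z2E [a + _]addrC addrK !normrZ (gtr0_norm h0) (ger0_norm s0).
  by move: hr' shu hv0 h0; clear; lra.
have := hr _ _ near1 near2; rewrite zE normrZ (gtr0_norm h0) TZ => H.
set X := 'd f z1 u in H *; set Y := 'd f z2 u in H *.
have -> : h * X - h * Y - h ^+ 2 * T v = h * (X - Y - h * T v) by ring.
rewrite normrM gtr0_norm// expr2 -mulrA ler_wpM2l ?(ltW h0)//.
rewrite (le_trans H)// mulrCA ler_wpM2l ?(ltW h0)//.
by rewrite mulrAC ler_pdivrMr// ler_wpM2l ?(ltW e0)// lerDl.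
Qed.

(** The second difference is symmetric in u and v, and divided by h^2 it is within e / 2 of either
    mixed derivative for small h. *)
Lemma second_diff_sym n d (f : 'cV[R]_n * 'cV[R]_d -> R) a u v :
  C2 f -> 'd (fun z => 'd f z u) a v = 'd (fun z => 'd f z v) a u.
Proof.
move=> [[df _] C1d].
have sd w := C1_strict_derivative a (C1d w).
have TZ w := diffZ (fun z => 'd f z w) a.
move: ('d _ a) (sd u) (TZ u) => Tu sdu TuZ; move: ('d _ a) (sd v) (TZ v) => Tv sdv TvZ.
apply/eqP; rewrite -subr_eq0 -normr_le0; apply/ler_addgt0Pr => e e0.
have e2 : 0 < e / 2 by rewrite divr_gt0.
have [r1 r10 h1] := second_difference v df TuZ sdu e2.
have [r2 r20 h2] := second_difference u df TvZ sdv e2.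
pose h := Num.min r1 r2; have h0 : 0 < h by rewrite lt_min r10.
have := h1 h h0; rewrite ge_min lexx => /(_ isT).
have := h2 h h0; rewrite ge_min lexx orbT => /(_ isT).
rewrite [a + h *: v + _]addrAC.
move: (f _) (f _) (f _) (f a) (Tv u) (Tu v) => A0 A1 A2 A3 X Y k1 k2.
rewrite add0r -(ler_pM2l (exprn_gt0 2 h0)) -[leLHS]ger0_norm ?mulr_ge0 ?(ltW h0)//.
rewrite normrM normr_id -normrM.
have -> : h ^+ 2 * (Y - X) = (A2 - A1 - A0 + A3 - h ^+ 2 * X) - (A2 - A0 - A1 + A3 - h ^+ 2 * Y).
  by ring.
by rewrite (le_trans (ler_normB _ _))// [e in leRHS]splitr mulrDr lerD.
Qed.

End StrictDerivativeCalculus.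

(** * The Nash equilibrium problem as a single KKT system *)

Section SliceDerivatives.
Variable R : realType.

Lemma pair_linear_slice n d (h : R) (x v : 'cV[R]_n) (w : 'cV[R]_d) :
  (h *: v + x, w) = h *: (v, 0 : 'cV[R]_d) + (x, w) :> 'cV[R]_n * 'cV[R]_d.
Proof. by transitivity (h *: v + x, h *: (0 : 'cV[R]_d) + w); first rewrite scaler0 add0r. Qed.

Lemma is_derive_slice p n d (g : 'cV[R]_n * 'cV[R]_d -> R) (l : 'cV[R]_p -> 'cV[R]_n)
    (x v : 'cV[R]_p) w :
  (forall (h : R) v x, l (h *: v + x) = h *: l v + l x) ->
  differentiable g (l x, w) ->
  is_derive x v (fun x => g (l x, w)) ('d g (l x, w) (l v, 0)).
Proof.
move=> l_lin dg; apply: (@is_derive_comp_affine R _ _ g (fun x => (l x, w)) x v (l v, 0)).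
  by move=> h; rewrite l_lin pair_linear_slice.
exact: is_derive_diff.
Qed.

Lemma linear_colvec_delta n (phi : 'cV[R]_n -> R) (x : 'cV[R]_n) :
  (forall (h : R) v x, phi (h *: v + x) = h * phi v + phi x) ->
  phi x = \sum_b phi (delta_mx b 0) * x b 0.
Proof.
move=> lin.
have phi0 : phi 0 = 0.
  by apply: (addrI (phi 0)); have := lin 1 0 0; rewrite scale1r addr0 mul1r addr0 => <-.
rewrite [in LHS](colvec_sum_delta x).
apply: (big_rec2 (fun y z => phi y = z)) => // b z y _ <-.
by rewrite lin mulrC.
Qed.

End SliceDerivatives.

(** * Flat indices versus pairs of a player and a position *)

Section FlatIndices.
Variables (R : realType) (N : nat) (q : 'I_N -> nat).
Import tagnat.

Lemma tagnat_forall (Q : forall k, 'I_(q k) -> Prop) :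
  (forall i : 'I_(\sum_k q k), Q (sig1 i) (sig2 i)) <-> (forall k i, Q k i).
Proof.
split=> [h k i|h i]; last exact: h.
by have := h (rank (Tagged (fun k => 'I_(q k)) i)); rewrite /sig1 /sig2 rankK.
Qed.

Lemma tagnat_sum (f : forall k, 'I_(q k) -> R) :
  \sum_(i < \sum_k q k) f (sig1 i) (sig2 i) = \sum_k \sum_(i < q k) f k i.
Proof.
rewrite sig_big_dep/= [RHS](reindex _ tagnat.sig_bij_on)/=.
by apply: eq_bigr => i _.
Qed.

Lemma submxcol_sig (x : 'cV[R]_(\sum_k q k)) i :
  submxcol x (sig1 i) (sig2 i) 0 = x i 0.
Proof. by rewrite mxE sig2K. Qed.

Lemma submxcol_linear k (h : R) (v x : 'cV[R]_(\sum_k q k)) :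
  submxcol (h *: v + x) k = h *: submxcol v k + submxcol x k.
Proof. by apply/colP => i; rewrite !mxE. Qed.

Lemma norm_submxcol_le (x : 'cV[R]_(\sum_k q k)) k : `|submxcol x k| <= `|x|.
Proof. by apply: mx_norm_le => // i j; rewrite mxE mx_entry_le_norm. Qed.

Lemma submxcol_delta_neq (a : 'I_(\sum_k q k)) k : k != sig1 a ->
  submxcol (delta_mx a 0 : 'cV[R]_(\sum_k q k)) k = 0.
Proof.
move=> ka; apply/colP => i; rewrite !mxE; case: eqP => // e.
by move: ka; rewrite -e Rank1K eqxx.
Qed.

End FlatIndices.

Section FlatNEP.
Variables (R : realType) (N : nat) (P : nep R N).
Import tagnat.

Local Notation strat := 'cV[R]_(\sum_(k < N) nx P k).
Local Notation mult := 'cV[R]_(\sum_(k < N) mc P k).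
Local Notation wpar := 'cV[R]_(\sum_(k < N) dw P k).

Definition obj_pair k (z : strat * 'cV[R]_(dw P k)) : R := obj z.1 z.2.
Definition cstr_pair k (i : 'I_(mc P k)) (z : 'cV[R]_(nx P k) * 'cV[R]_(dw P k)) : R :=
  cstr i z.1 z.2.

Definition obj_partial k a (z : strat * 'cV[R]_(dw P k)) : R :=
  'd (@obj_pair k) z (delta_mx a 0, 0).
(** The direction is block k of a flat basis vector, hence 0 when coordinate a belongs to another
    player. This lets constraints be differentiated in the full vector x, like objectives. *)
Definition cstr_partial k (i : 'I_(mc P k)) (a : 'I_(\sum_(k < N) nx P k))
    (z : 'cV[R]_(nx P k) * 'cV[R]_(dw P k)) : R :=
  'd (@cstr_pair k i) z (submxcol (delta_mx a 0 : strat) k, 0).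

Lemma obj_pair_C2 k : C2 (@obj_pair k). Proof. exact: obj_C2. Qed.
Lemma cstr_pair_C2 k i : C2 (@cstr_pair k i). Proof. exact: cstr_C2. Qed.

Lemma obj_partial_C1 k a : C1 (@obj_partial k a).
Proof. by have [_] := @obj_pair_C2 k; apply. Qed.
Lemma cstr_partial_C1 k i a : C1 (@cstr_partial k i a).
Proof. by have [_] := @cstr_pair_C2 k i; apply. Qed.

Lemma is_derive_lagrangian_like k (g0 : strat * 'cV[R]_(dw P k) -> R)
   (g : 'I_(mc P k) -> 'cV[R]_(nx P k) * 'cV[R]_(dw P k) -> R)
   (lam : 'cV[R]_(mc P k)) w (x v : strat) :
  (forall z, differentiable g0 z) -> (forall i z, differentiable (g i) z) ->
  is_derive x v (fun x => g0 (x, w) + \sum_i lam i 0 * g i (submxcol x k, w))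
    ('d g0 (x, w) (v, 0) +
     \sum_i lam i 0 * 'd (g i) (submxcol x k, w) (submxcol v k, 0)).
Proof.
move=> dg0 dg; apply: is_deriveD; first exact: (is_derive_slice (l := id)).
have -> : (fun x : strat => \sum_i lam i 0 * g i (submxcol x k, w)) =
    \sum_i (lam i 0 \*: (fun x : strat => g i (submxcol x k, w))).
  by apply/funext => t; rewrite fct_sumE.
apply: is_derive_sum => i; apply: is_deriveZ.
by apply: (is_derive_slice (l := fun x : strat => submxcol x k)) => // h u t; exact: submxcol_linear.
Qed.

Lemma partial_lagrangian k a (x : strat) (lam : 'cV[R]_(mc P k)) w :
  partial (fun x' : strat => lagrangian x' lam w) a x =
  obj_partial a (x, w) + \sum_i lam i 0 * cstr_partial i a (submxcol x k, w).
Proof.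
have dobj z : differentiable (@obj_pair k) z by have [[]] := @obj_pair_C2 k.
have dcstr i z : differentiable (@cstr_pair k i) z by have [[]] := @cstr_pair_C2 k i.
by have [_] := is_derive_lagrangian_like lam w x (delta_mx a 0) dobj dcstr.
Qed.

Lemma partial2_lagrangian k a b (x : strat) (lam : 'cV[R]_(mc P k)) w :
  partial (partial (fun x' : strat => lagrangian x' lam w) a) b x =
  'd (@obj_partial k a) (x, w) (delta_mx b 0, 0) +
  \sum_i lam i 0 * 'd (@cstr_partial k i a) (submxcol x k, w)
    (submxcol (delta_mx b 0 : strat) k, 0).
Proof.
have -> : partial (fun x' : strat => lagrangian x' lam w) a = fun x : strat =>
    obj_partial a (x, w) + \sum_i lam i 0 * cstr_partial i a (submxcol x k, w).
  by apply/funext => t; exact: partial_lagrangian.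
have dobj z : differentiable (@obj_partial k a) z by have [] := @obj_partial_C1 k a.
have dcstr i z : differentiable (@cstr_partial k i a) z by have [] := @cstr_partial_C1 k i a.
by have [_] := is_derive_lagrangian_like lam w x (delta_mx b 0) dobj dcstr.
Qed.

Lemma partial2_lagrangian_sym k a b (x : strat) (lam : 'cV[R]_(mc P k)) w :
  partial (partial (fun x' : strat => lagrangian x' lam w) a) b x =
  partial (partial (fun x' : strat => lagrangian x' lam w) b) a x.
Proof.
rewrite !partial2_lagrangian; congr (_ + _).
  exact: second_diff_sym (@obj_pair_C2 k).
by apply: eq_bigr => i _; congr (_ * _); exact: second_diff_sym (@cstr_pair_C2 k i).
Qed.

Definition is_equality (i : 'I_(\sum_(k < N) mc P k)) := (sig2 i < sc P (sig1 i))%N.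

(** Coordinate a uses the Lagrangian of the player who owns it. *)
Definition stationarity_map (t : strat * mult * wpar) : strat :=
  \col_a partial (fun x => lagrangian x (submxcol t.1.2 (sig1 a))
                              (submxcol t.2 (sig1 a))) a t.1.1.

Definition constraint_map (t : strat * wpar) : mult :=
  \col_i cstr (sig2 i) (submxcol t.1 (sig1 i)) (submxcol t.2 (sig1 i)).

Lemma S_KKT_kkt_system p : S_KKT (P := P) p = kkt_system is_equality stationarity_map constraint_map p.
Proof.
apply/seteqP; split=> z h.
  split.
    apply/colP => a; rewrite mxE /=; have [/colP/(_ (sig2 a)) + _ _] := h (sig1 a).
    by rewrite /vblk submxcol_sig mxE [X in _ = X -> _]mxE sig2K => ->.
  move=> i; have [_ h1 h2] := h (sig1 i).
  rewrite mxE -[p.1.1 i 0]submxcol_sig -[z.2 i 0]submxcol_sig /is_equality.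
  by case: ltnP => hi; [exact: h1|exact: h2].
move=> k; have [h1 h2] := h.
(* Stated for a player and a position, so that [tagnat_forall] can transfer it from flat indices. *)
pose Q2 k (i : 'I_(mc P k)) :=
  if (i < sc P k)%N
  then cstr i (submxcol z.1 k) (submxcol p.2 k) = submxcol p.1.1 k i 0
  else [/\ 0 <= submxcol z.2 k i 0,
      cstr i (submxcol z.1 k) (submxcol p.2 k) <= submxcol p.1.1 k i 0 &
      submxcol z.2 k i 0 *
        (cstr i (submxcol z.1 k) (submxcol p.2 k) - submxcol p.1.1 k i 0) = 0].
have {}h2 : forall k i, Q2 k i.
  by apply/tagnat_forall => i; have := h2 i; rewrite /Q2 mxE !submxcol_sig.
pose Q1 k (a : 'I_(nx P k)) :=
  vblk p k a 0 = grad_lagrangian z.1 (submxcol z.2 k) (wblk p k) a 0.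
have {}h1 : forall k a, Q1 k a.
  apply/tagnat_forall => a; rewrite /Q1 /vblk submxcol_sig h1 /grad_lagrangian.
  by rewrite [RHS]mxE [RHS]mxE sig2K mxE.
move=> x lam g; split.
- by apply/colP => a; exact: h1.
- by move=> i hi; have := h2 k i; rewrite /Q2 hi.
- by move=> i hi; have := h2 k i; rewrite /Q2 ltnNge hi.
Qed.

End FlatNEP.

(** * Jacobians of the stacked system at the reference point *)

Section ReferenceJacobians.
Variables (R : realType) (N : nat) (P : nep R N).
Import tagnat.

Local Notation strat := 'cV[R]_(\sum_(k < N) nx P k).
Local Notation mult := 'cV[R]_(\sum_(k < N) mc P k).
Local Notation wpar := 'cV[R]_(\sum_(k < N) dw P k).

Variables (p : mult * strat * wpar) (z : strat * mult).

Local Notation lam k := (submxcol z.2 k : 'cV[R]_(mc P k)).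
Local Notation xk k := (submxcol z.1 k : 'cV[R]_(nx P k)).

Definition stationarity_jac : 'M[R]_(\sum_(k < N) nx P k) :=
  \matrix_(a, b) partial (partial
    (fun x => lagrangian x (lam (sig1 a)) (wblk p (sig1 a))) a) b z.1.

Definition stationarity_jac_w : 'M[R]_(\sum_(k < N) nx P k, \sum_(k < N) dw P k) :=
  \matrix_(a, j) ('d (@obj_partial R N P (sig1 a) a) (z.1, wblk p (sig1 a))
      (0, submxcol (delta_mx j 0 : wpar) (sig1 a)) +
    \sum_i lam (sig1 a) i 0 * 'd (@cstr_partial R N P (sig1 a) i a)
      (xk (sig1 a), wblk p (sig1 a)) (0, submxcol (delta_mx j 0 : wpar) (sig1 a))).

Definition constraint_jac : 'M[R]_(\sum_(k < N) mc P k, \sum_(k < N) nx P k) :=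
  \matrix_(i, b) cstr_partial (sig2 i) b (xk (sig1 i), wblk p (sig1 i)).

Definition constraint_jac_w : 'M[R]_(\sum_(k < N) mc P k, \sum_(k < N) dw P k) :=
  \matrix_(i, j) 'd (@cstr_pair R N P (sig1 i) (sig2 i)) (xk (sig1 i), wblk p (sig1 i))
    (0, submxcol (delta_mx j 0 : wpar) (sig1 i)).

(** Entry (i, j) on either side is a second derivative of the Lagrangian of the player owning j, but
    in opposite orders of differentiation. *)
Lemma critical_matrix_jac : critical_matrix p z = stationarity_jac^T.
Proof.
apply/matrixP => i j; rewrite !mxE !sig2K.
exact: partial2_lagrangian_sym.
Qed.

Lemma diff_fst n d (f : 'cV[R]_n * 'cV[R]_d -> R) a (h : R) v x :
  'd f a (h *: v + x, 0) = h * 'd f a (v, 0) + 'd f a (x, 0).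
Proof. by rewrite pair_linear_slice; exact: linearP. Qed.

Lemma diff_snd n d (f : 'cV[R]_n * 'cV[R]_d -> R) a (h : R) v x :
  'd f a (0, h *: v + x) = h * 'd f a (0, v) + 'd f a (0, x).
Proof.
have -> : (0, h *: v + x) = h *: (0 : 'cV[R]_n, v) + (0, x) :> 'cV[R]_n * 'cV[R]_d.
  by transitivity (h *: (0 : 'cV[R]_n) + 0, h *: v + x); first rewrite scaler0 addr0.
exact: linearP.
Qed.

Lemma diff_pair n d (f : 'cV[R]_n * 'cV[R]_d -> R) a v w :
  'd f a (v, w) = 'd f a (v, 0) + 'd f a (0, w).
Proof.
have -> : (v, w) = (v, 0) + (0, w) :> 'cV[R]_n * 'cV[R]_d.
  by transitivity (v + 0, 0 + w); first rewrite addr0 add0r.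
exact: linearD.
Qed.

Lemma sumrD m (f g : 'I_m -> R) : \sum_i (f i + g i) = \sum_i f i + \sum_i g i.
Proof. exact: big_split. Qed.

Lemma sum_mul_affine m (c e f g : 'I_m -> R) (h : R) :
  (forall i, e i = h * f i + g i) ->
  \sum_i c i * e i = h * (\sum_i c i * f i) + \sum_i c i * g i.
Proof. by move=> eE; rewrite mulr_sumr -sumrD; apply: eq_bigr => i _; rewrite eE; ring. Qed.

Lemma constraint_jac_mul (y : strat) i : (constraint_jac *m y) i 0 =
  'd (@cstr_pair R N P (sig1 i) (sig2 i)) (xk (sig1 i), wblk p (sig1 i))
    (submxcol y (sig1 i), 0).
Proof.
rewrite mxE (@linear_colvec_delta _ _ (fun y : strat => 'd (@cstr_pair R N P (sig1 i) (sig2 i))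
   (xk (sig1 i), wblk p (sig1 i)) (submxcol y (sig1 i), 0))).
  by apply: eq_bigr => b _; rewrite mxE.
by move=> h v x; rewrite submxcol_linear diff_fst.
Qed.

Lemma constraint_jac_dotv (y : strat) i : (constraint_jac *m y) i 0 =
  dotv (grad_cstr p z (sig2 i)) (submxcol y (sig1 i)).
Proof.
rewrite constraint_jac_mul dotvE.
rewrite (@linear_colvec_delta _ _ (fun y => 'd (@cstr_pair R N P (sig1 i) (sig2 i))
   (xk (sig1 i), wblk p (sig1 i)) (y, 0))); last by move=> h v x; exact: diff_fst.
apply: eq_bigr => b _; congr (_ * _); rewrite mxE.
have dc t : differentiable (@cstr_pair R N P (sig1 i) (sig2 i)) t.
  by have [[]] := cstr_pair_C2 (sig2 i).
have [_ e] := is_derive_slice (l := id) (delta_mx b 0) (fun h v x => erefl) (dc (xk (sig1 i), wblk p (sig1 i))).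
exact: esym e.
Qed.

Lemma stationarity_jac_mul (v : strat) a : (stationarity_jac *m v) a 0 =
  'd (@obj_partial R N P (sig1 a) a) (z.1, wblk p (sig1 a)) (v, 0) +
  \sum_i lam (sig1 a) i 0 * 'd (@cstr_partial R N P (sig1 a) i a)
     (xk (sig1 a), wblk p (sig1 a)) (submxcol v (sig1 a), 0).
Proof.
rewrite mxE (@linear_colvec_delta _ _ (fun v : strat =>
  'd (@obj_partial R N P (sig1 a) a) (z.1, wblk p (sig1 a)) (v, 0) +
  \sum_i lam (sig1 a) i 0 * 'd (@cstr_partial R N P (sig1 a) i a)
     (xk (sig1 a), wblk p (sig1 a)) (submxcol v (sig1 a), 0))).
  by apply: eq_bigr => b _; rewrite mxE partial2_lagrangian.
move=> h w x; rewrite diff_fst.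
rewrite [X in _ + X = _](@sum_mul_affine _ _ _
  (fun i => 'd (@cstr_partial R N P (sig1 a) i a)
    (xk (sig1 a), wblk p (sig1 a)) (submxcol w (sig1 a), 0))
  (fun i => 'd (@cstr_partial R N P (sig1 a) i a)
    (xk (sig1 a), wblk p (sig1 a)) (submxcol x (sig1 a), 0)) h); first by ring.
by move=> i; rewrite submxcol_linear diff_fst.
Qed.

Lemma stationarity_jac_w_mul (w : wpar) a : (stationarity_jac_w *m w) a 0 =
  'd (@obj_partial R N P (sig1 a) a) (z.1, wblk p (sig1 a)) (0, submxcol w (sig1 a)) +
  \sum_i lam (sig1 a) i 0 * 'd (@cstr_partial R N P (sig1 a) i a)
     (xk (sig1 a), wblk p (sig1 a)) (0, submxcol w (sig1 a)).
Proof.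
rewrite mxE (@linear_colvec_delta _ _ (fun w : wpar =>
  'd (@obj_partial R N P (sig1 a) a) (z.1, wblk p (sig1 a)) (0, submxcol w (sig1 a)) +
  \sum_i lam (sig1 a) i 0 * 'd (@cstr_partial R N P (sig1 a) i a)
     (xk (sig1 a), wblk p (sig1 a)) (0, submxcol w (sig1 a)))).
  by apply: eq_bigr => b _; rewrite mxE.
move=> h v x; rewrite submxcol_linear diff_snd.
rewrite [X in _ + X = _](@sum_mul_affine _ _ _
  (fun i => 'd (@cstr_partial R N P (sig1 a) i a)
    (xk (sig1 a), wblk p (sig1 a)) (0, submxcol v (sig1 a)))
  (fun i => 'd (@cstr_partial R N P (sig1 a) i a)
    (xk (sig1 a), wblk p (sig1 a)) (0, submxcol x (sig1 a))) h); first by ring.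
by move=> i; rewrite diff_snd.
Qed.

Lemma constraint_jac_w_mul (w : wpar) i : (constraint_jac_w *m w) i 0 =
  'd (@cstr_pair R N P (sig1 i) (sig2 i)) (xk (sig1 i), wblk p (sig1 i))
    (0, submxcol w (sig1 i)).
Proof.
rewrite mxE (@linear_colvec_delta _ _ (fun w : wpar => 'd (@cstr_pair R N P (sig1 i) (sig2 i))
   (xk (sig1 i), wblk p (sig1 i)) (0, submxcol w (sig1 i)))).
  by apply: eq_bigr => b _; rewrite mxE.
by move=> h v x; rewrite submxcol_linear diff_snd.
Qed.

(** Constraints of other players do not involve the strategy of [sig1 a], so only the owner's remain
    in the sum. This is why the multiplier derivative of stationarity is the transpose of the whole
    constraint Jacobian. *)
Lemma constraint_jac_tr_mul (l : mult) a : (constraint_jac^T *m l) a 0 =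
  \sum_i submxcol l (sig1 a) i 0 * cstr_partial i a (xk (sig1 a), wblk p (sig1 a)).
Proof.
rewrite mxE; pose f k (i : 'I_(mc P k)) :=
  submxcol l k i 0 * cstr_partial i a (xk k, wblk p k).
transitivity (\sum_(i < \sum_k mc P k) f (sig1 i) (sig2 i)).
  by apply: eq_bigr => i _; rewrite !mxE /f submxcol_sig mulrC.
rewrite tagnat_sum (bigD1 (sig1 a))//= [X in _ + X = _]big1 ?addr0// => k ka.
apply: big1 => i _; rewrite /f /cstr_partial submxcol_delta_neq//.
have -> : (0, 0) = 0 :> 'cV[R]_(nx P k) * 'cV[R]_(dw P k) by [].
by rewrite [X in _ * X](_ : _ = 0) ?mulr0//; exact: linear0.
Qed.

Lemma stationarity_map_strict : strict_derivative (@stationarity_map R N P)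
  (z.1, z.2, p.2)
  (fun t => stationarity_jac *m t.1.1 + constraint_jac^T *m t.1.2 + stationarity_jac_w *m t.2).
Proof.
apply: strict_derivative_colvec => a; pose k := sig1 a.
pose P0 (t : strat * mult * wpar) := (t.1.1, submxcol t.2 k : 'cV[R]_(dw P k)).
pose P1 (t : strat * mult * wpar) :=
  (submxcol t.1.1 k : 'cV[R]_(nx P k), submxcol t.2 k : 'cV[R]_(dw P k)).
pose P2 i (t : strat * mult * wpar) : R := (submxcol t.1.2 k : 'cV[R]_(mc P k)) i 0.
have P0B t t' : P0 (t - t') = P0 t - P0 t' by rewrite /P0 /= submxcolB.
have P1B t t' : P1 (t - t') = P1 t - P1 t' by rewrite /P1 /= !submxcolB.
have P2B i t t' : P2 i (t - t') = P2 i t - P2 i t' by rewrite /P2 /= !mxE.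
have n1 (t : strat * mult * wpar) : `|t.1.1| <= `|t|.
  by case: t => [[x l] w]; rewrite !norm_pair !le_max lexx.
have n2 (t : strat * mult * wpar) : `|t.1.2| <= `|t|.
  by case: t => [[x l] w]; rewrite !norm_pair !le_max lexx orbT.
have n3 (t : strat * mult * wpar) : `|t.2| <= `|t|.
  by case: t => [[x l] w]; rewrite !norm_pair !le_max lexx orbT.
have P0n t : `|P0 t| <= `|t|.
  by rewrite norm_pair ge_max n1 (le_trans (norm_submxcol_le _ _)).
have P1n t : `|P1 t| <= `|t|.
  by rewrite norm_pair ge_max !(le_trans (norm_submxcol_le _ _)).
have P2n i t : `|P2 i t| <= 1 * `|t|.
  by rewrite mul1r (le_trans (mx_entry_le_norm _ _ _))// (le_trans (norm_submxcol_le _ _)).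
have P2s i t : strict_derivative (P2 i) t (P2 i).
  move=> delta delta0; exists 1 => // t1 t2 _ _.
  by rewrite P2B subrr normr0 mulr_ge0// ltW.
pose t0 := (z.1, z.2, p.2).
have D1n i : exists M, forall v, `|('d (@cstr_partial R N P k i a) (P1 t0) \o P1) v| <= M * `|v|.
  have [M hM] := diff_bounded (@cstr_partial R N P k i a) (P1 t0).
  exists `|M| => v; rewrite /= (le_trans (hM _))//.
  by rewrite (@le_trans _ _ (`|M| * `|P1 v|))// ?ler_wpM2l// ler_wpM2r// ler_norm.
(* The product rule: the factor [P2 i] is a multiplier, and differentiating it produces the G^T
   term. *)
have prod_strict i : strict_derivative
    (fun t => P2 i t * (@cstr_partial R N P k i a \o P1) t) t0
    (fun v => P2 i t0 * ('d (@cstr_partial R N P k i a) (P1 t0) \o P1) v +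
              P2 i v * (@cstr_partial R N P k i a \o P1) t0).
  have [M hM] := D1n i; apply: strict_derivativeM (P2s i t0) _ (P2n i) hM.
  exact: strict_derivative_comp P1B P1n (C1_strict_derivative (P1 t0) (@cstr_partial_C1 R N P k i a)).
have H := strict_derivativeD
  (strict_derivative_comp P0B P0n (C1_strict_derivative (P0 t0) (@obj_partial_C1 R N P k a)))
  (strict_derivative_sum prod_strict).
move: H; congr strict_derivative; apply/funext => t.
  by rewrite mxE partial_lagrangian.
rewrite [RHS]mxE [X in _ = X + _]mxE stationarity_jac_mul stationarity_jac_w_mul constraint_jac_tr_mul.
rewrite /= [in LHS]/P0 diff_pair sumrD.
rewrite [X in _ + (X + _) = _](_ : _ = \sum_i lam k i 0 * 'd (@cstr_partial R N P k i a)
     (xk k, wblk p k) (submxcol t.1.1 k, 0) + \sum_i lam k i 0 * 'd (@cstr_partial R N P k i a)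
     (xk k, wblk p k) (0, submxcol t.2 k)); last first.
  by rewrite -sumrD; apply: eq_bigr => i _; rewrite /P1 diff_pair mulrDr.
rewrite /P2 /P1 /t0 /= -/k /wblk; ring.
Qed.

Lemma constraint_map_strict : strict_derivative (@constraint_map R N P)
  (z.1, p.2) (fun t => constraint_jac *m t.1 + constraint_jac_w *m t.2).
Proof.
apply: strict_derivative_colvec => i; pose k := sig1 i.
pose P1 (t : strat * wpar) :=
  (submxcol t.1 k : 'cV[R]_(nx P k), submxcol t.2 k : 'cV[R]_(dw P k)).
have P1B t t' : P1 (t - t') = P1 t - P1 t' by rewrite /P1 /= !submxcolB.
have P1n t : `|P1 t| <= `|t|.
  by case: t => x w; rewrite !norm_pair ge_max !le_max !norm_submxcol_le orbT.
have [C1c _] := cstr_pair_C2 (sig2 i).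
have := strict_derivative_comp P1B P1n (C1_strict_derivative (P1 (z.1, p.2)) C1c).
congr strict_derivative; apply/funext => t; first by rewrite mxE.
by rewrite [RHS]mxE constraint_jac_mul constraint_jac_w_mul -diff_pair.
Qed.

End ReferenceJacobians.

(** * Critical pairs and the partition condition *)

Section PolarMultipliers.
Variables (R : realType) (n m : nat) (G : 'M[R]_(m, n)) (S J2 : pred 'I_m).
Variable v : 'cV[R]_n.
Hypothesis independent : forall eta : 'cV[R]_m,
  (forall i, ~~ S i -> eta i 0 = 0) -> G^T *m eta = 0 -> eta = 0.
Hypothesis v_polar : forall y : 'cV[R]_n,
  (forall i, S i -> (G *m y) i 0 = 0 \/ J2 i /\ (G *m y) i 0 <= 0) -> dotv v y <= 0.

(** A Farkas lemma that independence reduces to linear algebra: v is orthogonal to the common kernel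
    of the rows in [S], hence a combination of them, and each sign is read off from a test vector
    that moves a single row. *)
Lemma polar_multipliers : exists eta : 'cV[R]_m,
  [/\ v + G^T *m eta = 0, forall i, ~~ S i -> eta i 0 = 0 &
      forall i, S i -> J2 i -> eta i 0 <= 0].
Proof.
(* [D] masks the rows outside [S], so that [H] keeps the size of [G]. *)
pose D : 'M[R]_m := diag_mx (\row_i (S i)%:R); pose H := D *m G.
have DE (x : 'cV[R]_m) i : (D *m x) i 0 = (S i)%:R * x i 0.
  by rewrite mul_diag_mx !mxE.
have DT : D^T = D by rewrite tr_diag_mx.
have HE (y : 'cV[R]_n) i : S i -> (G *m y) i 0 = (H *m y) i 0.
  by move=> Si; rewrite -mulmxA DE Si mul1r.
have HtE (x : 'cV[R]_m) : H^T *m x = G^T *m (D *m x).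
  by rewrite trmx_mul DT mulmxA.
have : (v^T <= H)%MS.
  rewrite submxE; apply/eqP/rowP => j; rewrite [RHS]mxE.
  have -> : (v^T *m cokermx H) 0 j = dotv v (col j (cokermx H)).
    rewrite mxE /dotv mxE; apply: eq_bigr => k _.
    by rewrite [col _ _ _ _]mxE.
  have Hy : H *m col j (cokermx H) = 0 by rewrite colE mulmxA mulmx_coker mul0mx.
  apply/eqP; rewrite eq_le; apply/andP; split.
    by apply: v_polar => i Si; left; rewrite HE// Hy mxE.
  rewrite -oppr_le0 -dotvNr; apply: v_polar => i Si; left.
  by rewrite HE// mulmxN Hy oppr0 mxE.
move=> /submxP[r vE].
have {}vE : v = H^T *m r^T by rewrite -[v]trmxK vE trmx_mul.
exists (- (D *m r^T)); split.
- by rewrite mulmxN vE HtE subrr.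
- by move=> i /negbTE Si; rewrite mxE DE Si mul0r oppr0.
move=> i Si J2i; rewrite mxE DE Si mul1r.
pose e : 'cV[R]_m := delta_mx i 0.
(* Any kernel vector of H^T vanishes at i by independence, so the basis vector e_i has the form H
   w. *)
have : (e^T <= H^T)%MS.
  rewrite submxE; apply/eqP/rowP => j; rewrite [RHS]mxE.
  pose kap := col j (cokermx H^T).
  have Hk : H^T *m kap = 0 by rewrite /kap colE mulmxA mulmx_coker mul0mx.
  have Dk : D *m kap = 0.
    apply: independent; last by rewrite -HtE.
    by move=> k /negbTE Sk; rewrite DE Sk mul0r.
  have := DE kap i; rewrite Dk Si mul1r mxE /kap mxE => k0.
  by rewrite /e trmx_delta -rowE mxE -k0.
move=> /submxP[w eE].
have Hw : H *m w^T = e by rewrite -[e]trmxK eE trmx_mul trmxK.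
(* The vector - w moves row i by -1 and no other row of [S], so it is admissible because i lies in
   [J2]; polarity gives r_i >= 0. *)
have := v_polar (y := - w^T).
rewrite dotvNr dotvC vE dotv_trmx trmxK Hw.
have -> : dotv e r^T = r^T i 0.
  rewrite dotvE (bigD1 i)//= big1 ?addr0 => [|k ki]; rewrite !mxE ?eqxx ?mul1r//.
  by rewrite (negbTE ki) mul0r.
apply=> k Sk; rewrite HE// mulmxN Hw !mxE eqxx andbT.
by case: eqP => [->|_]; [right; split=> //; rewrite oppr_le0|left; rewrite oppr0].
Qed.

End PolarMultipliers.

Lemma free_enumP (K : fieldType) (vT : vectType K) (I : finType) (A : {set I}) (f : I -> vT) :
  free [seq f i | i <- enum A] <->
  forall e : I -> K, \sum_(i in A) e i *: f i = 0 -> forall i, i \in A -> e i = 0.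
Proof.
have nthE (j : 'I_#|A|) : [seq f i | i <- enum A]`_j = f (enum_val j).
  rewrite (nth_map (enum_val j)) -?cardE//; congr f.
  exact/esym/enum_val_nth.
have freeE : free [seq f i | i <- enum A] <->
    forall k : 'I_#|A| -> K, \sum_(j < #|A|) k j *: f (enum_val j) = 0 -> forall j, k j = 0.
  have sz : size [seq f i | i <- enum A] == #|A| by rewrite size_map -cardE.
  split=> [/(@freeP _ _ _ (Tuple sz)) h k hk|h].
    apply: h; rewrite -[RHS]hk; apply: eq_bigr => j _; congr (_ *: _); exact: nthE.
  apply/(@freeP _ _ _ (Tuple sz)) => k hk; apply: h; rewrite -[RHS]hk.
  by apply: eq_bigr => j _; congr (_ *: _); rewrite -nthE.
rewrite freeE; split=> [h e he i iA|h k hk j].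
  rewrite big_enum_val in he.
  by rewrite -(enum_rankK_in iA iA); exact: (h (fun j => e (enum_val j)) he).
have x0A := enum_valP j.
have := h (fun i => k (enum_rank_in x0A i)) _ _ x0A; rewrite enum_valK_in; apply.
by rewrite big_enum_val -[RHS]hk; apply: eq_bigr => i _; rewrite enum_valK_in.
Qed.


Section Transfer.
Variables (R : realType) (N : nat) (P : nep R N).
Import tagnat.

Local Notation strat := 'cV[R]_(\sum_(k < N) nx P k).
Local Notation mult := 'cV[R]_(\sum_(k < N) mc P k).
Local Notation wpar := 'cV[R]_(\sum_(k < N) dw P k).

Variables (p : mult * strat * wpar) (z : strat * mult).
Hypothesis kkt : S_KKT (P := P) p z.

Let xi0 : mult := z.2 + (@constraint_map R N P (z.1, p.2) - p.1.1).
Let A1 := [pred i | @is_equality R N P i || (0 < xi0 i 0)].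
Let A0 := [pred i | ~~ @is_equality R N P i && (xi0 i 0 < 0)].
Let G := constraint_jac p z.

Lemma xi0E i : xi0 i 0 = submxcol z.2 (sig1 i) (sig2 i) 0 + slack p z (sig2 i).
Proof. by rewrite /slack /wblk /ublk !submxcol_sig !mxE. Qed.

Lemma kkt_inequality i : ~~ @is_equality R N P i ->
  [/\ 0 <= submxcol z.2 (sig1 i) (sig2 i) 0, slack p z (sig2 i) <= 0 &
      submxcol z.2 (sig1 i) (sig2 i) 0 * slack p z (sig2 i) = 0].
Proof.
rewrite /is_equality -leqNgt => hi; have [_ _ /(_ _ hi)[h1 h2 h3]] := kkt (sig1 i).
by split=> //; rewrite /slack subr_le0.
Qed.

(** On inequality indices complementarity makes the sign of xi0_i distinguish the three sets:
    positive for I_1, zero for I_2, negative for I_3. *)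
Lemma mem_I1 i : (sig2 i \in I1 p z (sig1 i)) = A1 i.
Proof.
rewrite inE /= -/(is_equality i); case: (boolP (is_equality i)) => //= Ei.
have [h1 h2 h3] := kkt_inequality Ei; rewrite xi0E.
move: Ei; rewrite /is_equality -leqNgt => -> /=.
move: (submxcol _ _ _ _) (slack _ _ _) h1 h2 h3 => l s h1 h2 /eqP.
rewrite mulf_eq0 => /orP[/eqP e|/eqP e]; rewrite e.
  by rewrite ltxx add0r; apply/esym/negbTE; rewrite -leNgt.
by rewrite addr0 eqxx andbT.
Qed.

Lemma mem_I3 i : (sig2 i \in I3 p z (sig1 i)) = A0 i.
Proof.
rewrite inE /=; case: (boolP (is_equality i)) => [Ei|Ei] /=.
  by move: Ei; rewrite /is_equality ltnNge => /negbTE ->.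
have [h1 h2 h3] := kkt_inequality Ei; rewrite xi0E.
move: Ei; rewrite /is_equality -leqNgt => -> /=.
move: (submxcol _ _ _ _) (slack _ _ _) h1 h2 h3 => l s h1 h2 /eqP.
rewrite mulf_eq0 => /orP[/eqP e|/eqP e]; rewrite e.
  by rewrite eqxx add0r.
by rewrite addr0 ltxx andbF; apply/esym/negbTE; rewrite -leNgt.
Qed.

Lemma mem_I2 i : (sig2 i \in I2 p z (sig1 i)) = ~~ A1 i && ~~ A0 i.
Proof.
rewrite inE /=; case: (boolP (is_equality i)) => [Ei|Ei] /=.
  by move: Ei; rewrite /is_equality ltnNge => /negbTE ->.
have [h1 h2 h3] := kkt_inequality Ei; rewrite xi0E.
move: Ei; rewrite /is_equality -leqNgt => -> /=.
move: (submxcol _ _ _ _) (slack _ _ _) h1 h2 h3 => l s h1 h2 /eqP.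
rewrite -!leNgt mulf_eq0 => /orP[/eqP e|/eqP e]; rewrite e.
  by rewrite eqxx add0r h2 /= eq_le h2.
by rewrite eqxx andbT addr0 h1 andbT eq_le h1 andbT.
Qed.

Lemma A1_A0_disjoint i : A1 i -> A0 i -> False.
Proof. by rewrite /A1 /A0/=; case: is_equality => //= h1 /(lt_trans h1); rewrite ltxx. Qed.

Lemma Kcone_flat J1 J2 (y : strat) : Kcone p z J1 J2 y <->
  forall i, (sig2 i \in J1 (sig1 i) -> (G *m y) i 0 = 0) /\
            (sig2 i \in J2 (sig1 i) -> (G *m y) i 0 <= 0).
Proof.
pose Q k (i : 'I_(mc P k)) :=
  (i \in J1 k -> dotv (grad_cstr p z i) (submxcol y k) = 0) /\
  (i \in J2 k -> dotv (grad_cstr p z i) (submxcol y k) <= 0).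
split=> [h i|h k].
  by rewrite constraint_jac_dotv; split=> hi; [exact: (h _).1|exact: (h _).2].
have {}h : forall k i, Q k i.
  by apply/tagnat_forall => i; have := h i; rewrite constraint_jac_dotv.
by split=> i; have [] := h k i.
Qed.

Lemma submxcol_delta_sig (a : 'I_(\sum_(k < N) nx P k)) :
  submxcol (delta_mx a 0 : strat) (sig1 a) = delta_mx (sig2 a) 0.
Proof.
apply/colP => b; rewrite !mxE andbT eqxx andbT; congr ((_ : bool)%:R).
rewrite -[X in _ == X](sig2K a); apply/eqP/eqP => [/rank_inj e|->//].
by apply/eqP; have := eq_Tagged; move/eqP: e; rewrite eq_Tagged.
Qed.

Lemma cstr_partial_grad (a : 'I_(\sum_(k < N) nx P k)) (i : 'I_(mc P (sig1 a))) :
  cstr_partial i a (submxcol z.1 (sig1 a), wblk p (sig1 a)) =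
  grad_cstr p z i (sig2 a) 0.
Proof.
rewrite /cstr_partial submxcol_delta_sig mxE.
have dc t : differentiable (@cstr_pair R N P (sig1 a) i) t.
  by have [[]] := cstr_pair_C2 i.
have [_ e] := is_derive_slice (l := id) (delta_mx (sig2 a) 0) (fun h v x => erefl)
  (dc (submxcol z.1 (sig1 a), wblk p (sig1 a))).
exact: esym e.
Qed.

Lemma constraint_jac_tr_eq0 (eta : mult) : G^T *m eta = 0 <->
  forall k, \sum_(i < mc P k) submxcol eta k i 0 *: grad_cstr p z i = 0.
Proof.
have E a : (G^T *m eta) a 0 =
    (\sum_i submxcol eta (sig1 a) i 0 *: grad_cstr p z i) (sig2 a) 0.
  rewrite constraint_jac_tr_mul summxE; apply: eq_bigr => i _.
  by rewrite [RHS]mxE cstr_partial_grad.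
split=> [h k|h].
  pose Q k (a : 'I_(nx P k)) := (\sum_(i < mc P k) submxcol eta k i 0 *: grad_cstr p z i) a 0 = 0.
  have {}h : forall k a, Q k a.
    by apply/tagnat_forall => a; rewrite /Q -E h mxE.
  by apply/colP => a; rewrite [RHS]mxE; exact: h.
by apply/colP => a; rewrite E h !mxE.
Qed.

Lemma LICQ_flat : (forall k, LICQ p z k) <->
  forall eta : mult, (forall i, A0 i -> eta i 0 = 0) -> G^T *m eta = 0 -> eta = 0.
Proof.
split=> [licq eta eta0 /constraint_jac_tr_eq0 h|h k].
  pose Q k (i : 'I_(mc P k)) := i \notin (I1 p z k :|: I2 p z k)%SET -> submxcol eta k i 0 = 0.
  have off : forall k i, Q k i.
    apply/tagnat_forall => i; rewrite /Q finset.in_setU mem_I1 mem_I2 submxcol_sig => hi.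
    by apply: eta0; move: hi; case: (A1 i) => //=; rewrite negbK.
  pose Q' k (i : 'I_(mc P k)) := submxcol eta k i 0 = 0.
  have all0 : forall k i, Q' k i.
    move=> k i; have [iA|/off//] := boolP (i \in (I1 p z k :|: I2 p z k)%SET).
    apply: (free_enumP _ _).1 (licq k) (fun i => submxcol eta k i 0) _ i iA.
    rewrite -[RHS](h k) [RHS](bigID (fun i => i \in (I1 p z k :|: I2 p z k)%SET))/=.
    by rewrite [X in _ = _ + X]big1 ?addr0// => j /off ->; rewrite scale0r.
  by apply/colP => i; rewrite -[eta i 0]submxcol_sig all0 mxE.
apply/free_enumP => e he i iA.
pose A := (I1 p z k :|: I2 p z k)%SET.
(* The coefficients of player k, extended by zero to the other players and to the inactive
   constraints. *)
pose eta : mult := \sum_(j in A) e j *: delta_mx (Rank k j) 0.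
have etaE k' (i' : 'I_(mc P k')) : submxcol eta k' i' 0 =
    \sum_(j in A) e j * (Rank k' i' == Rank k j)%:R.
  by rewrite mxE summxE; apply: eq_bigr => j _; rewrite !mxE andbT.
have eta_k (i' : 'I_(mc P k)) : submxcol eta k i' 0 = (i' \in A)%:R * e i'.
  rewrite etaE; have [i'A|i'A] := boolP (i' \in A).
    rewrite (bigD1 i')//= eqxx mulr1 big1 ?addr0 ?mul1r// => j /andP[_ ji].
    rewrite [_ == _](_ : _ = false) ?mulr0//; apply/eqP => /rank_inj /eqP.
    by rewrite eq_Tagged /= eq_sym (negbTE ji).
  rewrite big1 ?mul0r// => j jA.
  rewrite [_ == _](_ : _ = false) ?mulr0//; apply/eqP => /rank_inj /eqP.
  by rewrite eq_Tagged /= => /eqP ij; rewrite ij jA in i'A.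
have eta_k' k' (i' : 'I_(mc P k')) : k' != k -> submxcol eta k' i' 0 = 0.
  move=> kk'; rewrite etaE big1// => j _.
  rewrite [_ == _](_ : _ = false) ?mulr0//; apply/eqP => /rank_inj.
  by move=> /(congr1 tag)/= e'; rewrite e' eqxx in kk'.
have eta0 : eta = 0.
  apply: h.
    move=> j A0j; rewrite -submxcol_sig.
    have [e'|/eta_k'//] := eqVneq (sig1 j) k.
    have : sig2 j \notin (I1 p z (sig1 j) :|: I2 p z (sig1 j))%SET.
      rewrite finset.in_setU mem_I1 mem_I2 A0j andbF orbF.
      by apply/negP => /A1_A0_disjoint; apply.
    move: (sig2 j); rewrite e' => i' i'A.
    by rewrite eta_k (negbTE i'A) mul0r.
  apply/constraint_jac_tr_eq0 => k'; have [->|kk'] := eqVneq k' k; last first.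
    by apply: big1 => i' _; rewrite eta_k'// scale0r.
  rewrite -[RHS]he [RHS]big_mkcond/=; apply: eq_bigr => i' _; rewrite eta_k /A.
  by case: (i' \in _); rewrite ?mul1r// mul0r scale0r.
have := eta_k i; rewrite eta0 submxcol0 mxE /A iA mul1r => ->.
by [].
Qed.

Lemma critical_pairs_trivial_iff :
  (forall y eta, critical_pair (stationarity_jac p z) G A1 A0 y eta -> y = 0 /\ eta = 0) <->
  (forall k, LICQ p z k) /\
  (forall J1 J2 J3 : forall k, {set 'I_(mc P k)},
     index_partition p z J1 J2 J3 ->
     forall y, Kcone p z J1 J2 y ->
       polar (Kcone p z J1 J2) (critical_matrix p z *m y) -> y = 0).
Proof.
rewrite LICQ_flat critical_matrix_jac; split=> [crit0|[licq hJ] y eta [stat crit]].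
  (* With y = 0 all conditions on G y hold, so LICQ is the statement about the pairs (0, eta). *)
  have licq (eta : mult) : (forall i, A0 i -> eta i 0 = 0) -> G^T *m eta = 0 -> eta = 0.
    move=> eta0 Geta; apply: (crit0 0 eta _).2; split.
      by rewrite mulmx0 add0r.
    by move=> i; rewrite mulmx0 mxE; split=> //; [exact: eta0|apply: Or31].
  split=> // J1 J2 J3 part y /Kcone_flat Ky polar_y.
  pose S := [pred i | (sig2 i \in J1 (sig1 i)) || (sig2 i \in J2 (sig1 i))].
  have A0_notS i : A0 i -> ~~ S i.
    rewrite -mem_I3 => iI3; have [_ [/finset.setP d12 /finset.setP d13 /finset.setP d23] _ ] := part (sig1 i).
    move=> /andP[/fintype.subsetP/(_ _ iI3) iJ3 _]; rewrite negb_or; apply/andP; split.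
      by have := d13 (sig2 i); rewrite finset.in_setI finset.in_set0 iJ3 andbT => ->.
    by have := d23 (sig2 i); rewrite finset.in_setI finset.in_set0 iJ3 andbT => ->.
  have A1_J1 i : A1 i -> sig2 i \in J1 (sig1 i).
    rewrite -mem_I1 => iI1; have [_ _ /andP[/fintype.subsetP sub _] _] := part (sig1 i).
    exact: sub.
  have J2_notJ1 i : sig2 i \in J2 (sig1 i) -> sig2 i \notin J1 (sig1 i).
    move=> iJ2; have [_ [/finset.setP/(_ (sig2 i)) + _ _] _ _] := part (sig1 i).
    by rewrite finset.in_setI finset.in_set0 iJ2 andbT => ->.
  (* Polarity of J^T y supplies the multipliers that complete y to a critical pair; LICQ gives the
     required independence since [S] avoids I_3. *)
  have [||eta [stat eta0 eta_neg]] := @polar_multipliers R _ _ G S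
     [pred i | sig2 i \in J2 (sig1 i)] ((stationarity_jac p z)^T *m y).
  - by move=> eta eta0; apply: licq => i /A0_notS; exact: eta0.
  - move=> y' hy'; apply: polar_y; apply/Kcone_flat => i; split=> hi.
      have [|//|[/= /J2_notJ1]] := hy' i; first by rewrite /S/= hi.
      by rewrite hi.
    have [|->//|[]//] := hy' i; by rewrite /S/= hi orbT.
  apply: (crit0 y eta _).1; split=> // i; split.
  - by move=> /A1_J1; exact: (Ky i).1.
  - by move=> /A0_notS; exact: eta0.
  have [Si|/eta0 e0] := boolP (S i); last by apply: Or32.
  move: (Si); rewrite /S/= => /orP[iJ1|iJ2]; first by apply: Or31; exact: (Ky i).1.
  have gy := (Ky i).2 iJ2; have en := eta_neg i Si iJ2.
  have [g0|g0] := eqVneq ((G *m y) i 0) 0; first by apply: Or31.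
  have [e0|e0] := eqVneq (eta i 0) 0; first by apply: Or32.
  by apply: Or33; rewrite !lt_neqAle g0 e0 gy en.
pose Gy k (i : 'I_(mc P k)) := dotv (grad_cstr p z i) (submxcol y k) == 0.
pose et k (i : 'I_(mc P k)) := submxcol eta k i 0 == 0.
(* The pair dictates the partition: a degenerate index goes to J_1 if (G y)_i = 0, otherwise to J_3
   if eta_i = 0, and to J_2 if both are nonzero, hence negative. *)
pose J1 k := finset (fun i : 'I_(mc P k) => (i \in I1 p z k) || (i \in I2 p z k) && Gy k i).
pose J2 k := finset (fun i : 'I_(mc P k) => [&& i \in I2 p z k, ~~ Gy k i & ~~ et k i]).
pose J3 k := finset (fun i : 'I_(mc P k) =>
  (i \in I3 p z k) || [&& i \in I2 p z k, ~~ Gy k i & et k i]).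
have J1E k i : (i \in J1 k) = (i \in I1 p z k) || (i \in I2 p z k) && Gy k i.
  by rewrite /J1 finset.in_set.
have J2E k i : (i \in J2 k) = [&& i \in I2 p z k, ~~ Gy k i & ~~ et k i].
  by rewrite /J2 finset.in_set.
have J3E k i : (i \in J3 k) = (i \in I3 p z k) || [&& i \in I2 p z k, ~~ Gy k i & et k i].
  by rewrite /J3 finset.in_set.
have GyE i : Gy (sig1 i) (sig2 i) = ((G *m y) i 0 == 0) by rewrite constraint_jac_dotv.
have etE i : et (sig1 i) (sig2 i) = (eta i 0 == 0) by rewrite /et submxcol_sig.
(* Membership in exactly one of I_1, I_2, I_3, written as a sum so that the partition axioms reduce
   to a Boolean case check. *)
pose once k (i : 'I_(mc P k)) :=
  ((i \in I1 p z k) + (i \in I2 p z k) + (i \in I3 p z k) = 1)%N.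
have once_all : forall k i, once k i.
  apply/tagnat_forall => i; rewrite /once mem_I1 mem_I2 mem_I3.
  have := @A1_A0_disjoint i; case: (A1 i); case: (A0 i) => //= h.
  by case: (h isT isT).
have y0 : y = 0.
  apply: (hJ J1 J2 J3).
  - move=> k; split.
    + apply/finset.setP => i; rewrite !finset.in_setU finset.in_setT J1E J2E J3E.
      have := once_all k i; rewrite /once.
      by case: (i \in I1 p z k); case: (i \in I2 p z k); case: (i \in I3 p z k);
         case: (Gy k i); case: (et k i).
    + split; apply/finset.setP => i; rewrite !finset.in_setI ?J1E ?J2E ?J3E finset.in_set0;
      have := once_all k i; rewrite /once;
      by case: (i \in I1 p z k); case: (i \in I2 p z k); case: (i \in I3 p z k);
         case: (Gy k i); case: (et k i).
    + apply/andP; split; apply/fintype.subsetP => i; rewrite ?finset.in_setU ?J1E ?J3E;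
      by case: (i \in I1 p z k); case: (i \in I2 p z k).
    + apply/andP; split; apply/fintype.subsetP => i; rewrite ?finset.in_setU ?J1E ?J3E;
      by case: (i \in I3 p z k); case: (i \in I2 p z k).
  - apply/Kcone_flat => i; have [c1 c0 cd] := crit i.
    rewrite J1E J2E GyE etE mem_I1 mem_I2; split.
      by case/orP => [/c1//|/andP[_ /eqP]].
    case/and3P => _ g0 e0; case: cd => [/eqP|/eqP|[/ltW//]].
      by rewrite (negbTE g0).
    by rewrite (negbTE e0).
  move=> y' /Kcone_flat Ky'.
  have -> : (stationarity_jac p z)^T *m y = - (G^T *m eta).
    by apply/eqP; rewrite -addr_eq0 stat eqxx.
  (* Every eta_i (G y')_i is nonnegative: the second factor vanishes on J_1, the first on J_3, and
     both are nonpositive on J_2. *)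
  rewrite dotvC dotvNr oppr_le0 dotv_trmx trmxK dotvE sumr_ge0// => i _.
  have [c1 c0 cd] := crit i; have [k1 k2] := Ky' i.
  move: k1 k2; rewrite J1E J2E GyE etE mem_I1 mem_I2.
  have [a0|a0] := boolP (A0 i); first by rewrite c0// mulr0.
  case: (A1 i) => /=; first by move=> ->; rewrite ?mul0r.
  case: eqP => /= [_ ->//|g0 _]; first by rewrite mul0r.
  case: eqP => /= [-> _|e0]; first by rewrite mulr0.
  move=> /(_ isT) gy'; by case: cd => [/g0//|/e0//|[_ /ltW e_le]]; rewrite mulr_le0.
split=> //; apply: licq => [i|]; first by have [_ + _] := crit i.
by move: stat; rewrite y0 mulmx0 add0r.
Qed.

End Transfer.

Theorem theorem3p1 (R : realType) (N : nat) (P : nep R N)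
    (pbar : 'cV[R]_(\sum_(k < N) mc P k) * 'cV[R]_(\sum_(k < N) nx P k)
            * 'cV[R]_(\sum_(k < N) dw P k))
    (zbar : 'cV[R]_(\sum_(k < N) nx P k) * 'cV[R]_(\sum_(k < N) mc P k)) :
  S_KKT pbar zbar ->
  (lipschitz_localization (@S_KKT R N P) pbar zbar <->
  (forall k, LICQ pbar zbar k) /\
  (forall J1 J2 J3 : forall k, {set 'I_(mc P k)},
     index_partition pbar zbar J1 J2 J3 ->
     forall y, Kcone pbar zbar J1 J2 y ->
       polar (Kcone pbar zbar J1 J2) (critical_matrix pbar zbar *m y) ->
       y = 0)).
Proof.
move=> kkt; rewrite -critical_pairs_trivial_iff//.
have flatE : @S_KKT R N P =
    kkt_system (@is_equality R N P) (@stationarity_map R N P) (@constraint_map R N P).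
  by apply/funext => p; exact: S_KKT_kkt_system.
have F_strict := stationarity_map_strict pbar zbar.
have c_strict := constraint_map_strict pbar zbar.
move: kkt; rewrite flatE => kkt; split.
  exact: kkt_system_localization_critical F_strict c_strict kkt.
exact: kkt_system_localization F_strict c_strict kkt.
Qed.
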